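(* Let $\mathsf{L}$ be a super-intuitionistic logic of infinite branching which has a Frege system, and let $\mathsf{L}-\mathbf{EF}$ denote the extended Frege system for $\mathsf{L}$. (i) Let $\mathbf{P}$ be a proof system for a logic with the language $\mathcal{L}^*=\{\wedge,\vee,*,\setminus,/,1,0\}$ such that $\mathbf{P}$ is at least as strong as $\mathbf{FL}$ and $\mathbf{P}\leq^{t}\mathsf{L}-\mathbf{EF}$. Then $\mathbf{P}\vdash\Theta^*_n$ for all $n\ge 1$, and the length of any such proof is exponential in $n$. (ii) Let $\mathbf{P}$ be a proof system for a logic with the language $\mathcal{L}=\{\wedge,\vee,\to,\top,\bot\}$ such that $\mathbf{P}$ is at least as strong as $\mathbf{BPC}$ and $\mathbf{P}\leq\mathsf{L}-\mathbf{EF}$. Then $\mathbf{P}\vdash(\Theta^*_n)^t$ for all $n\ge 1$, and the length of any such proof is exponential in $n$.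
   Context: **Convention.** ''Exponential in $n$'' means bounded below by $2^{n^{\Omega(1)}}$, i.e. there is $\varepsilon>0$ (depending on the systems but not on $n$) such that the quantity is at least $2^{n^{\varepsilon}}$ for all sufficiently large $n$. **Proof systems.** A proof system for a set $\mathsf{L}$ of finite strings over a finite alphabet is a polynomial-time computable function $\mathbf{P}$ with range $\mathsf{L}$; $\pi$ is a $\mathbf{P}$-proof of $\phi$ (written $\mathbf{P}\vdash^{\pi}\phi$) if $\mathbf{P}(\pi)=\phi$. $|\phi|,|\pi|$ denote length (number of symbols). Let $\mathbf{P},\mathbf{Q}$ be proof systems for logics $\mathsf{L}_{\mathbf P},\mathsf{L}_{\mathbf Q}$ and $tr$ a polynomial-time translation from strings in the language of $\mathbf P$ to strings in the language of $\mathbf Q$. $\mathbf{Q}$ is at least as strong as $\mathbf{P}$ with respect to $tr$ if for every $\pi$ there is $\pi'$ with $tr(\mathbf{P}(\pi))=\mathbf{Q}(\pi')$. $\mathbf{P}\leq^{tr}\mathbf{Q}$ ($\mathbf Q$ simulates $\mathbf P$) if there is a polynomial $g$ such that for every $\pi$ there is $\pi'$ with $tr(\mathbf{P}(\pi))=\mathbf{Q}(\pi')$ and $|\pi'|\le g(|\pi|)$. When $tr$ is the inclusion, it is omitted from the notation. Sequent calculi are regarded as proof systems for their logics: the logic of a calculus is the set of $\phi$ with $(\Rightarrow\phi)$ provable. **Translation $t$** from $\mathcal{L}^*$-formulas to $\mathcal{L}$-formulas: $p^t=p$ for variables, $0^t=\bot$, $1^t=\top$, $(\phi\circ\psi)^t=\phi^t\circ\psi^t$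 for $\circ\in\{\wedge,\vee\}$, $(\phi*\psi)^t=\phi^t\wedge\psi^t$, $(\psi/\phi)^t=(\phi\setminus\psi)^t=\phi^t\to\psi^t$. **The calculus $\mathbf{FL}$** over $\mathcal{L}^*$. Sequents $\Gamma\Rightarrow\Delta$, with $\Gamma$ a finite sequence of formulas and $\Delta$ empty or a single formula. Initial sequents: $\phi\Rightarrow\phi$; $\Rightarrow 1$; $0\Rightarrow$. Rules (premises / conclusion): (cut) $\Gamma\Rightarrow\phi$ and $\Sigma,\phi,\Pi\Rightarrow\Delta$ / $\Sigma,\Gamma,\Pi\Rightarrow\Delta$; $(1w)$ $\Gamma,\Sigma\Rightarrow\Delta$ / $\Gamma,1,\Sigma\Rightarrow\Delta$; $(0w)$ $\Gamma\Rightarrow$ / $\Gamma\Rightarrow 0$; $(L\wedge)$ $\Gamma,\phi,\Sigma\Rightarrow\Delta$ (or $\Gamma,\psi,\Sigma\Rightarrow\Delta$) / $\Gamma,\phi\wedge\psi,\Sigma\Rightarrow\Delta$; $(R\wedge)$ $\Gamma\Rightarrow\phi$ and $\Gamma\Rightarrow\psi$ / $\Gamma\Rightarrow\phi\wedge\psi$; $(L\vee)$ $\Gamma,\phi,\Sigma\Rightarrow\Delta$ and $\Gamma,\psi,\Sigma\Rightarrow\Delta$ / $\Gamma,\phi\vee\psi,\Sigma\Rightarrow\Delta$; $(R\vee)$ $\Gamma\Rightarrow\phi$ (or $\Gamma\Rightarrow\psi$) / $\Gamma\Rightarrow\phi\vee\psi$; $(L* )$ $\Gamma,\phi,\psi,\Sigma\Rightarrow\Delta$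 / $\Gamma,\phi*\psi,\Sigma\Rightarrow\Delta$; $(R* )$ $\Gamma\Rightarrow\phi$ and $\Sigma\Rightarrow\psi$ / $\Gamma,\Sigma\Rightarrow\phi*\psi$; $(L/)$ $\Gamma\Rightarrow\phi$ and $\Pi,\psi,\Sigma\Rightarrow\delta$ / $\Pi,\psi/\phi,\Gamma,\Sigma\Rightarrow\delta$; $(R/)$ $\Gamma,\phi\Rightarrow\psi$ / $\Gamma\Rightarrow\psi/\phi$; $(L\setminus)$ $\Gamma\Rightarrow\phi$ and $\Pi,\psi,\Sigma\Rightarrow\delta$ / $\Pi,\Gamma,\phi\setminus\psi,\Sigma\Rightarrow\delta$; $(R\setminus)$ $\phi,\Gamma\Rightarrow\psi$ / $\Gamma\Rightarrow\phi\setminus\psi$. **The calculus $\mathbf{BPC}$** (Visser's basic propositional calculus) over $\mathcal{L}$. Sequents $\Upsilon\Rightarrow\Xi$ with $\Upsilon,\Xi$ finite multisets. Initial sequents: $\Upsilon,\phi\Rightarrow\phi,\Xi$; $\Upsilon\Rightarrow\top,\Xi$; $\Upsilon,\bot\Rightarrow\Xi$. Rules: $(L\wedge)$ $\phi,\psi,\Upsilon\Rightarrow\Xi$ / $\phi\wedge\psi,\Upsilon\Rightarrow\Xi$; $(R\wedge)$ $\Upsilon\Rightarrow\Xi,\phi$ and $\Upsilon\Rightarrow\Xi,\psi$ / $\Upsilon\Rightarrow\Xi,\phi\wedge\psi$; $(L\vee)$ $\phi,\Upsilon\Rightarrow\Xi$ and $\psi,\Upsilon\Rightarrow\Xi$ /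 $\phi\vee\psi,\Upsilon\Rightarrow\Xi$; $(R\vee)$ $\Upsilon\Rightarrow\Xi,\phi,\psi$ / $\Upsilon\Rightarrow\Xi,\phi\vee\psi$; $(R\to)$ $\phi,\Upsilon\Rightarrow\psi$ / $\Upsilon\Rightarrow\Xi,\phi\to\psi$; $(D)$ $\phi\wedge\psi,\Upsilon\Rightarrow\Xi$ and $\phi\wedge\theta,\Upsilon\Rightarrow\Xi$ / $\phi\wedge(\psi\vee\theta),\Upsilon\Rightarrow\Xi$; $(Tr)$ $\Upsilon\Rightarrow\phi\to\psi$ and $\Upsilon\Rightarrow\psi\to\theta$ / $\Upsilon\Rightarrow\Xi,\phi\to\theta$; $(F\wedge)$ $\Upsilon\Rightarrow\phi\to\psi$ and $\Upsilon\Rightarrow\phi\to\theta$ / $\Upsilon\Rightarrow\Xi,\phi\to(\psi\wedge\theta)$; $(F\vee)$ $\Upsilon\Rightarrow\phi\to\theta$ and $\Upsilon\Rightarrow\psi\to\theta$ / $\Upsilon\Rightarrow\Xi,(\phi\vee\psi)\to\theta$; (cut) $\Upsilon_1\Rightarrow\phi,\Xi_1$ and $\Upsilon_2,\phi\Rightarrow\Xi_2$ / $\Upsilon_1,\Upsilon_2\Rightarrow\Xi_1,\Xi_2$. **Super-intuitionistic logics.** A consequence relation $\vdash_{\mathsf L}$ is a relation between sets of formulas and formulas that is closed under substitution, reflexive ($\phi\in\Upsilon$ implies $\Upsilon\vdash_{\mathsf L}\phi$), transitive (if $\Upsilon\vdash_{\mathsf L}\phi$ and $\Xi\vdash_{\mathsf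 L}\gamma$ for all $\gamma\in\Upsilon$ then $\Xi\vdash_{\mathsf L}\phi$) and finitary; its logic is $\mathsf{L}=\{\phi:\ \vdash_{\mathsf L}\phi\}$. It is super-intuitionistic if it is over $\mathcal{L}$ and is closed under the initial sequents and rules of the standard intuitionistic sequent calculus $\mathbf{LJ}$ (reading a sequent $\Upsilon\Rightarrow\Xi$ as $\Upsilon\vdash_{\mathsf L}\bigvee\Xi$, empty disjunction being $\bot$); its logic is then called super-intuitionistic. $\mathsf{T_k}$ is the super-intuitionistic logic axiomatized over intuitionistic logic $\mathsf{IPC}$ by $\bigwedge_{i=0}^{k}\big((p_i\to\bigvee_{j\ne i}p_j)\to\bigvee_j p_j\big)\to\bigvee_i p_i$. $\mathsf L$ has branching $k$ if $\mathsf{T_k}\subseteq\mathsf{L}$; it has infinite branching if it has branching $k$ for no $k$. **Frege systems.** An inference system is given by a set of rules $\phi_1,\dots,\phi_m\,/\,\phi$ ($m\ge 0$); a proof of $\phi$ from a set $X$ is a sequence of formulas ending in $\phi$, each in $X$ or derived from earlier ones by a substitution instance of a rule. It is a Frege system for $\mathsf{L}$ if it has finitely many rules, is sound (provable formulas are in $\mathsf L$), strongly complete ($\phi_1,\dots,\phi_n\vdash_{\mathsf L}\phi$ implies $\phi$ is derivable from $\phi_1,\dots,\phi_n$), and every rule $\phi_1,\dots,\phi_m/\phi$ satisfies $\phi_1,\dots,\phi_m\vdash_{\mathsf L}\phi$. An extended Frege system for $\mathsf{L}$ is a Frege system for $\mathsf L$ together with the extension axiom: one may add a line $(p\to\phi)\wedge(\phi\to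 p)$, where $p$ is a variable not occurring in $\phi$, in any earlier line, in any hypothesis, or in the last line. All extended Frege systems for $\mathsf L$ are polynomially equivalent, so $\mathsf{L}-\mathbf{EF}$ denotes any of them. **The formulas.** For $1\le k\le n$ use variables $p_{i,j},q_{i,j}$ ($0\le i,j<n$), $s_{i,l},s'_{i,l}$ ($0\le i<n$, $0\le l<k$), $r_{i,l},r'_{i,l}$ ($0\le i<n$, $0\le l<k+1$), and put $$\alpha^k_n(\bar p,\bar s,\bar s'):=\bigvee_{i<n}\bigwedge_{l<k}s'_{i,l}\ \vee\bigvee_{i,j<n}\bigvee_{l<k}(s_{i,l}\wedge s_{j,l}\wedge p_{i,j}),$$ $$\beta^{k+1}_n(\bar q,\bar r,\bar r'):=\bigvee_{l<k+1}\bigwedge_{i<n}r'_{i,l}\ \vee\bigvee_{i,j<n}\bigvee_{l<m<k+1}(r_{i,l}\wedge r_{j,m}\wedge q_{i,j}).$$ With $\bigotimes$ denoting iterated fusion $*$ in lexicographic order of the indices, $$\Theta^*_{n,k}:=\Big[\bigotimes_{i,j<n}((p_{i,j}\wedge1)\vee(q_{i,j}\wedge1))\Big]\setminus\Big(\Big[\bigotimes_{i<n,\,l<k}((s_{i,l}\wedge1)\vee(s'_{i,l}\wedge1))\setminus\alpha^k_n\Big]\vee\Big[\bigotimes_{i<n,\,l<k+1}((r_{i,l}\wedge1)\vee(r'_{i,l}\wedge1))\setminus\beta^{k+1}_n\Big]\Big),$$ and $\Theta^*_n:=\Theta^*_{n,\lfloor\sqrt n\rfloor}$. *)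

(* Defs.v *)
From HB Require Import structures.
From Stdlib Require Import NArith Permutation.
From mathcomp Require Import all_boot all_order all_algebra.
From mathcomp Require Import boolp classical_sets reals exp.
From mathcomp Require Import zify.

Set Implicit Arguments.
Unset Strict Implicit.
Unset Printing Implicit Defensive.

Import Order.TTheory GRing.Theory Num.Theory.

Local Open Scope classical_set_scope.
Local Open Scope nat_scope.

Inductive formula (C B : Type) : Type :=
| Var of nat
| Con of C
| Bin of B & formula C B & formula C B.
Arguments Var {C B}.
Arguments Con {C B}.
Arguments Bin {C B}.

Section Syntax.
Variables C B : Type.

Fixpoint subst (s : nat -> formula C B) (f : formula C B) : formula C B :=
  match f with
  | Var x => s x
  | Con c => Con c
  | Bin b g h => Bin b (subst s g) (subst s h)
  end.

Fixpoint occurs (x : nat) (f : formula C B) : bool :=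
  match f with
  | Var y => x == y
  | Con _ => false
  | Bin _ g h => occurs x g || occurs x h
  end.

(* No unit is appended: on a nonempty list this is the right-nested
   [f1 b (f2 b (... b fm))]; the value [e] is used only on the empty list. *)
Fixpoint iterop_form (b : B) (e : formula C B) (s : seq (formula C B)) :=
  match s with
  | [::] => e
  | f :: s' => if s' is [::] then f else Bin b f (iterop_form b e s')
  end.

End Syntax.

(* A formula is written fully parenthesised and infix. The variable of index [x]
   is the binary expansion of [x], least significant digit first, followed by
   [VarEnd]. *)
Inductive letter (C B : Type) : Type :=
| LPar | RPar | VarEnd | Digit of bool | Cst of C | Op of B.
Arguments LPar {C B}.
Arguments RPar {C B}.
Arguments VarEnd {C B}.
Arguments Digit {C B}.
Arguments Cst {C B}.
Arguments Op {C B}.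

Section LetterFin.
Variables C B : Type.

Definition letter_code (a : letter C B) : option bool + (bool + (C + B)) :=
  match a with
  | LPar => inl None
  | RPar => inl (Some true)
  | VarEnd => inl (Some false)
  | Digit d => inr (inl d)
  | Cst c => inr (inr (inl c))
  | Op b => inr (inr (inr b))
  end.

Definition letter_decode (a : option bool + (bool + (C + B))) : letter C B :=
  match a with
  | inl None => LPar
  | inl (Some true) => RPar
  | inl (Some false) => VarEnd
  | inr (inl d) => Digit d
  | inr (inr (inl c)) => Cst c
  | inr (inr (inr b)) => Op b
  end.

Lemma letter_codeK : cancel letter_code letter_decode.
Proof. by case. Qed.

End LetterFin.

HB.instance Definition _ (C B : finType) :=
  Finite.copy (letter C B) (can_type (@letter_codeK C B)).

Fixpoint pos_bits (p : positive) : seq bool :=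
  match p with
  | xH => [:: true]
  | xO p' => false :: pos_bits p'
  | xI p' => true :: pos_bits p'
  end.

Definition bits (n : nat) : seq bool :=
  if bin_of_nat n is Npos p then pos_bits p else [::].

Lemma pos_bits_neq0 p : pos_bits p <> [::].
Proof. by case: p. Qed.

Lemma pos_bits_inj : injective pos_bits.
Proof.
elim=> [p IH|p IH|] [q|q|] //= [].
- by move/IH->.
- by move/pos_bits_neq0.
- by move/IH->.
- by move/esym/pos_bits_neq0.
Qed.

Lemma bits_inj : injective bits.
Proof.
move=> m n; rewrite /bits => e.
apply: (can_inj bin_of_natK); move: e.
case: (bin_of_nat m) => [|p]; case: (bin_of_nat n) => [|q] //.
- by move/esym/pos_bits_neq0.
- by move/pos_bits_neq0.
- by move/pos_bits_inj->.
Qed.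

Section Encoding.
Variables C B : Type.

Fixpoint enc (f : formula C B) : seq (letter C B) :=
  match f with
  | Var x => rcons (map Digit (bits x)) VarEnd
  | Con c => [:: Cst c]
  | Bin b g h => LPar :: enc g ++ Op b :: rcons (enc h) RPar
  end.

Lemma digits_inj (r s : seq bool) (u v : seq (letter C B)) :
  map Digit r ++ VarEnd :: u = map Digit s ++ VarEnd :: v -> r = s /\ u = v.
Proof.
elim: r s => [|a r IH] [|b s] //=; first by case.
by case=> -> /IH[-> ->].
Qed.

Lemma enc_prefix (f g : formula C B) u v :
  enc f ++ u = enc g ++ v -> f = g /\ u = v.
Proof.
elim: f g u v => [x|c|b f1 IH1 f2 IH2] [y|d|b' g1 g2] u v /=;
  rewrite ?cat_rcons //; try by case: (bits _).
- by move/digits_inj => [/bits_inj -> ->].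
- by case=> -> ->.
- rewrite -!catA !cat_cons !cat_rcons => -[/IH1[-> [-> /IH2[-> [->]]]]].
  by [].
Qed.

Lemma enc_inj : injective enc.
Proof.
by move=> f g e; case: (@enc_prefix f g [::] [::]) => //; rewrite e.
Qed.

End Encoding.

HB.instance Definition _ (C B : finType) :=
  Equality.copy (formula C B) (inj_type (@enc_inj C B)).

Inductive lcon := CTop | CBot.
Inductive lbin := BAnd | BOr | BImp.
Inductive scon := COne | CZero.
Inductive sbin := BMeet | BJoin | BFus | BUnder | BOver.

Definition lcon_code c := if c is CTop then true else false.
Definition lcon_decode c := if c then CTop else CBot.
Lemma lcon_codeK : cancel lcon_code lcon_decode. Proof. by case. Qed.
HB.instance Definition _ := Finite.copy lcon (can_type lcon_codeK).

Definition scon_code c := if c is COne then true else false.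
Definition scon_decode c := if c then COne else CZero.
Lemma scon_codeK : cancel scon_code scon_decode. Proof. by case. Qed.
HB.instance Definition _ := Finite.copy scon (can_type scon_codeK).

Definition lbin_code b : option bool :=
  match b with BAnd => None | BOr => Some true | BImp => Some false end.
Definition lbin_decode (b : option bool) :=
  match b with None => BAnd | Some true => BOr | Some false => BImp end.
Lemma lbin_codeK : cancel lbin_code lbin_decode. Proof. by case. Qed.
HB.instance Definition _ := Finite.copy lbin (can_type lbin_codeK).

Definition sbin_code b : option (bool * bool) :=
  match b with
  | BMeet => None | BJoin => Some (true, true) | BFus => Some (true, false)
  | BUnder => Some (false, true) | BOver => Some (false, false)
  end.
Definition sbin_decode (b : option (bool * bool)) :=
  match b with
  | None => BMeet | Some (true, true) => BJoin | Some (true, false) => BFus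
  | Some (false, true) => BUnder | Some (false, false) => BOver
  end.
Lemma sbin_codeK : cancel sbin_code sbin_decode. Proof. by case. Qed.
HB.instance Definition _ := Finite.copy sbin (can_type sbin_codeK).

Definition lform := formula lcon lbin.
Definition sform := formula scon sbin.

Declare Scope form_L_scope.
Delimit Scope form_L_scope with L.
Bind Scope form_L_scope with lform.
Declare Scope form_S_scope.
Delimit Scope form_S_scope with S.
Bind Scope form_S_scope with sform.

Notation Top := (Con CTop : lform).
Notation Bot := (Con CBot : lform).
Notation "f ∧ g" := (Bin BAnd f g) (at level 40, left associativity) : form_L_scope.
Notation "f ∨ g" := (Bin BOr f g) (at level 50, left associativity) : form_L_scope.
Notation "f → g" := (Bin BImp f g) (at level 55, right associativity) : form_L_scope.

Notation One := (Con COne : sform).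
Notation Zero := (Con CZero : sform).
Notation "f ∧ g" := (Bin BMeet f g) (at level 40, left associativity) : form_S_scope.
Notation "f ∨ g" := (Bin BJoin f g) (at level 50, left associativity) : form_S_scope.
Notation "f * g" := (Bin BFus f g) (at level 40, left associativity) : form_S_scope.
(* [f ⑊ g] is the left residual f \ g, and [g ⁄ f] the right residual g / f. *)
Notation "f ⑊ g" := (Bin BUnder f g) (at level 55, no associativity) : form_S_scope.
Notation "g ⁄ f" := (Bin BOver g f) (at level 55, no associativity) : form_S_scope.

Fixpoint transl (f : sform) : lform :=
  match f with
  | Var x => Var x
  | Con CZero => Bot
  | Con COne => Top
  | Bin BMeet g h => (transl g ∧ transl h)%L
  | Bin BJoin g h => (transl g ∨ transl h)%L
  | Bin BFus g h => (transl g ∧ transl h)%L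
  | Bin BUnder g h => (transl g → transl h)%L
  | Bin BOver h g => (transl g → transl h)%L
  end.

Inductive move := GoLeft | GoRight | Stay.

(* One-tape deterministic machine; [None] is the blank cell, [inl (inl _)] and
   [inl (inr _)] are the input and output letters, [work] the auxiliary ones.
   The machine halts when [delta] returns [None]. *)
Record machine (A B : finType) := Machine {
  state : finType;
  work : finType;
  start : state;
  delta : state -> option (A + B + work) ->
          option (state * option (A + B + work) * move)
}.

(* [ltape] lists the cells to the left of the head, nearest first, and [rtape]
   those from the scanned cell on; all cells beyond the lists are blank. *)
Record config (A B : finType) (M : machine A B) := Config {
  cstate : state M;
  ltape : seq (option (A + B + work M));
  rtape : seq (option (A + B + work M))
}.

Section Machines.
Variables (A B : finType) (M : machine A B).

Definition next (c : config M) := delta (cstate c) (head None (rtape c)).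

Definition step (c : config M) : config M :=
  match next c with
  | None => c
  | Some (q, a, Stay) => Config q (ltape c) (a :: behead (rtape c))
  | Some (q, a, GoRight) => Config q (a :: ltape c) (behead (rtape c))
  | Some (q, a, GoLeft) =>
      Config q (behead (ltape c)) (head None (ltape c) :: a :: behead (rtape c))
  end.

Definition init (x : seq A) : config M :=
  Config (start M) [::] [seq Some (inl (inl a)) | a <- x].

Definition halts_with (c : config M) (y : seq B) : Prop :=
  next c = None /\
  exists k, rtape c = [seq Some (inl (inr b)) | b <- y] ++ nseq k None.

End Machines.

Definition polytime (A B : finType) (f : seq A -> seq B) : Prop :=
  exists (M : machine A B) (g : {poly nat}), forall x : seq A,
    exists2 k : nat, k <= (g.[size x])%R &
      halts_with (iter k (@step _ _ M) (init M x)) (f x).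

Section Consequence.
Variables C B : finType.
Implicit Type D : set (formula C B) -> formula C B -> Prop.

Definition consequence D : Prop :=
  [/\ forall s X f, D X f -> D (subst s @` X) (subst s f),
      forall X f, X f -> D X f,
      forall X Y f, D X f -> (forall g, X g -> D Y g) -> D Y f
    & forall X f, D X f ->
        exists2 s : seq (formula C B), [set` s] `<=` X & D [set` s] f].

Definition logic_of D : set (formula C B) := [set f | D set0 f].

Definition is_logic (X : set (formula C B)) : Prop :=
  exists2 D, consequence D & X = logic_of D.

End Consequence.

(* Up to the injective encoding [enc], a proof system computes strings from
   strings; its values are given here as the formulas these strings denote. *)
Definition proof_system (A C B : finType) (P : seq A -> formula C B)
    (X : set (formula C B)) : Prop :=
  polytime (fun p => enc (P p)) /\ range P = X.

(* [T] and [U] are arbitrary types of proofs, so that this also applies to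
   sequent calculi, whose proofs are derivations. *)
Definition at_least_as_strong (T U F G : Type) (tr : F -> G)
    (Q : U -> G) (P : T -> F) : Prop :=
  forall p, exists q, tr (P p) = Q q.

Definition simulated (A A' : finType) (F G : Type) (tr : F -> G)
    (P : seq A -> F) (Q : seq A' -> G) : Prop :=
  exists g : {poly nat}, forall p, exists q,
    tr (P p) = Q q /\ size q <= (g.[size p])%R.

Definition exponential_length (R : realType) (A : finType) (F : Type)
    (P : seq A -> F) (f : nat -> F) : Prop :=
  exists2 e : R, (0 < e)%R & exists N : nat, forall n : nat, N <= n ->
    forall p, P p = f n -> (2 `^ (n%:R `^ e) <= (size p)%:R :> R)%R.

Inductive derivable (S : eqType) (R : seq S -> S -> Prop) : S -> Prop :=
| Derive ps c of R ps c & (forall s, s \in ps -> derivable R s) : derivable R c.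

Section FL.
Local Open Scope form_S_scope.

Definition fl_sequent : eqType := (seq sform * option sform)%type.

Implicit Types (G S P : seq sform) (D : option sform) (f g : sform).

Inductive FL_rule : seq fl_sequent -> fl_sequent -> Prop :=
| FL_id f : FL_rule [::] ([:: f], Some f)
| FL_one : FL_rule [::] ([::], Some One)
| FL_zero : FL_rule [::] ([:: Zero], None)
| FL_cut G S P f D :
    FL_rule [:: (G, Some f); (S ++ f :: P, D)] (S ++ G ++ P, D)
| FL_1w G S D : FL_rule [:: (G ++ S, D)] (G ++ One :: S, D)
| FL_0w G : FL_rule [:: (G, None)] (G, Some Zero)
| FL_Lmeet1 G S f g D :
    FL_rule [:: (G ++ f :: S, D)] (G ++ (f ∧ g) :: S, D)
| FL_Lmeet2 G S f g D :
    FL_rule [:: (G ++ g :: S, D)] (G ++ (f ∧ g) :: S, D)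
| FL_Rmeet G f g :
    FL_rule [:: (G, Some f); (G, Some g)] (G, Some (f ∧ g))
| FL_Ljoin G S f g D :
    FL_rule [:: (G ++ f :: S, D); (G ++ g :: S, D)] (G ++ (f ∨ g) :: S, D)
| FL_Rjoin1 G f g : FL_rule [:: (G, Some f)] (G, Some (f ∨ g))
| FL_Rjoin2 G f g : FL_rule [:: (G, Some g)] (G, Some (f ∨ g))
| FL_Lfus G S f g D :
    FL_rule [:: (G ++ f :: g :: S, D)] (G ++ (f * g) :: S, D)
| FL_Rfus G S f g :
    FL_rule [:: (G, Some f); (S, Some g)] (G ++ S, Some (f * g))
| FL_Lover G P S f g D :
    FL_rule [:: (G, Some f); (P ++ g :: S, D)] (P ++ (g ⁄ f) :: G ++ S, D)
| FL_Rover G f g : FL_rule [:: (rcons G f, Some g)] (G, Some (g ⁄ f))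
| FL_Lunder G P S f g D :
    FL_rule [:: (G, Some f); (P ++ g :: S, D)] (P ++ G ++ (f ⑊ g) :: S, D)
| FL_Runder G f g : FL_rule [:: (f :: G, Some g)] (G, Some (f ⑊ g)).

Definition FL (d : {f : sform | derivable FL_rule ([::], Some f)}) : sform :=
  sval d.

End FL.

Section BPC.
Local Open Scope form_L_scope.

(* Multisets are represented by lists, with [BPC_exchange] as an extra rule. *)
Definition bpc_sequent : eqType := (seq lform * seq lform)%type.

Implicit Types (U X : seq lform) (f g h : lform).

Inductive BPC_rule : seq bpc_sequent -> bpc_sequent -> Prop :=
| BPC_exchange U U' X X' : Permutation U U' -> Permutation X X' ->
    BPC_rule [:: (U, X)] (U', X')
| BPC_id U X f : BPC_rule [::] (f :: U, f :: X)
| BPC_top U X : BPC_rule [::] (U, Top :: X)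
| BPC_bot U X : BPC_rule [::] (Bot :: U, X)
| BPC_Land U X f g : BPC_rule [:: (f :: g :: U, X)] ((f ∧ g) :: U, X)
| BPC_Rand U X f g :
    BPC_rule [:: (U, f :: X); (U, g :: X)] (U, (f ∧ g) :: X)
| BPC_Lor U X f g :
    BPC_rule [:: (f :: U, X); (g :: U, X)] ((f ∨ g) :: U, X)
| BPC_Ror U X f g : BPC_rule [:: (U, f :: g :: X)] (U, (f ∨ g) :: X)
| BPC_Rimp U X f g : BPC_rule [:: (f :: U, [:: g])] (U, (f → g) :: X)
| BPC_D U X f g h :
    BPC_rule [:: ((f ∧ g) :: U, X); ((f ∧ h) :: U, X)] ((f ∧ (g ∨ h)) :: U, X)
| BPC_Tr U X f g h :
    BPC_rule [:: (U, [:: f → g]); (U, [:: g → h])] (U, (f → h) :: X)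
| BPC_Fand U X f g h :
    BPC_rule [:: (U, [:: f → g]); (U, [:: f → h])] (U, (f → (g ∧ h)) :: X)
| BPC_For U X f g h :
    BPC_rule [:: (U, [:: f → h]); (U, [:: g → h])] (U, ((f ∨ g) → h) :: X)
| BPC_cut U1 U2 X1 X2 f :
    BPC_rule [:: (U1, f :: X1); (f :: U2, X2)] (U1 ++ U2, X1 ++ X2).

Definition BPC (d : {f : lform | derivable BPC_rule ([::], [:: f])}) : lform :=
  sval d.

End BPC.

Section LJ.
Local Open Scope form_L_scope.

Definition lj_sequent : eqType := (seq lform * option lform)%type.

Implicit Types (G S : seq lform) (D : option lform) (f g : lform).

Inductive LJ_rule : seq lj_sequent -> lj_sequent -> Prop :=
| LJ_id f : LJ_rule [::] ([:: f], Some f)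
| LJ_top : LJ_rule [::] ([::], Some Top)
| LJ_bot : LJ_rule [::] ([:: Bot], None)
| LJ_exchange G S f g D :
    LJ_rule [:: (G ++ f :: g :: S, D)] (G ++ g :: f :: S, D)
| LJ_weakenL G f D : LJ_rule [:: (G, D)] (f :: G, D)
| LJ_weakenR G f : LJ_rule [:: (G, None)] (G, Some f)
| LJ_contract G f D : LJ_rule [:: (f :: f :: G, D)] (f :: G, D)
| LJ_cut G S f D : LJ_rule [:: (G, Some f); (f :: S, D)] (G ++ S, D)
| LJ_Land1 G f g D : LJ_rule [:: (f :: G, D)] ((f ∧ g) :: G, D)
| LJ_Land2 G f g D : LJ_rule [:: (g :: G, D)] ((f ∧ g) :: G, D)
| LJ_Rand G f g : LJ_rule [:: (G, Some f); (G, Some g)] (G, Some (f ∧ g))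
| LJ_Lor G f g D : LJ_rule [:: (f :: G, D); (g :: G, D)] ((f ∨ g) :: G, D)
| LJ_Ror1 G f g : LJ_rule [:: (G, Some f)] (G, Some (f ∨ g))
| LJ_Ror2 G f g : LJ_rule [:: (G, Some g)] (G, Some (f ∨ g))
| LJ_Limp G S f g D :
    LJ_rule [:: (G, Some f); (g :: S, D)] ((f → g) :: G ++ S, D)
| LJ_Rimp G f g : LJ_rule [:: (f :: G, Some g)] (G, Some (f → g)).

Definition holds (D : set lform -> lform -> Prop) (s : lj_sequent) : Prop :=
  D [set` s.1] (odflt Bot s.2).

Definition super_intuitionistic (D : set lform -> lform -> Prop) : Prop :=
  consequence D /\
  forall ps c, LJ_rule ps c -> (forall s, s \in ps -> holds D s) -> holds D c.

Definition bigand (s : seq lform) : lform := iterop_form BAnd Top s.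
Definition bigor (s : seq lform) : lform := iterop_form BOr Bot s.

Definition branching_axiom (k : nat) : lform :=
  bigand [seq (Var i → bigor [seq Var j | j <- iota 0 k.+1 & j != i])
                → bigor [seq Var j | j <- iota 0 k.+1] | i <- iota 0 k.+1]
  → bigor [seq Var i | i <- iota 0 k.+1].

(* Theorems of intuitionistic logic and substitution instances of the axiom,
   closed under modus ponens. *)
Inductive Tk (k : nat) : set lform :=
| Tk_IPC f : derivable LJ_rule ([::], Some f) -> Tk k f
| Tk_axiom s : Tk k (subst s (branching_axiom k))
| Tk_mp f g : Tk k (f → g) -> Tk k f -> Tk k g.

Definition has_branching (X : set lform) (k : nat) : Prop := Tk k `<=` X.

Definition infinite_branching (X : set lform) : Prop :=
  forall k, ~ has_branching X k.

End LJ.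

Definition frege_rule : Type := seq lform * lform.

Definition frege_step (rules : seq frege_rule) (hyp : set lform)
    (prev : seq lform) (f : lform) : Prop :=
  hyp f \/
  exists r s, [/\ r \in rules, {subset [seq subst s g | g <- r.1] <= prev}
                & f = subst s r.2].

Definition line_by_line (stp : seq lform -> lform -> Prop) (ds : seq lform) :=
  forall i, i < size ds -> stp (take i ds) (nth Bot ds i).

Definition ends_in (ds : seq lform) (f : lform) : Prop :=
  exists ds', ds = rcons ds' f.

Definition frege_proof rules (hyp : set lform) (ds : seq lform) (f : lform) :=
  ends_in ds f /\ line_by_line (frege_step rules hyp) ds.

Definition frege_system (D : set lform -> lform -> Prop)
    (rules : seq frege_rule) : Prop :=
  [/\ forall f ds, frege_proof rules set0 ds f -> logic_of D f,
      forall (s : seq lform) f, D [set` s] f ->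
        exists ds, frege_proof rules [set` s] ds f
    & forall r, r \in rules -> D [set` r.1] r.2].

Definition extension_step (hyp : set lform) (goal : lform)
    (prev : seq lform) (f : lform) : Prop :=
  exists x g, f = ((Var x → g) ∧ (g → Var x))%L /\
    [/\ ~~ occurs x g, forall h, h \in prev -> ~~ occurs x h,
        forall h, hyp h -> ~~ occurs x h & ~~ occurs x goal].

Definition EF_proof rules (hyp : set lform) (ds : seq lform) (f : lform) :=
  ends_in ds f /\
  line_by_line (fun prev g => frege_step rules hyp prev g \/
                              extension_step hyp f prev g) ds.

(* A proof is written as the string of its lines, each followed by the separator
   [None]. *)
Definition enc_proof (ds : seq lform) : seq (option (letter lcon lbin)) :=
  flatten [seq rcons [seq Some a | a <- enc f] None | f <- ds].

Lemma enc_line_inj (T : Type) (r s : seq T) u v :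
  map Some r ++ None :: u = map Some s ++ None :: v -> r = s /\ u = v.
Proof.
elim: r s => [|a r IH] [|b s] //=; first by case.
by case=> -> /IH[-> ->].
Qed.

Lemma enc_proof_inj : injective enc_proof.
Proof.
elim=> [|f ds IH] [|g es] //=; rewrite /enc_proof /=.
- by case: (enc g).
- by case: (enc f).
- by rewrite !cat_rcons => /enc_line_inj[/enc_inj -> /IH ->].
Qed.

(* Strings that are not extended Frege proofs count as proofs of [Top]. *)
Definition EF rules (p : seq (option (letter lcon lbin))) : lform :=
  if pselect (exists f ds, p = enc_proof ds /\ EF_proof rules set0 ds f)
  is left w then sval (cid w) else Top.

Lemma EF_correct rules ds f :
  EF_proof rules set0 ds f -> EF rules (enc_proof ds) = f.
Proof.
move=> pf; rewrite /EF; case: pselect => [w|[]]; last by exists f, ds.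
case: cid => g /= [es [/enc_proof_inj <- [[ds' e] _]]].
by case: pf => -[es' +] _; rewrite e => /rcons_inj[].
Qed.

Section Theta.
Local Open Scope form_S_scope.

Definition bigmeet (s : seq sform) : sform := iterop_form BMeet One s.
Definition bigjoin (s : seq sform) : sform := iterop_form BJoin Zero s.
Definition bigfus (s : seq sform) : sform := iterop_form BFus One s.

(* The doubly indexed families are coded injectively, see [dvar_inj], with indices
   polynomial in [i] and [j]. *)
Definition dvar (tag i j : nat) : nat := tag + 6 * ((i + j) ^ 2 + i).

Lemma dvar_inj a b i j k l : a < 6 -> b < 6 ->
  dvar a i j = dvar b k l -> [/\ a = b, i = k & j = l].
Proof.
rewrite /dvar => a6 b6 e.
have [e1 e2] : a = b /\ (i + j) ^ 2 + i = (k + l) ^ 2 + k by lia.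
have e3 : i + j = k + l.
  case: (ltngtP (i + j) (k + l)) => // lt.
  - have : (i + j).+1 ^ 2 <= (k + l) ^ 2 by rewrite leq_exp2r.
    by rewrite -addn1 sqrnD; lia.
  - have : (k + l).+1 ^ 2 <= (i + j) ^ 2 by rewrite leq_exp2r.
    by rewrite -addn1 sqrnD; lia.
by move: e2; rewrite e3; split; lia.
Qed.

Definition p_ (i j : nat) : sform := Var (dvar 0 i j).
Definition q_ (i j : nat) : sform := Var (dvar 1 i j).
Definition s_ (i l : nat) : sform := Var (dvar 2 i l).
Definition s'_ (i l : nat) : sform := Var (dvar 3 i l).
Definition r_ (i l : nat) : sform := Var (dvar 4 i l).
Definition r'_ (i l : nat) : sform := Var (dvar 5 i l).

Definition alpha (k n : nat) : sform :=
  bigjoin [seq bigmeet [seq s'_ i l | l <- iota 0 k] | i <- iota 0 n]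
  ∨ bigjoin [seq bigjoin [seq s_ i l ∧ s_ j l ∧ p_ i j | l <- iota 0 k]
            | i <- iota 0 n, j <- iota 0 n].

(* [beta m n] is the formula written with superscript [m] and subscript [n]. *)
Definition beta (m n : nat) : sform :=
  bigjoin [seq bigmeet [seq r'_ i l | i <- iota 0 n] | l <- iota 0 m]
  ∨ bigjoin [seq bigjoin [seq r_ i u.1 ∧ r_ j u.2 ∧ q_ i j
                         | u <- [seq (l, l') | l <- iota 0 m, l' <- iota 0 m]
                         & u.1 < u.2]
            | i <- iota 0 n, j <- iota 0 n].

Definition Theta_nk (n k : nat) : sform :=
  bigfus [seq (p_ i j ∧ One) ∨ (q_ i j ∧ One) | i <- iota 0 n, j <- iota 0 n]
  ⑊ ((bigfus [seq (s_ i l ∧ One) ∨ (s'_ i l ∧ One)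
             | i <- iota 0 n, l <- iota 0 k] ⑊ alpha k n)
     ∨ (bigfus [seq (r_ i l ∧ One) ∨ (r'_ i l ∧ One)
               | i <- iota 0 n, l <- iota 0 k.+1] ⑊ beta k.+1 n)).

Definition Theta (n : nat) : sform := Theta_nk n (Nat.sqrt n).

End Theta.

(* Main.v *)
(* In a logic of infinite branching every constant number [M] of points can be placed
   above a new root: a maximal prime theory refuting the branching axiom is mapped onto
   a fork with [M] leaves or onto a diamond, a fork with an added top point. So the
   theorems of the logic are valid in all such small frames of one of the two kinds.

   Given an extended Frege proof of the translation of [Theta n], let [T] be the closure
   of the edge variables of a graph under Horn clauses, polynomially many in the length
   of the proof, that express for each line all entailments among the constantly many
   subformulas of the rule used, at the middle points of these frames. A rule instance
   then has enough points to refute all implications outside [T], so the Kleene slash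
   relative to [T] is preserved by the proof, and one of the two disjuncts of [Theta n]
   lies in [T]. If all the variables [q] are put in [T], the question whether the left
   disjunct belongs to [T] is monotone in the variables [p] and separates graphs with a
   [(k + 1)]-clique from [k]-colourable ones. Razborov's method of approximations,
   applied directly to the Horn closure, shows that this takes exponentially many
   clauses. *)
From Stdlib Require Import Permutation.
Require Import Defs.
From mathcomp Require Import all_boot all_order all_algebra.
From mathcomp Require Import boolp zify.

Set Implicit Arguments.
Unset Strict Implicit.
Unset Printing Implicit Defensive.

(** * Clique versus colouring by Horn closures *)

(** The clauses are read off the proof alone, and the graph enters only through the hypotheses
    handed to them. Hence membership of the left disjunct in the closure is monotone in the edges,
    and adding all variables [q] is harmless: the closure only grows, and a colouring still refutes
    the left disjunct, in which no [q] occurs. The link between the two halves is soundness at one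
    point: every clause preserves truth at each middle point, so a valuation that refutes a disjunct
    there keeps it out of the closure. The obstacle is that only small frames are known to be sound.
    Each proof step is therefore treated at the level of its rule scheme, where [2 ^ B] middle
    points suffice for [B] metavariables. Extension axioms are removed by substitution, which may
    lengthen formulas exponentially but does not add subformulas beyond the images of the old ones.
    For the lower bound a clause counts as one disjunction plus one conjunction per premise. With
    [k] the integer square root of [n], [t ^ 16 <= n] gives [t ^ 8 <= k]; another square root pays
    for the polynomial overhead, whence the exponent 1/32. *)

Inductive horn (T : eqType) (cls : seq (seq T * T)) (H : pred T) : T -> Prop :=
| HornHyp f of H f : horn cls H f
| HornClause cl of cl \in cls & (forall g, g \in cl.1 -> horn cls H g) :
    horn cls H cl.2.

Lemma horn_mono (T : eqType) (cls : seq (seq T * T)) (H H' : pred T) f :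
  subpred H H' -> horn cls H f -> horn cls H' f.
Proof.
move=> HH'; elim=> [g /HH'|cl clin _ IH]; first exact: HornHyp.
exact: HornClause.
Qed.

(** * Product-measure estimates in counting form *)

Section Resampling.
Variables I J : finType.
Implicit Types (c d : {ffun I -> J}) (Q : {set {ffun I -> J}}).

Definition update c u a : {ffun I -> J} := [ffun i => if i == u then a else c i].

(** On [Q] the coordinate [u] is determined by the others, so [(a, c)] can be recovered from
    [update c u a]: forcing one coordinate costs a factor [#|J|]. *)
Lemma card_resample u Q Q' :
    (forall c a, c \in Q -> update c u a \in Q') ->
    {in Q &, forall c d, (forall i, i != u -> c i = d i) -> c = d} ->
  #|J| * #|Q| <= #|Q'|.
Proof.
move=> QQ' Qdet; pose h (x : J * {ffun I -> J}) := update x.2 u x.1.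
rewrite -cardsT -cardsX -(@card_in_imset _ _ h).
  by apply/subset_leq_card/subsetP => _ /imsetP[[a c] /setXP[_ cQ] ->]; exact: QQ'.
move=> [a c] [b d] /setXP[_ cQ] /setXP[_ dQ] /ffunP e.
have -> : a = b by have := e u; rewrite !ffunE eqxx.
congr pair; apply: Qdet => // i /negPf iu.
by have := e i; rewrite !ffunE iu.
Qed.

(** The prescribed coordinates are freed one at a time, each gaining a factor [#|J|]. *)
Lemma card_prescribed (D : {set I}) (h : I -> J) :
  #|J| ^ #|D| * #|[set c : {ffun I -> J} | [forall i in D, c i == h i]]| <= #|J| ^ #|I|.
Proof.
move Dk: #|D| => k; elim: k D Dk => [|k IH] D Dk.
  by rewrite expn0 mul1n -card_ffun max_card.
have [u uD] : exists u, u \in D by apply/card_gt0P; rewrite Dk.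
have {IH} IH := IH (D :\ u); rewrite expnS -mulnA mulnCA.
have Dk' : #|D :\ u| = k by apply/eqP; rewrite -eqSS -Dk [#|D|](cardsD1 u) uD.
apply: leq_trans (IH Dk'); rewrite leq_mul2l; apply/orP; right.
apply: (@card_resample u).
  move=> c a; rewrite !inE => /forall_inP cD; apply/forall_inP => i.
  by rewrite !inE ffunE => /andP[/negPf -> /cD].
move=> c d; rewrite !inE => /forall_inP cD /forall_inP dD e.
apply/ffunP => i; case: (altP (i =P u)) => [->|/e//].
by rewrite (eqP (cD u _)) ?(eqP (dD u _)).
Qed.

End Resampling.

Lemma leq_card_bigcup (I T : finType) (P : pred I) (F : I -> {set T}) :
  #|\bigcup_(i | P i) F i| <= \sum_(i | P i) #|F i|.
Proof.
apply: (big_ind2 (fun (B : {set T}) m => #|B| <= m)) => [|B b B' b' Bb Bb'|//].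
  by rewrite cards0.
by apply: leq_trans (leq_card_setU _ _) _; rewrite leq_add.
Qed.

(** * The Erdős-Rado sunflower lemma *)

Section Sunflower.
Variable T : finType.
Implicit Types (A S : {set {set T}}) (U X Y Z : {set T}).

Definition sunflower S Z :=
  {in S, forall X, Z \subset X} /\ {in S &, forall X Y, X != Y -> X :&: Y = Z}.

(** Disjoint members are collected greedily. If this stops before [p] of them, their union meets
    every nonempty member of [A]. *)
Lemma disjoint_or_hitting A l p : {in A, forall X, #|X| <= l} ->
  (exists S, [/\ S \subset A, #|S| = p & sunflower S set0]) \/
  (exists2 U : {set T}, #|U| <= p.-1 * l & {in A, forall X, X != set0 -> X :&: U != set0}).
Proof.
move=> Al; elim: p => [|p [[S [SA Sp [_ Sd]]]|[U Up hU]]].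
- left; exists set0; rewrite sub0set cards0; split=> //; split=> X; rewrite inE //.
- case: (pselect (exists2 X, X \in A :\: S & {in S, forall Y, X :&: Y = set0})).
    case=> X /setDP[XA XS] Xd; left; exists (X |: S); split.
    + by apply/subsetP => Y /setU1P[->//|]; exact: (subsetP SA).
    + by rewrite cardsU1 XS Sp.
    split=> [? _|Y1 Y2 /setU1P[->|Y1S] /setU1P[->|Y2S] ne]; first exact: sub0set.
    + by rewrite eqxx in ne.
    + exact: Xd.
    + by rewrite setIC; exact: Xd.
    + exact: Sd.
  move=> noX; right; exists (cover S).
    apply: leq_trans (leq_card_cover S) _; rewrite -Sp -sum_nat_const.
    by apply: leq_sum => X XS; apply/Al/(subsetP SA).
  move=> X XA; apply: contraNneq => XU.
  case: (boolP (X \in S)) => XS.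
    by rewrite -XU (setIidPl _) //; exact: bigcup_sup.
  case: noX; exists X => [|Y YS]; first by rewrite inE XS.
  by apply/eqP; rewrite -subset0 -XU; apply: setIS; exact: bigcup_sup.
- right; exists U => //; apply: leq_trans Up _.
  by case: p => //= p; rewrite leq_mul2r leqnSn orbT.
Qed.

(** Without [p] disjoint members there is a small hitting set, one of whose points lies in so many
    members that deleting it allows induction on [l]. The separate bound [L] keeps the base of the
    power fixed along this induction. *)
Lemma sunflower_exists p L l A : 0 < L -> l <= L ->
    {in A, forall X, #|X| <= l} -> (p * L) ^ l < #|A| ->
  exists S Z, [/\ S \subset A, #|S| = p & sunflower S Z].
Proof.
case: p => [|p] L0.
  by exists set0, set0; rewrite sub0set cards0; split=> //; split=> X; rewrite inE.
elim: l A => [|l IH] A lL Al gtA.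
  suff : #|A| <= 1 by rewrite leqNgt gtA.
  rewrite -(cards1 (set0 : {set T})); apply/subset_leq_card/subsetP => X /Al.
  by rewrite leqn0 cards_eq0 inE.
case: (disjoint_or_hitting p.+1 Al) => [[S [SA Sp Sd]]|[U Up hU]].
  by exists S, set0.
pose star u := [set X in A | u \in X].
have [u uU gtu] : exists2 u, u \in U & (p.+1 * L) ^ l < #|star u|.
  apply: contrapT => noU; suff : #|A| <= (p.+1 * L) ^ l.+1 by rewrite leqNgt gtA.
  have cov : A \subset set0 |: \bigcup_(u in U) star u.
    apply/subsetP => X XA; rewrite !inE; case: eqP => //= /eqP /(hU X XA) /set0Pn[u].
    by rewrite inE => /andP[uX uU]; apply/bigcupP; exists u; rewrite // inE XA.
  apply: leq_trans (subset_leq_card cov) _.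
  apply: leq_trans (leq_card_setU _ _) _; rewrite cards1.
  have : #|\bigcup_(u in U) star u| <= #|U| * (p.+1 * L) ^ l.
    apply: leq_trans (leq_card_bigcup _ _) _; rewrite -sum_nat_const; apply: leq_sum => u uU.
    by rewrite leqNgt; apply/negP => h; apply: noU; exists u.
  have gt0 : 0 < (p.+1 * L) ^ l by rewrite expn_gt0 muln_gt0 L0.
  (* The gap between [p * L] and [p.+1 * L] pays for the empty set, which no point hits. *)
  rewrite expnS => le1; have le2 : #|U| <= p * L.
    by apply: leq_trans Up _; rewrite leq_mul2l lL orbT.
  nia.
pose rm X := X :\ u.
have rm_inj : {in star u &, injective rm}.
  move=> X Y; rewrite !inE => /andP[_ uX] /andP[_ uY] e.
  by rewrite -(setD1K uX) -(setD1K uY) -/(rm X) e.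
case: (IH (rm @: star u)).
- exact: ltnW.
- move=> _ /imsetP[X + ->]; rewrite inE => /andP[/Al + uX].
  by rewrite (cardsD1 u) uX.
- by rewrite card_in_imset.
move=> S [Z [SA Sp [SZ Sd]]].
have uS : {in S, forall X, u \notin X}.
  by move=> X /(subsetP SA)/imsetP[Y _ ->]; rewrite !inE eqxx.
exists ((fun X => u |: X) @: S), (u |: Z); split.
- apply/subsetP => _ /imsetP[_ /(subsetP SA)/imsetP[X + ->] ->].
  by rewrite inE => /andP[XA uX]; rewrite setD1K.
- rewrite card_in_imset // => X Y XS YS e.
  by rewrite -(setU1K (uS X XS)) e setU1K // uS.
split=> [_ /imsetP[X XS ->]|_ _ /imsetP[X XS ->] /imsetP[Y YS ->] ne].
  by apply: setUS; exact: SZ.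
by rewrite -setUIr Sd //; apply: contraNneq ne => ->.
Qed.

End Sunflower.

(** * Random colourings of a sunflower *)

Section Colourings.
Variables (V C : finType).
Implicit Types (c : {ffun V -> C}) (X Y Z : {set V}) (S A : {set {set V}}).

Definition rainbow c X := [forall i in X, forall j in X, (c i == c j) ==> (i == j)].

Lemma rainbowP c X : reflect {in X &, injective c} (rainbow c X).
Proof.
apply: (iffP forall_inP) => [h i j iX jX cij|h i iX].
  by apply/eqP; apply: (implyP (forall_inP (h i iX) j jX)); exact/eqP.
by apply/forall_inP => j jX; apply/implyP => /eqP /h ->.
Qed.

Lemma rainbowS c X Y : X \subset Y -> rainbow c Y -> rainbow c X.
Proof.
move=> /subsetP XY /rainbowP h; apply/rainbowP => i j iX jX.
by apply: h; exact: XY.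
Qed.

(** The colourings on which replacing the petals [S] by the core [Z] may turn rejection into
    acceptance. *)
Definition misled S Z :=
  [set c | rainbow c Z && [forall X in S, ~~ rainbow c X]].

(** Once the core is rainbow, each petal fails with probability at most [l ^ 2 / #|C|], and these
    factors multiply: a clash in a petal involves a vertex outside [Z], which lies in no other
    petal, so recolouring it leaves the others alone. *)
Lemma card_misled S Z l : {in S, forall X, #|X| <= l} -> sunflower S Z ->
  #|C| ^ #|S| * #|misled S Z| <= (l ^ 2) ^ #|S| * #|C| ^ #|V|.
Proof.
move Sk: #|S| => k; elim: k S Sk => [|k IH] S Sk Sl [SZ Sd].
  by rewrite !expn0 !mul1n -card_ffun max_card.
have [X XS] : exists X, X \in S by apply/card_gt0P; rewrite Sk.
have Sk' : #|S :\ X| = k by apply/eqP; rewrite -eqSS -Sk [#|S|](cardsD1 X) XS.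
have SS' : {subset S :\ X <= S} by move=> Y /setD1P[].
have {}IH : #|C| ^ k * #|misled (S :\ X) Z| <= (l ^ 2) ^ k * #|C| ^ #|V|.
  apply: IH => //; first by move=> Y /SS'; exact: Sl.
  by split=> [Y /SS'|Y1 Y2 /SS' Y1S /SS']; [exact: SZ|exact: Sd].
suff step : #|C| * #|misled S Z| <= l ^ 2 * #|misled (S :\ X) Z|.
  rewrite (expnS _ k) (expnS _ k) -[leqLHS]mulnA mulnCA -[leqRHS]mulnA.
  apply: leq_trans (_ : #|C| ^ k * (l ^ 2 * #|misled (S :\ X) Z|) <= _).
    by rewrite leq_mul2l step orbT.
  by rewrite mulnCA leq_mul2l IH orbT.
pose clash (u : V * V) := [set c in misled (S :\ X) Z | c u.1 == c u.2].
(* The first vertex of a pair lies outside the core; it is the one recoloured in [clashP]. *)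
pose pairs := [set u in setX (X :\: Z) X | u.1 != u.2].
have cov : misled S Z \subset \bigcup_(u in pairs) clash u.
  apply/subsetP => c; rewrite inE => /andP[cZ /forall_inP cS].
  have cS' : c \in misled (S :\ X) Z.
    by rewrite inE cZ; apply/forall_inP => Y /SS'; exact: cS.
  have := cS X XS; rewrite negb_forall_in => /exists_inP[i iX].
  rewrite negb_forall_in => /exists_inP[j jX]; rewrite negb_imply => /andP[/eqP cij ij].
  have [iZ|iZ] := boolP (i \in Z).
    have jZ : j \notin Z.
      apply: contraNN ij => jZ; apply/eqP; exact: (rainbowP _ _ cZ).
    apply/bigcupP; exists (j, i); first by rewrite !inE /= jZ jX iX eq_sym.
    by rewrite inE cS' /= cij.
  apply/bigcupP; exists (i, j); first by rewrite !inE /= iZ jX iX.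
  by rewrite inE cS' /= cij.
have clashP u : u \in pairs -> #|C| * #|clash u| <= #|misled (S :\ X) Z|.
  case: u => u w; rewrite !inE /= => /andP[/andP[/andP[uZ uX] wX] uw].
  apply: (@card_resample _ _ u) => [c a|c d].
    rewrite inE => /andP[]; rewrite !inE => /andP[cZ /forall_inP cS] _.
    have upd Y : u \notin Y -> rainbow (update c u a) Y = rainbow c Y.
      move=> uY; apply/rainbowP/rainbowP => h i j iY jY; have := h i j iY jY;
      rewrite !ffunE; have /negPf -> : i != u by [apply: contraNneq uY => <-];
      by have /negPf -> : j != u by [apply: contraNneq uY => <-].
    rewrite upd // cZ; apply/forall_inP => Y YS; rewrite upd; first exact: cS.
    case/setD1P: YS => YX YS; apply: contraNN uZ => uY.
    by rewrite -(Sd X Y) // 1?eq_sym // inE uX.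
  rewrite !inE /= => /andP[_ /eqP cuw] /andP[_ /eqP duw] e.
  apply/ffunP => i; have [->|/e//] := eqVneq i u.
  by rewrite cuw duw; apply: e; rewrite eq_sym.
have pairsl : #|pairs| <= l ^ 2.
  rewrite -mulnn; apply: (@leq_trans #|setX (X :\: Z) X|).
    by apply/subset_leq_card/subsetP => u; rewrite inE => /andP[].
  rewrite cardsX leq_mul ?(Sl X) //; apply: leq_trans (Sl _ XS).
  by apply: subset_leq_card; exact: subsetDl.
have := subset_leq_card cov.
move=> le2; have le1 := leq_card_bigcup (mem pairs) clash.
have le3 : #|C| * #|misled S Z| <= #|C| * \sum_(u in pairs) #|clash u|.
  by rewrite leq_mul2l (leq_trans le2 le1) orbT.
apply: (leq_trans le3); rewrite big_distrr /=.
apply: (@leq_trans (#|pairs| * #|misled (S :\ X) Z|)).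
  by rewrite -sum_nat_const; apply: leq_sum => u; exact: clashP.
by rewrite leq_mul2r pairsl orbT.
Qed.

End Colourings.

(** * Approximators by families of small vertex sets, and their errors *)

Section Approximation.
(* The positive tests are cliques with one vertex [h (i, K i)] in each of the
   disjoint blocks [h (i, _)]; the negative ones are complete multipartite graphs,
   given by a colouring of the vertices. *)
Variables (V C I J : finType) (h : I * J -> V) (l p : nat).
Hypotheses (h_inj : injective h) (l_gt1 : 1 < l) (p_gt1 : 1 < p) (C_gt0 : 0 < #|C|).

Notation pos := {ffun I -> J}.
Notation neg := {ffun V -> C}.
Notation M := ((p * l) ^ l).
Implicit Types (K : pos) (c : neg) (X Y Z : {set V}) (A B : {set {set V}}).
Implicit Types (P Q : {set pos}) (N : {set neg}) (F G : pos + neg -> bool).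

Definition clique K := [set h (i, K i) | i : I].

(** The blocks are disjoint, so containing [X] fixes the choice of [K] in [#|X|] different blocks,
    unless no [K] works at all. *)
Lemma card_cliques X :
  #|J| ^ #|X| * #|[set K | X \subset clique K]| <= #|J| ^ #|I|.
Proof.
case: (set_0Vmem [set K | X \subset clique K]) => [->|[K0]].
  by rewrite cards0 muln0.
rewrite inE => /subsetP XK0; pose D := [set i | h (i, K0 i) \in X].
have XD : X = [set h (i, K0 i) | i in D].
  apply/setP => v; apply/idP/imsetP => [vX|[i + ->]]; last by rewrite inE.
  by have /imsetP[i _ e] := XK0 v vX; exists i; rewrite // inE -e.
have -> : #|X| = #|D| by rewrite {1}XD card_in_imset // => i j _ _ /h_inj[].
apply: leq_trans (card_prescribed D K0); rewrite leq_mul2l; apply/orP; right.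
apply/subset_leq_card/subsetP => K; rewrite !inE => /subsetP XK.
apply/forall_inP => i; rewrite inE => /XK/imsetP[j _ /h_inj[-> ->]].
exact: eqxx.
Qed.

Definition accepts A (T : pred {set V}) := [exists X in A, T X].

(** [M] is the threshold of [sunflower_exists]: any larger family of such sets contains [p] petals
    to pluck. *)
Definition small A := (#|A| <= M) && [forall X in A, #|X| <= l].

(** In terms of measure, with [s] counting gates: each gate may lose up to [M ^ 2] events of
    probability at most [#|J| ^ (- l.+1)], the chance that a set of more than [l] vertices lies in a
    random clique. *)
Definition negligible_pos s P := #|P| * #|J| ^ l.+1 <= s * M ^ 2 * #|J| ^ #|I|.
(** Likewise each gate makes up to [M ^ 2] pluckings, and each misleads a fraction of at most
    [(l ^ 2 / #|C|) ^ p] of the colourings. *)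
Definition negligible_neg s N :=
  #|N| * #|C| ^ p <= s * M ^ 2 * ((l ^ 2) ^ p * #|C| ^ #|V|).

(** Only harmful errors count: missing a positive test on which [F] holds, or accepting a negative
    one on which [F] fails. *)
Definition approximated P N F := exists A,
  [/\ small A, forall K, K \notin P -> F (inl K) -> accepts A (fun X => X \subset clique K)
    & forall c, c \notin N -> accepts A (rainbow c) -> F (inr c)].

Lemma negligible_posU s t P Q :
  negligible_pos s P -> negligible_pos t Q -> negligible_pos (s + t) (P :|: Q).
Proof.
rewrite /negligible_pos => nP nQ; rewrite !mulnDl.
apply: leq_trans (leq_add nP nQ); rewrite -mulnDl leq_mul2r.
by rewrite leq_card_setU orbT.
Qed.

Lemma negligible_negU s t N N' :
  negligible_neg s N -> negligible_neg t N' -> negligible_neg (s + t) (N :|: N').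
Proof.
rewrite /negligible_neg => nP nQ; rewrite !mulnDl.
apply: leq_trans (leq_add nP nQ); rewrite -mulnDl leq_mul2r.
by rewrite leq_card_setU orbT.
Qed.

Lemma approximatedS P Q N N' F : P \subset Q -> N \subset N' ->
  approximated P N F -> approximated Q N' F.
Proof.
move=> /subsetP PQ /subsetP NN' [A [sA Ap An]]; exists A; split=> // x nx.
  by apply: Ap; apply: contraNN nx => /PQ.
by apply: An; apply: contraNN nx => /NN'.
Qed.

Lemma M_gt1 : 1 < M.
Proof. have := ltn_expl l (_ : 1 < p * l); nia. Qed.

(** While more than [M] sets remain, the petals of a sunflower are replaced by its core. Positive
    tests lose nothing, the core being contained in each petal; negative tests are spoiled only by
    misled colourings. As [p > 1], each replacement shrinks the family, so at most [#|A|] of them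
    occur. *)
Lemma pluck A : {in A, forall X, #|X| <= l} -> exists A' N,
  [/\ small A', {in A, forall X, exists2 Y, Y \in A' & Y \subset X},
      forall c, c \notin N -> accepts A' (rainbow c) -> accepts A (rainbow c)
    & #|N| * #|C| ^ p <= #|A| * ((l ^ 2) ^ p * #|C| ^ #|V|)].
Proof.
have [n] := ubnP #|A|; elim: n A => // n IH A An Al.
have [leM|gtM] := leqP #|A| M.
  exists A, set0; split=> //; last by rewrite cards0.
  - by rewrite /small leM; apply/forall_inP.
  - by move=> X XA; exists X.
have [S [Z [SA Sp [SZ Sd]]]] := sunflower_exists (ltnW l_gt1) (leqnn l) Al gtM.
have [X0 X0S] : exists X, X \in S by apply/card_gt0P; rewrite Sp; lia.
pose A1 := Z |: (A :\: S).
have ltA1 : #|A1| < #|A|.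
  rewrite -(cardsID S A) (setIidPr SA) Sp cardsU1 ltn_add2r.
  by apply: leq_ltn_trans p_gt1; case: (_ \notin _).
have [] := IH A1; first exact: leq_trans ltA1 An.
  move=> X /setU1P[->|/setDP[/Al//]].
  by apply: leq_trans (Al X0 _); [exact/subset_leq_card/SZ|exact: (subsetP SA)].
move=> A' [N [sA' A1A' cN Nle]]; exists A', (N :|: misled C S Z); split=> //.
- move=> X XA; have [XS|XS] := boolP (X \in S).
    have [|Y YA' YZ] := A1A' Z; first exact: setU11.
    by exists Y => //; apply: subset_trans YZ (SZ _ XS).
  by apply: A1A'; rewrite !inE XS XA orbT.
- move=> c; rewrite !inE negb_or => /andP[cN' cm] /(cN c cN').
  case/exists_inP => X /setU1P[->|/setDP[XA _] cX]; last by apply/exists_inP; exists X.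
  move=> cZ; move: cm; rewrite cZ /= negb_forall_in => /exists_inP[Y YS].
  by rewrite negbK => cY; apply/exists_inP; exists Y; rewrite // (subsetP SA).
- have Sl : {in S, forall X, #|X| <= l} by move=> X /(subsetP SA)/Al.
  have := card_misled C Sl (conj SZ Sd); rewrite Sp => mis.
  apply: leq_trans (_ : #|A1|.+1 * ((l ^ 2) ^ p * #|C| ^ #|V|) <= _); last first.
    by rewrite leq_mul2r ltA1 orbT.
  rewrite mulSn addnC; apply: leq_trans (leq_add Nle mis).
  by rewrite [X in _ + X]mulnC -mulnDl leq_mul2r leq_card_setU orbT.
Qed.

Lemma approximated_or P N F G : approximated P N F -> approximated P N G ->
  exists2 N', negligible_neg 1 N' & approximated P (N :|: N') (fun x => F x || G x).
Proof.
move=> [A [/andP[AM /forall_inP Al] Ap An]] [B [/andP[BM /forall_inP Bl] Bp Bn]].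
have [X|D [N' [sD DA DN lN']]] := @pluck (A :|: B).
  by rewrite inE => /orP[/Al|/Bl].
exists N'.
  rewrite /negligible_neg mul1n; apply: leq_trans lN' _; rewrite leq_mul2r.
  apply/orP; right; apply: leq_trans (leq_card_setU _ _) _.
  (* At most [2 * M] sets enter the plucking, and [2 * M <= M ^ 2]. *)
  by apply: leq_trans (leq_add AM BM) _; rewrite addnn -mul2n -mulnn leq_mul2r M_gt1 orbT.
exists D; split=> // [K KP|c].
  have [[X XAB XK]|] := pselect (exists2 X, X \in A :|: B & X \subset clique K).
    have [Y YD YX] := DA X XAB => _; apply/exists_inP; exists Y => //.
    exact: subset_trans YX XK.
  move=> no /orP[/(Ap K KP)|/(Bp K KP)] /exists_inP[X XA XK]; case: no; exists X => //;
  by rewrite inE XA ?orbT.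
rewrite inE negb_or => /andP[cN cN'] /(DN c cN') /exists_inP[X].
rewrite inE => /orP[XA|XB] cX; apply/orP; [left; apply: An|right; apply: Bn] => //;
by apply/exists_inP; exists X.
Qed.

(** The approximator consists of pairwise unions. Those with more than [l] vertices are dropped,
    which costs only the cliques containing such a union; the rest is plucked. *)
Lemma approximated_and P N F G : approximated P N F -> approximated P N G ->
  exists P' N', [/\ negligible_pos 1 P', negligible_neg 1 N'
    & approximated (P :|: P') (N :|: N') (fun x => F x && G x)].
Proof.
move=> [A [/andP[AM /forall_inP Al] Ap An]] [B [/andP[BM /forall_inP Bl] Bp Bn]].
pose U := [set u.1 :|: u.2 | u in setX A B].
have cardU : #|U| <= M ^ 2.
  by apply: leq_trans (leq_imset_card _ _) _; rewrite cardsX -mulnn leq_mul.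
have [X|D [N' [sD DA DN lN']]] := @pluck [set X in U | #|X| <= l].
  by rewrite inE => /andP[].
pose P' := \bigcup_(X in U | l < #|X|) [set K | X \subset clique K].
exists P', N'; split.
- rewrite /negligible_pos mul1n.
  have [J0|J0] := posnP #|J|; first by rewrite J0 exp0n ?muln0.
  apply: leq_trans
    (_ : (\sum_(X in U | l < #|X|) #|[set K | X \subset clique K]|) * #|J| ^ l.+1 <= _).
    by rewrite leq_mul2r leq_card_bigcup orbT.
  rewrite big_distrl /=; apply: leq_trans (_ : \sum_(X in U) #|J| ^ #|I| <= _).
    rewrite big_mkcondr; apply: leq_sum => X XU; case: ifP => // lX.
    apply: leq_trans (card_cliques X); rewrite mulnC leq_mul2r.
    by rewrite leq_pexp2l ?orbT.
  by rewrite sum_nat_const leq_mul2r cardU orbT.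
- rewrite /negligible_neg mul1n; apply: leq_trans lN' _; rewrite leq_mul2r.
  apply/orP; right; apply: leq_trans cardU; apply/subset_leq_card/subsetP => X.
  by rewrite inE => /andP[].
exists D; split=> // [K|c].
  rewrite inE negb_or => /andP[KP KP'] /andP[/(Ap K KP) + /(Bp K KP)].
  case/exists_inP => X XA XK /exists_inP[Y YB YK].
  have XYU : X :|: Y \in U by apply/imsetP; exists (X, Y); rewrite // inE /= XA.
  have XYK : X :|: Y \subset clique K by rewrite subUset XK.
  have [lXY|lXY] := leqP #|X :|: Y| l.
    have [|Z ZD ZXY] := DA (X :|: Y); first by rewrite inE XYU.
    by apply/exists_inP; exists Z => //; apply: subset_trans ZXY XYK.
  by case/negP: KP'; apply/bigcupP; exists (X :|: Y); rewrite ?XYU // inE.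
rewrite inE negb_or => /andP[cN cN'] /(DN c cN') /exists_inP[Z].
case/setIdP=> /imsetP[[X Y] /setXP[/= XA YB] ->] _ cXY; apply/andP.
split; [apply: An|apply: Bn] => //;
apply/exists_inP; [exists X|exists Y] => //; apply: rainbowS cXY;
[exact: subsetUl|exact: subsetUr].
Qed.

Lemma approximated_false P N F : (forall x, F x = false) -> approximated P N F.
Proof.
move=> F0; exists set0; split=> [|K _|c _ /exists_inP[X]].
- by rewrite /small cards0; apply/forall_inP => X; rewrite inE.
- by rewrite F0.
- by rewrite inE.
Qed.

Lemma approximated_set X P N F : #|X| <= l ->
    (forall K, F (inl K) -> X \subset clique K) ->
    (forall c, rainbow c X -> F (inr c)) ->
  approximated P N F.
Proof.
move=> lX XK Xc; exists [set X]; split=> [|K _ /XK XsK|c _ /exists_inP[Y]].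
- by rewrite /small cards1 (ltnW M_gt1); apply/forall_inP => Y /set1P ->.
- by apply/exists_inP; exists X => //; exact: set11.
- by move/set1P ->; exact: Xc.
Qed.

(** Either the approximator is empty and rejects every clique, or it has a member [X] with at most
    [l] vertices, on which at least half of the colourings are rainbow. So one of the two error sets
    is large. *)
Lemma approximated_separates s P N F : 2 * l ^ 2 <= #|C| -> 0 < #|J| ->
    negligible_pos s P -> negligible_neg s N -> approximated P N F ->
    (forall K, F (inl K)) -> (forall c, ~~ F (inr c)) ->
  #|J| ^ l.+1 <= s * M ^ 2 \/ #|C| ^ p <= 2 * s * M ^ 2 * (l ^ 2) ^ p.
Proof.
move=> lC J0 nP nN [A [/andP[_ /forall_inP Al] Ap An]] FK Fc.
have [A0|[X XA]] := set_0Vmem A.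
  left; have PT : #|P| = #|J| ^ #|I|.
    rewrite -card_ffun -cardsT; congr #|pred_of_set _|; apply/setP => K; rewrite inE.
    by apply: contraT => /(Ap K)/(_ (FK K))/exists_inP[X]; rewrite A0 inE.
  by move: nP; rewrite /negligible_pos PT mulnC leq_pmul2r // expn_gt0 J0.
(* A single set is a sunflower with empty core, and [card_misled] becomes a union bound on the
   colourings that are not rainbow on [X]. *)
right; have sX : sunflower [set X] set0.
  split=> [Y _|Y Y' /set1P -> /set1P ->]; first exact: sub0set.
  by rewrite eqxx.
have := @card_misled _ C [set X] set0 l; rewrite cards1 !expn1 => /(_ _ sX) mis.
have {}mis : #|C| * #|misled C [set X] set0| <= l ^ 2 * #|C| ^ #|V|.
  by apply: mis => Y /set1P ->; exact: Al.
have half : 2 * #|misled C [set X] set0| <= #|C| ^ #|V|.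
  by rewrite -(@leq_pmul2l (l ^ 2)) ?expn_gt0 ?(ltnW l_gt1) //; apply: leq_trans mis; nia.
have cov : #|C| ^ #|V| <= #|misled C [set X] set0| + #|N|.
  rewrite -card_ffun -cardsT; apply: leq_trans (leq_card_setU _ _).
  apply/subset_leq_card/subsetP => c _; rewrite !inE.
  have [cN|cN] := boolP (c \in N); first by rewrite orbT.
  rewrite orbF; apply/andP; split; first by apply/rainbowP => i j; rewrite inE.
  apply/forall_inP => Y /set1P ->; apply: contraNN (Fc c) => cX.
  by apply: An => //; apply/exists_inP; exists X.
have CV0 : 0 < #|C| ^ #|V| by rewrite expn_gt0 C_gt0.
rewrite -(leq_pmul2r CV0); move: nN; rewrite /negligible_neg => nN.
apply: leq_trans (_ : 2 * (#|N| * #|C| ^ p) <= _).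
  by rewrite mulnA [leqLHS]mulnC leq_mul2r; apply/orP; right; lia.
by rewrite -!mulnA leq_mul2l /= !mulnA; rewrite !mulnA in nN.
Qed.

(** * Horn closure as a monotone computation *)

Section Horn.
Variable T : eqType.
Implicit Types (cl : seq T * T) (W : T -> pos + neg -> bool).

(** One pair of error sets serves all [f] at once, so the error grows with the number of gates and
    not with the number of formulas. *)
Definition approximable s W := exists P N,
  [/\ negligible_pos s P, negligible_neg s N & forall f, approximated P N (W f)].

Definition fire W cl : T -> pos + neg -> bool :=
  fun f x => W f x || ((f == cl.2) && all (W ^~ x) cl.1).

Lemma negligible_pos0 : negligible_pos 0 set0.
Proof. by rewrite /negligible_pos cards0. Qed.

Lemma negligible_neg0 : negligible_neg 0 set0.
Proof. by rewrite /negligible_neg cards0. Qed.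

Lemma approximable_all s W b : approximable s W -> exists P N,
  [/\ negligible_pos (s + size b) P, negligible_neg (s + size b) N,
     forall f, approximated P N (W f) & approximated P N (fun x => all (W ^~ x) b)].
Proof.
move=> [P [N [nP nN YPN]]]; elim: b => [|f b [Pb [Nb [nPb nNb Yb ab]]]].
  exists P, N; rewrite addn0; split=> //.
  apply: (@approximated_set set0) => //; first by rewrite cards0.
  by move=> K _; exact: sub0set.
have [P' [N' [nP' nN' fb]]] := approximated_and (Yb f) ab.
exists (Pb :|: P'), (Nb :|: N'); split=> //=.
- by rewrite addnS -addn1; exact: negligible_posU.
- by rewrite addnS -addn1; exact: negligible_negU.
- by move=> g; apply: approximatedS (Yb g); exact: subsetUl.
Qed.

Lemma approximable_fire s W cl :
  approximable s W -> approximable (s + (size cl.1).+1) (fire W cl).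
Proof.
move=> aY; have [P [N [nP nN YPN bPN]]] := approximable_all cl.1 aY.
have [N' nN' hN'] := approximated_or (YPN cl.2) bPN.
exists P, (N :|: N'); split.
- rewrite addnS -addn1 -[P]setU0; apply: negligible_posU => //.
  by rewrite /negligible_pos cards0.
- by rewrite addnS -addn1; exact: negligible_negU.
move=> f; rewrite /fire; have [->//|ne] := eqVneq f cl.2.
have -> : (fun x => W f x || false && all (W ^~ x) cl.1) = W f.
  by apply: funext => x; rewrite orbF.
by apply: approximatedS (YPN f); [|exact: subsetUl].
Qed.

Lemma approximable_foldl w s W cls : all (fun cl : seq T * T => size cl.1 <= w) cls ->
  approximable s W -> approximable (s + size cls * w.+1) (foldl fire W cls).
Proof.
have mono s' t W' : s' <= t -> approximable s' W' -> approximable t W'.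
  move=> st [P [N [nP nN YPN]]]; exists P, N; split=> //.
    by apply: leq_trans nP _; rewrite -!mulnA leq_mul2r st orbT.
  by apply: leq_trans nN _; rewrite -!mulnA leq_mul2r st orbT.
elim: cls s W => [|cl cls IH] s W /=; first by rewrite addn0.
case/andP=> clw clsw aY; have := IH _ _ clsw (approximable_fire cl aY).
by apply: mono; rewrite mulSn addnA leq_add2r leq_add2l ltnS.
Qed.

Variables (cls : seq (seq T * T)) (w : nat) (H : pos + neg -> pred T).
Hypothesis cls_w : all (fun cl : seq T * T => size cl.1 <= w) cls.

Let pass W := foldl fire W cls.
Let closed_at x W := forall cl, cl \in cls -> all (W ^~ x) cl.1 -> W cl.2 x.

Lemma fold_fireW W cls' f x : W f x -> foldl fire W cls' f x.
Proof. by elim: cls' W => //= cl cls' IH W Wf; apply: IH; rewrite /fire Wf. Qed.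

Lemma fold_fire_clause W cls' cl x :
  cl \in cls' -> all (W ^~ x) cl.1 -> foldl fire W cls' cl.2 x.
Proof.
elim: cls' W => //= cl' cls' IH W; rewrite inE => /predU1P[<- b|clin b].
  by apply: fold_fireW; rewrite /fire eqxx b orbT.
by apply: IH => //; apply: sub_all b => g Wg; rewrite /fire Wg.
Qed.

Lemma fold_fire_horn W cls' x : {subset cls' <= cls} ->
  (forall f, W f x -> horn cls (H x) f) ->
  forall f, foldl fire W cls' f x -> horn cls (H x) f.
Proof.
elim: cls' W => //= cl cls' IH W sub WH; apply: IH => [g gin|f].
  by apply: sub; rewrite inE gin orbT.
case/orP=> [/WH//|/andP[/eqP -> /allP b]].
by apply: HornClause => [|g /b /WH//]; apply: sub; rewrite mem_head.
Qed.

Lemma closed_atP W x : closed_at x W -> forall f, pass W f x = W f x.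
Proof.
move=> clW f; apply/idP/idP; last exact: fold_fireW.
suff aux : forall cls' W', {subset cls' <= cls} ->
    (forall g, W' g x -> W g x) -> foldl fire W' cls' f x -> W f x by exact: aux.
elim=> //= [|cl cls' IH] W' sub W'W; first exact: W'W.
apply: IH => [g gin|g]; first by apply: sub; rewrite inE gin orbT.
case/orP=> [/W'W//|/andP[/eqP -> b]]; apply: clW; first by apply: sub; rewrite mem_head.
by apply: sub_all b => g'; exact: W'W.
Qed.

(** A pass started from an unclosed set makes the head of some clause newly true, and there are only
    [size cls] heads to gain. *)
Lemma iter_pass_closed W x : closed_at x (iter (size cls).+1 pass W).
Proof.
pose m W' := count (fun cl : seq T * T => W' cl.2 x) cls.
suff : closed_at x (iter (size cls).+1 pass W) \/
       (size cls).+1 <= m (iter (size cls).+1 pass W).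
  by case=> //; rewrite ltnNge count_size.
elim: (size cls).+1 => [|k [IH|IH]]; first by right.
  have e := closed_atP IH; left=> cl clin; rewrite iterS e => b; apply: IH => //.
  by rewrite (@eq_all _ _ ((pass (iter k pass W)) ^~ x)) // => g; rewrite e.
have [clo|nclo] := pselect (closed_at x (iter k pass W)).
  have e := closed_atP clo; left=> cl clin; rewrite iterS e => b; apply: clo => //.
  by rewrite (@eq_all _ _ ((pass (iter k pass W)) ^~ x)) // => g; rewrite e.
right; apply: leq_ltn_trans IH _.
have [cl [clin b nW]] : exists cl, [/\ cl \in cls, all ((iter k pass W) ^~ x) cl.1
    & ~~ iter k pass W cl.2 x].
  apply: contrapT => no; apply: nclo => cl clin b; apply: contrapT => /negP nW.
  by apply: no; exists cl.
set W1 := iter k pass W in b nW *; rewrite /m iterS -/W1.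
rewrite -[ltnLHS]add0n -addSn.
have split1 W' : count (fun cl' : seq T * T => W' cl'.2 x) cls =
    W' cl.2 x + count (fun cl' : seq T * T => W' cl'.2 x) (rem cl cls).
  by rewrite (permP (perm_to_rem clin)).
rewrite !split1 (negPf nW) [pass W1 cl.2 x](fold_fire_clause clin b) leq_add //.
by apply: sub_count => cl'; exact: fold_fireW.
Qed.

Lemma approximable_iter k s W : approximable s W ->
  approximable (s + k * (size cls * w.+1)) (iter k pass W).
Proof.
elim: k => [|k IH] aW; first by rewrite addn0.
rewrite mulSn [size cls * _ + _]addnC addnA iterS.
by apply: approximable_foldl => //; exact: IH.
Qed.

(** After [(size cls).+1] passes the iteration equals the Horn closure on every test, so
    [approximated_separates] applies with [s] bounding all gates fired. *)
Lemma horn_separates goal : 2 * l ^ 2 <= #|C| -> 0 < #|J| ->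
    (forall f, approximated set0 set0 (H ^~ f)) ->
    (forall K, horn cls (H (inl K)) goal) ->
    (forall c, ~ horn cls (H (inr c)) goal) ->
  let s := (size cls).+1 * (size cls * w.+1) in
  #|J| ^ l.+1 <= s * M ^ 2 \/ #|C| ^ p <= 2 * s * M ^ 2 * (l ^ 2) ^ p.
Proof.
move=> lC J0 Hap HK Hc s; pose W0 f x := H x f.
have aW0 : approximable 0 W0.
  by exists set0, set0; split; [exact: negligible_pos0|exact: negligible_neg0|].
have [P [N [nP nN aPN]]] := approximable_iter (size cls).+1 aW0.
have complete f x : horn cls (H x) f -> iter (size cls).+1 pass W0 f x.
  elim=> [g Hg|cl clin _ b].
    have : W0 g x by []; elim: (size cls).+1 => //= k IH /IH; exact: fold_fireW.
  by apply: iter_pass_closed => //; apply/allP.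
have sound f x : iter (size cls).+1 pass W0 f x -> horn cls (H x) f.
  elim: (size cls).+1 f => [|k IH] f /=; first by move=> Wf; apply: HornHyp.
  by apply: fold_fire_horn.
apply: (approximated_separates lC J0 nP nN (aPN goal)) => [K|c].
  exact/complete/HK.
by apply/negP => /sound/Hc.
Qed.

End Horn.

End Approximation.

Section CliqueColouring.

Variables (T : eqType) (n k t w : nat) (cls : seq (seq T * T)).
Variables (H : rel 'I_n -> pred T) (goal : T).
Hypothesis cls_w : all (fun cl : seq T * T => size cl.1 <= w) cls.
Hypothesis H_input : forall f, [\/ forall G, H G f = false, forall G, H G f = true
  | exists i j, forall G, H G f = G i j].

(* Razborov's theorem in the parameters of Alon and Boppana: sets of size at most
   [t] and sunflowers with [t] petals. *)
Theorem clique_colouring_bound : 1 < t -> t ^ 8 <= k -> k ^ 2 <= n ->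
    (forall (G : rel 'I_n) (v : 'I_k.+1 -> 'I_n), injective v ->
       (forall l m, l != m -> G (v l) (v m)) -> horn cls (H G) goal) ->
    (forall (G : rel 'I_n) (c : 'I_n -> 'I_k),
       (forall i j, G i j -> c i != c j) -> ~ horn cls (H G) goal) ->
  2 ^ t <= (size cls).+1 * (size cls * w.+1).
Proof.
(* [b] is the size of each of the [k.+1] disjoint blocks, from which a clique takes one vertex
   each. *)
move=> t1 tk kn Hcl Hcol; pose b := n %/ k.+1.
have t8 : t ^ 8 = t ^ 7 * t by rewrite -expnSr.
have t7 : 0 < t ^ 7 by rewrite expn_gt0 (ltnW t1).
have bt : t ^ 7 <= b.
  rewrite leq_divRL //; apply: leq_trans kn.
  have k1 : t ^ 7 * 2 <= k by apply: leq_trans tk; rewrite t8 leq_mul2l t1 orbT.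
  rewrite -mulnn; nia.
have hP (i : 'I_k.+1) (j : 'I_b) : i * b + j < n.
  apply: leq_trans (leq_trunc_div n k.+1); rewrite -/b mulnC.
  have := ltn_ord i; have := ltn_ord j; nia.
pose h (u : 'I_k.+1 * 'I_b) : 'I_n := Ordinal (hP u.1 u.2).
have h_inj : injective h.
  move=> [i j] [i' j'] /(congr1 val) /= e.
  have ij : i = i' :> nat.
    have := congr1 (fun x => x %/ b) e; have b0 : 0 < b by apply: leq_trans bt.
    by rewrite !divnMDl // !divn_small // !addn0.
  congr pair; apply: val_inj => //=.
  by move: e; rewrite ij => /addnI.
pose graph (x : {ffun 'I_k.+1 -> 'I_b} + {ffun 'I_n -> 'I_k}) : rel 'I_n := fun i j =>
  match x with
  | inl K => [&& i != j, i \in clique h K & j \in clique h K]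
  | inr c => c i != c j
  end.
have k0 : 0 < k by apply: leq_trans tk; rewrite expn_gt0 (ltnW t1).
have C0 : 0 < #|'I_k| by rewrite card_ord.
have Hap f : approximated h t t set0 set0 (fun x => H (graph x) f).
  have [H0|H1|[i [j Hij]]] := H_input f.
  - by apply: approximated_false => x; exact: H0.
  - apply: (approximated_set (X := set0) t1 t1 C0); rewrite ?cards0 // => *;
    by rewrite ?sub0set ?H1.
  have [ij|ij] := eqVneq i j.
    by apply: approximated_false => -[K|c]; rewrite Hij /graph ij eqxx.
  apply: (approximated_set (X := [set i; j]) t1 t1 C0); rewrite ?cards2 ?ij //.
    move=> K; rewrite Hij => /and3P[_ iK jK]; apply/subsetP => v.
    by rewrite !inE => /orP[] /eqP ->.
  move=> c /rainbowP cij; rewrite Hij /=; apply: contraNN ij => /eqP.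
  by move/cij => -> //; rewrite !inE eqxx ?orbT.
have HK K : horn cls (H (graph (inl K))) goal.
  apply: (Hcl _ (fun i => h (i, K i))) => [i j /h_inj[]//|i j ij] /=.
  rewrite /graph; apply/and3P; split.
  - by apply: contraNneq ij => /h_inj[->].
  - by apply/imsetP; exists i.
  - by apply/imsetP; exists j.
have Hc c : ~ horn cls (H (graph (inr c))) goal by apply: (Hcol _ c).
have b0 : 0 < b by apply: leq_trans bt.
have M2 : ((t * t) ^ t) ^ 2 = t ^ (4 * t) by rewrite mulnn -!expnM; congr expn; lia.
have C2 : 2 * t ^ 2 <= #|'I_k|.
  rewrite card_ord; apply: leq_trans tk; rewrite (expnD t 1 7) (expnD t 2 5) expn1.
  by rewrite leq_mul // leq_pmulr // expn_gt0 (ltnW t1).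
have J0 : 0 < #|'I_b| by rewrite card_ord b0.
have tt : 2 ^ t <= t ^ t by rewrite leq_exp2r // ltnW.
have tt0 m : 0 < t ^ m by rewrite expn_gt0 (ltnW t1).
have := horn_separates h_inj t1 t1 C0 cls_w C2 J0 Hap HK Hc.
(* After cancelling [M ^ 2 = t ^ (4 * t)], blocks of size at least [t ^ 7] leave
   [t ^ (3 * t + 7) <= s], and at least [t ^ 8] colours leave [t ^ (2 * t) <= 2 * s]. *)
move=> /=; set s := _.+1 * _; rewrite !card_ord M2 => -[le1|le2].
  have : t ^ (7 * t.+1) <= s * t ^ (4 * t).
    by apply: leq_trans le1; rewrite expnM leq_exp2r.
  have -> : 7 * t.+1 = (t + (2 * t + 7)) + 4 * t by lia.
  rewrite expnD leq_pmul2r // => le3; apply: leq_trans tt _; apply: leq_trans le3.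
  by rewrite leq_pexp2l ?leq_addr // ltnW.
have : t ^ (8 * t) <= 2 * s * t ^ (4 * t) * (t ^ 2) ^ t.
  by apply: leq_trans le2; rewrite expnM leq_exp2r // ltnW.
have -> : 8 * t = (t + t) + (4 * t + 2 * t) by lia.
rewrite -expnM -[leqRHS]mulnA -expnD expnD leq_pmul2r // expnD => le3.
have : 2 * 2 ^ t <= 2 * s.
  apply: leq_trans le3; rewrite leq_mul //; apply: leq_trans tt.
  by rewrite -{1}[2]expn1 leq_pexp2l // ltnW.
by rewrite leq_pmul2l.
Qed.

End CliqueColouring.

From mathcomp Require Import classical_sets reals exp.

Local Open Scope classical_set_scope.

(** * Forks and diamonds *)

Fixpoint eval (d : pred nat) (f : lform) : bool :=
  match f with
  | Var x => d x
  | Con CTop => true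
  | Con CBot => false
  | Bin BAnd g h => eval d g && eval d h
  | Bin BOr g h => eval d g || eval d h
  | Bin BImp g h => eval d g ==> eval d h
  end.

(* Forcing at a point with valuation [d] that is maximal, if [top] is [None], or has
   a single proper successor with valuation [e], if [top] is [Some e]. *)
Fixpoint leaf_forces (top : option (pred nat)) (d : pred nat) (f : lform) : bool :=
  match f with
  | Var x => d x
  | Con CTop => true
  | Con CBot => false
  | Bin BAnd g h => leaf_forces top d g && leaf_forces top d h
  | Bin BOr g h => leaf_forces top d g || leaf_forces top d h
  | Bin BImp g h => (if top is Some e then eval e g ==> eval e h else true) &&
                    (leaf_forces top d g ==> leaf_forces top d h)
  end.

(* Forcing at the root of the fork, or of the diamond, with middle points [I]. *)
Fixpoint root_forces (top : option (pred nat)) (I : finType) (ds : I -> pred nat)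
    (rt : pred nat) (f : lform) : bool :=
  match f with
  | Var x => rt x
  | Con CTop => true
  | Con CBot => false
  | Bin BAnd g h => root_forces top ds rt g && root_forces top ds rt h
  | Bin BOr g h => root_forces top ds rt g || root_forces top ds rt h
  | Bin BImp g h => [forall i, leaf_forces top (ds i) f] &&
                    (root_forces top ds rt g ==> root_forces top ds rt h)
  end.

(** * The canonical model of prime theories *)

Section PrimeTheories.

Variable D : set lform -> lform -> Prop.
Hypothesis HD : super_intuitionistic D.
Implicit Types (X Y Z : set lform) (f g h : lform) (s : seq lform).
Local Open Scope form_L_scope.

Let D_consequence : consequence D := HD.1.

Lemma deriv_refl X f : X f -> D X f.
Proof. by case: D_consequence => _ + _ _; apply. Qed.

Lemma deriv_cut X Y f : D X f -> (forall g, X g -> D Y g) -> D Y f.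
Proof. by case: D_consequence => _ _ + _; apply. Qed.

Lemma deriv_mono X Y f : X `<=` Y -> D X f -> D Y f.
Proof. by move=> XY /deriv_cut; apply=> g /XY; exact: deriv_refl. Qed.

Lemma deriv_rule ps c X : LJ_rule ps c -> (forall q, q \in ps -> holds D q) ->
  (forall g, g \in c.1 -> D X g) -> D X (odflt Bot c.2).
Proof. by move=> r /(HD.2 _ _ r) Dc cX; exact: deriv_cut Dc cX. Qed.

Lemma deriv_refl_seq s f : f \in s -> D [set` s] f.
Proof. by move=> fs; exact: deriv_refl. Qed.

Lemma deriv_top X : D X Top.
Proof. exact: (deriv_rule LJ_top). Qed.

Lemma deriv_bot X f : D X Bot -> D X f.
Proof.
move=> XB; apply: (deriv_rule (LJ_weakenR [:: Bot] f)) => [s|g]; rewrite inE => /eqP -> //.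
exact: deriv_refl_seq (mem_head _ _).
Qed.

Lemma deriv_mp X f g : D X (f → g) -> D X f -> D X g.
Proof.
move=> Xfg Xf; apply: (deriv_rule (LJ_Limp [:: f] [::] f g (Some g))) => [s|h].
  by rewrite !inE => /orP[] /eqP -> /=; apply: deriv_refl_seq (mem_head _ _).
by rewrite !inE => /orP[] /eqP ->.
Qed.

Lemma deriv_and X f g : D X (f ∧ g) <-> D X f /\ D X g.
Proof.
split=> [Xfg|[Xf Xg]].
  split; [apply: (deriv_rule (LJ_Land1 [::] f g (Some f)))|
          apply: (deriv_rule (LJ_Land2 [::] f g (Some g)))] => s; rewrite inE => /eqP -> //;
  exact: deriv_refl_seq (mem_head _ _).
apply: (deriv_rule (LJ_Rand [:: f; g] f g)) => [s|h]; rewrite !inE => /orP[] /eqP -> //;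
by apply: deriv_refl_seq; rewrite !inE eqxx ?orbT.
Qed.

Lemma deriv_or1 X f g : D X f -> D X (f ∨ g).
Proof.
move=> Xf; apply: (deriv_rule (LJ_Ror1 [:: f] f g)) => s; rewrite inE => /eqP -> //.
exact: deriv_refl_seq (mem_head _ _).
Qed.

Lemma deriv_or2 X f g : D X g -> D X (f ∨ g).
Proof.
move=> Xf; apply: (deriv_rule (LJ_Ror2 [:: g] f g)) => s; rewrite inE => /eqP -> //.
exact: deriv_refl_seq (mem_head _ _).
Qed.

(** The deduction theorem for sets: finitarity provides a list of premises, from which [f] is
    filtered out before [LJ_Rimp] applies. *)
Lemma deriv_imp X f g : D (X `|` [set f]) g <-> D X (f → g).
Proof.
split=> [|Xfg]; last first.
  apply: (@deriv_mp _ f); first by apply: deriv_mono Xfg => h; left.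
  by apply: deriv_refl; right.
case: D_consequence => _ _ _ fin /fin[s sX sg].
pose G := [seq h <- s | h != f].
apply: (deriv_rule (LJ_Rimp G f g)) => [q|h].
  rewrite inE => /eqP -> /=; apply: deriv_mono sg => h /= hs.
  rewrite inE; case: eqP => //= /eqP hf.
  by rewrite mem_filter hf.
rewrite mem_filter => /andP[/eqP hf hs]; apply: deriv_refl.
by case: (sX h hs).
Qed.

Lemma deriv_orE X f g h :
  D X (f ∨ g) -> D (X `|` [set f]) h -> D (X `|` [set g]) h -> D X h.
Proof.
move=> Xfg /deriv_imp Xf /deriv_imp Xg.
pose G := [:: f → h; g → h].
apply: (deriv_rule (LJ_Lor G f g (Some h))) => [s|k].
  rewrite !inE => /orP[] /eqP -> /=; [apply: (@deriv_mp _ f)|apply: (@deriv_mp _ g)];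
  by apply: deriv_refl_seq; rewrite !inE eqxx ?orbT.
by rewrite !inE => /or3P[] /eqP ->.
Qed.

Definition theory X := forall f, D X f -> X f.

Definition prime X :=
  [/\ theory X, ~ X Bot & forall f g, X (f ∨ g) -> X f \/ X g].

(** The extension is maximal among all theories omitting [f]; [fork_or_diamond] uses this to control
    everything strictly above its root. *)
Lemma lindenbaum X f : ~ D X f -> exists Y,
  [/\ X `<=` Y, prime Y, ~ Y f & forall Z, theory Z -> Y `<=` Z -> ~ Z f -> Z `<=` Y].
Proof.
(* Zorn is applied to the sets [Y] adjoined to [X], so the empty chain is an instance like any
   other. *)
move=> Xf; have [F FP Ftot DF|Y [Yf Ymax]] := @Zorn_bigcup _ (fun Y => ~ D (X `|` Y) f).
  have [s sX sf] : exists2 s : seq lform,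
      [set` s] `<=` X `|` \bigcup_(Z in F) Z & D [set` s] f.
    by case: D_consequence => _ _ _ fin; exact: fin DF.
  suff [sX0|[Z FZ sZ]] : [set` s] `<=` X \/ exists2 Z, F Z & [set` s] `<=` X `|` Z.
  - by apply: Xf; exact: deriv_mono sf.
  - by apply: (FP Z FZ); exact: deriv_mono sf.
  elim: s sX {sf} => [|g s IH] sX; first by left.
  have sub h : h \in s -> [set` g :: s] h by move=> hs; rewrite /= inE hs orbT.
  have [h /sub /sX//|sX0|[Z FZ sZ]] := IH.
    have [Xg|[Z FZ Zg]] := sX g (mem_head _ _).
      by left=> h /predU1P[->//|]; exact: sX0.
    by right; exists Z => // h /predU1P[->|/sX0 Xh]; [right|left].
  right; have [Xg|[Z' FZ' Zg]] := sX g (mem_head _ _).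
    by exists Z => // h /predU1P[->|/sZ//]; left.
  have [ZZ'|Z'Z] := Ftot Z Z' FZ FZ'.
    exists Z' => // h /predU1P[->|/sZ[Xh|/ZZ' Z'h]]; by [right|left].
  by exists Z => // h /predU1P[->|/sZ//]; right; exact: Z'Z.
have Ymax' Z : X `<=` Z -> Y `<=` Z -> ~ D Z f -> Z `<=` Y.
  move=> XZ YZ Zf g Zg; apply: contrapT => Yg; apply: (Ymax Z).
    by split=> // ZY; exact/Yg/ZY.
  by rewrite setUidr.
have XY : X `<=` Y.
  by move=> g Xg; apply: (Ymax' (X `|` Y)) => //; left.
have {}Yf : ~ D Y f by rewrite setUidr in Yf.
have thY : theory Y.
  move=> g Yg; apply: (Ymax' [set h | D Y h]) => //= [h /XY|h|].
  - exact: deriv_refl.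
  - exact: deriv_refl.
  - by move=> DY; apply: Yf; apply: deriv_cut DY _.
exists Y; split=> //.
- split=> // [/deriv_refl/deriv_bot//|g h Ygh].
  apply: contrapT => /not_orP[Yg Yh]; apply: Yf.
  have ext k : ~ Y k -> D (Y `|` [set k]) f.
    move=> Yk; apply: contrapT => nD; apply: Yk; apply: (Ymax' (Y `|` [set k])) => //.
      by move=> ? /XY; left.
    by right.
  by apply: (@deriv_orE _ g h); [exact: deriv_refl|exact: ext|exact: ext].
- by move=> /deriv_refl.
- move=> Z thZ YZ Zf; apply: Ymax' => //; first exact: subset_trans YZ.
  by move/thZ.
Qed.

Lemma prime_mem X f : prime X -> X f <-> D X f.
Proof. by case=> th _ _; split=> [|/th//]; exact: deriv_refl. Qed.

Lemma prime_top X : prime X -> X Top.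
Proof. by move=> pX; apply/(prime_mem _ pX); exact: deriv_top. Qed.

Lemma prime_and X f g : prime X -> X (f ∧ g) <-> X f /\ X g.
Proof. by move=> pX; rewrite !(prime_mem _ pX); exact: deriv_and. Qed.

Lemma prime_or X f g : prime X -> X (f ∨ g) <-> X f \/ X g.
Proof.
move=> pX; split=> [|[]]; first by case: pX => _ _; apply.
  by rewrite !(prime_mem _ pX); exact: deriv_or1.
by rewrite !(prime_mem _ pX); exact: deriv_or2.
Qed.

Lemma prime_mp X f g : prime X -> X (f → g) -> X f -> X g.
Proof. by move=> pX; rewrite !(prime_mem _ pX); exact: deriv_mp. Qed.

Lemma prime_imp X f g : prime X ->
  X (f → g) <-> forall Y, prime Y -> X `<=` Y -> Y f -> Y g.
Proof.
move=> pX; split=> [Xfg Y pY /(_ _ Xfg)|Xfg]; first exact: prime_mp.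
apply/(prime_mem _ pX)/deriv_imp; apply: contrapT => /lindenbaum[Y [XY pY Yg _]].
by apply: Yg; apply: Xfg => // [h Xh|]; apply: XY; [left|right].
Qed.

Lemma prime_bigor X s : prime X -> X (bigor s) <-> exists2 f, f \in s & X f.
Proof.
move=> pX; elim: s => [|f s IH].
  by split=> [|[]//]; case: pX => _ + _ => /[apply].
have -> : X (bigor (f :: s)) <-> X f \/ X (bigor s).
  case: s {IH} => [|g s]; last exact: prime_or.
  by rewrite /bigor /=; case: pX => _ nX _; split; [left|case].
rewrite IH; split=> [[Xf|[g gs Xg]]|[g /predU1P[->|gs] Xg]].
- by exists f; rewrite ?mem_head.
- by exists g; rewrite // inE gs orbT.
- by left.
- by right; exists g.
Qed.

Lemma prime_bigand X s : prime X -> X (bigand s) <-> forall f, f \in s -> X f.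
Proof.
move=> pX; elim: s => [|f s IH]; first by split=> // _; exact: prime_top.
have -> : X (bigand (f :: s)) <-> X f /\ X (bigand s).
  case: s {IH} => [|g s]; last exact: prime_and.
  rewrite /bigand /=; split=> [Xf|[]//]; split=> //; exact: prime_top.
rewrite IH; split=> [[Xf Xs] g /predU1P[->//|/Xs//]|Xs].
by split=> [|g gs]; apply: Xs; rewrite inE ?eqxx ?gs ?orbT.
Qed.

(** * A p-morphism from the prime theories above [x] onto a fork or a diamond *)

Section Regions.
Variables (x : set lform) (dia : bool) (e : pred nat) (I : finType) (i0 : I).
Variables (ds : I -> pred nat) (rt : pred nat).
Variables (L : seq nat) (R : nat -> lform) (T : lform) (lbl : nat -> I).

Hypotheses (x_prime : prime x) (ds_rt : forall i, subpred rt (ds i))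
  (dia_e : dia -> forall i, subpred (ds i) e).
Hypothesis lbl_onto : forall i, exists2 a, a \in L & lbl a = i.

Implicit Types y z : set lform.

Hypothesis cover : forall y, prime y -> x `<=` y -> ~ y `<=` x ->
  y T \/ exists2 a, a \in L & y (R a).
Hypothesis disj : forall y a b, prime y -> x `<=` y -> a \in L -> b \in L ->
  y (R a) -> y (R b) -> y T \/ a = b.
Hypothesis inhab : forall a, a \in L -> exists y,
  [/\ prime y, x `<=` y, y (R a) & ~ y T].
Hypothesis x_out : ~ x T /\ forall a, a \in L -> ~ x (R a).
Hypothesis sees_top : dia -> forall y a, prime y -> x `<=` y -> a \in L -> y (R a) ->
  exists z, [/\ prime z, y `<=` z & z T].
Hypothesis no_top : ~~ dia -> forall y, prime y -> ~ y T.

Let top := if dia then Some e else None.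

(** Pulls a valuation back along the p-morphism: each variable becomes a formula that defines, above
    [x], the preimage of its truth set. The preimage of a middle point is made of the sets [R a]
    without [T], and several [a] may share a label. *)
Definition region_subst v : lform :=
  if rt v then Top
  else bigor ([seq R a | a <- L & ds (lbl a) v] ++ if e v then [:: T] else [::]).

Lemma region_top y v : prime y -> x `<=` y -> y T -> y (region_subst v) <-> e v.
Proof.
move=> py xy yT; have dd : dia by apply: contraT => /no_top/(_ y py).
rewrite /region_subst; case: ifP => [rv|_].
  by split=> _; [exact/(dia_e dd)/(ds_rt i0)|exact: prime_top].
rewrite prime_bigor //; split=> [[f]|ev].
  rewrite mem_cat => /orP[/mapP[a]|]; last by case: (e v).
  by rewrite mem_filter => /andP[/(dia_e dd)].
by exists T; rewrite // mem_cat ev mem_head orbT.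
Qed.

Lemma region_leaf y a v : prime y -> x `<=` y -> ~ y T -> a \in L -> y (R a) ->
  y (region_subst v) <-> ds (lbl a) v.
Proof.
move=> py xy nyT aL ya; rewrite /region_subst; case: ifP => [rv|_].
  by split=> _; [exact: ds_rt|exact: prime_top].
rewrite prime_bigor //; split=> [[f]|dv].
  rewrite mem_cat => /orP[/mapP[b]|]; last first.
    by case: (e v) => //; rewrite inE => /eqP ->.
  rewrite mem_filter => /andP[dv bL] -> yb.
  by have [//|->] := disj py xy aL bL ya yb.
by exists (R a); rewrite // mem_cat map_f // mem_filter dv.
Qed.

Lemma region_root v : x (region_subst v) <-> rt v.
Proof.
rewrite /region_subst; case: ifP => [rv|_].
  by split=> _ //; exact: prime_top.
have [xT xR] := x_out; rewrite prime_bigor //; split=> // -[f].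
rewrite mem_cat => /orP[/mapP[a]|].
  by rewrite mem_filter => /andP[_ /xR] + ->.
by case: (e v) => //; rewrite inE => /eqP ->.
Qed.

Lemma region_eval f y : prime y -> x `<=` y -> y T ->
  y (subst region_subst f) <-> eval e f.
Proof.
elim: f y => [v|[]|[] g IHg h IHh] y py xy yT /=.
- exact: region_top.
- by split=> _ //; exact: prime_top.
- by case: py.
- by rewrite prime_and // IHg // IHh //; split=> /andP.
- by rewrite prime_or // IHg // IHh //; split=> /orP.
rewrite prime_imp //; split=> [H|/implyP H z pz yz].
  by apply/implyP; rewrite -!(IHg y, IHh y) // => yg; exact: H.
have [xz zT] : x `<=` z /\ z T by split; [exact: subset_trans yz|exact: yz].
by rewrite IHg // IHh.
Qed.

Lemma region_leaf_forces f y a : prime y -> x `<=` y -> ~ y T -> a \in L -> y (R a) ->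
  y (subst region_subst f) <-> leaf_forces top (ds (lbl a)) f.
Proof.
elim: f y => [v|[]|[] g IHg h IHh] y py xy nyT aL ya /=.
- exact: region_leaf.
- by split=> _ //; exact: prime_top.
- by case: py.
- by rewrite prime_and // IHg // IHh //; split=> /andP.
- by rewrite prime_or // IHg // IHh //; split=> /orP.
split=> [yi|/andP[ti /implyP li]].
  apply/andP; split; last first.
    by apply/implyP; rewrite -(IHg y) // -(IHh y) //; exact: prime_mp yi.
  rewrite /top; case: (boolP dia) => // /sees_top /(_ y a py xy aL ya)[z [pz yz zT]].
  have xz : x `<=` z by exact: subset_trans yz.
  apply/implyP; rewrite -(region_eval g pz) // -(region_eval h pz) //.
  by apply: (prime_mp pz); exact: yz.
rewrite prime_imp // => z pz yz; have xz : x `<=` z by exact: subset_trans yz.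
have [zT|nzT] := pselect (z T); last by rewrite (IHg z) ?(IHh z) //; exact: yz.
rewrite !region_eval //; move: ti; rewrite /top.
by case: (boolP dia) => [_ /implyP//|/no_top/(_ z pz)].
Qed.

Lemma region_root_forces f : x (subst region_subst f) <-> root_forces top ds rt f.
Proof.
elim: f => [v|[]|[] g IHg h IHh] /=.
- exact: region_root.
- by split=> _ //; exact: prime_top.
- by split=> //; case: x_prime.
- by rewrite prime_and // IHg // IHh //; split=> /andP.
- by rewrite prime_or // IHg // IHh //; split=> /orP.
split=> [xi|/andP[/forallP li /implyP ri]].
  apply/andP; split; last by apply/implyP; rewrite -IHg -IHh; exact: prime_mp xi.
  apply/forallP => i; have [a aL <-] := lbl_onto i.
  have [y [py xy ya nyT]] := inhab aL.
  by apply/(@region_leaf_forces (Bin BImp g h) y a py xy nyT aL ya); exact: xy.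
rewrite prime_imp // => y py xy.
have [yx|/(cover py xy) yR] := pselect (y `<=` x).
  by have -> : y = x by [apply/seteqP; split]; rewrite IHg IHh.
suff yi : y (subst region_subst (g → h)) by exact: prime_mp yi.
have [yT|nyT] := pselect (y T); last first.
  by case: yR => // -[a aL ya]; apply/(@region_leaf_forces _ y a py xy nyT aL ya); exact: li.
have dd : dia by apply: contraT => /no_top/(_ y py).
apply/region_eval => //=; have := li i0; rewrite /top dd => /andP[]//.
Qed.

End Regions.

Lemma logic_subst sg f : logic_of D f -> logic_of D (subst sg f).
Proof.
case: D_consequence => /(_ sg set0 f) + _ _ _ => /[apply].
by rewrite image_set0.
Qed.

(** Otherwise closure under substitution and modus ponens would put all of [Tk k] into the logic. *)
Lemma branching_axiom_underivable k :
  infinite_branching (logic_of D) -> ~ logic_of D (branching_axiom k).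
Proof.
move=> /(_ k) nTk Dk; apply: nTk => f; elim=> {f} [f|sg|f g _ Df _ Dg].
- suff H q : derivable LJ_rule q -> holds D q by move/H; apply: deriv_mono.
  by elim=> ps c r _ IH; exact: (HD.2 _ _ r).
- exact: logic_subst.
- exact: deriv_mp Df Dg.
Qed.

Definition sound_on (dia : bool) (M : nat) := forall f, logic_of D f ->
  forall (I : finType) (ds : I -> pred nat) (rt e : pred nat), 0 < #|I| <= M ->
    (forall i, subpred rt (ds i)) -> (dia -> forall i, subpred (ds i) e) ->
  root_forces (if dia then Some e else None) ds rt f.

Lemma sound_on_regions (dia : bool) M (x : set lform) (L : seq nat) (R : nat -> lform) T :
  prime x -> uniq L -> M <= size L ->
  (forall y, prime y -> x `<=` y -> ~ y `<=` x -> y T \/ exists2 a, a \in L & y (R a)) ->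
  (forall y a b, prime y -> x `<=` y -> a \in L -> b \in L ->
     y (R a) -> y (R b) -> y T \/ a = b) ->
  (forall a, a \in L -> exists y, [/\ prime y, x `<=` y, y (R a) & ~ y T]) ->
  (~ x T /\ forall a, a \in L -> ~ x (R a)) ->
  (dia -> forall y a, prime y -> x `<=` y -> a \in L -> y (R a) ->
     exists z, [/\ prime z, y `<=` z & z T]) ->
  (~~ dia -> forall y, prime y -> ~ y T) ->
  sound_on dia M.
Proof.
move=> px uL ML cover disj inhab x_out sees no_top f Df I ds rt e /andP[I0 IM] dsrt dse.
have [i0 _] : exists i0 : I, i0 \in I by exact/card_gt0P.
(* Regions in excess of [#|I|] all go to the default point [i0]. *)
pose lbl a := nth i0 (enum I) (index a L).
have lbl_onto i : exists2 a, a \in L & lbl a = i.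
  have iI : index i (enum I) < #|I| by rewrite cardE index_mem mem_enum.
  have iL : index i (enum I) < size L by apply: leq_trans iI (leq_trans IM ML).
  exists (nth 0 L (index i (enum I))); first exact: mem_nth.
  by rewrite /lbl index_uniq // nth_index // mem_enum.
apply/(region_root_forces i0 px dsrt dse lbl_onto cover disj inhab x_out sees no_top).
apply/(prime_mem _ px)/(deriv_mono (@sub0set _ _)); exact: logic_subst.
Qed.

(* At a maximal prime theory [x] refuting the branching axiom of index [2M], call an
   index [i] open if some [y] above [x] contains [p_i], no other [p_j], and a
   successor of [y] contains two of the variables. If there are [M] open indices, then
   they give the middle points of a diamond, otherwise the others give a fork. *)
Lemma fork_or_diamond M : infinite_branching (logic_of D) -> exists dia, sound_on dia M.
Proof.
move=> /(@branching_axiom_underivable (2 * M)); set k := 2 * M => nax.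
pose ks := iota 0 k.+1.
pose F := bigor [seq (Var j : lform) | j <- ks].
pose F' i := bigor [seq (Var j : lform) | j <- ks & j != i].
pose A := bigand [seq ((Var i → F' i) → F) | i <- ks].
have {nax} : ~ D (set0 `|` [set A]) F by rewrite deriv_imp.
case/lindenbaum => x [Ax px xF xmax].
have {A} {}Ax i : i \in ks -> x ((Var i → F' i) → F).
  move=> ik; have : x A by apply: Ax; right.
  by rewrite prime_bigand // => /(_ ((Var i → F' i) → F)); apply; exact: map_f.
have F_mem y : prime y -> y F <-> exists2 j, j \in ks & y (Var j).
  move=> py; rewrite prime_bigor //; split=> [[f /mapP[j jk ->]]|[j jk yj]].
    by exists j.
  by exists (Var j); rewrite // map_f.
pose two := bigor [seq (Var u.1 ∧ Var u.2 : lform)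
                  | u <- [seq (i, j) | i <- ks, j <- ks] & u.1 != u.2].
have two_mem y : prime y -> y two <->
    exists i j, [/\ i \in ks, j \in ks, i != j, y (Var i) & y (Var j)].
  move=> py; rewrite prime_bigor //; split=> [[f /mapP[u]]|[i [j [ik jk ij yi yj]]]].
    rewrite mem_filter => /andP[ne /allpairsP[[i j] [/= ik jk e]]] ->.
    by rewrite prime_and // e in ne * => -[yi yj]; exists i, j.
  exists (Var i ∧ Var j); last by rewrite prime_and.
  apply/mapP; exists (i, j) => //; rewrite mem_filter.
  by apply/andP; split=> //; apply/allpairsP; exists (i, j).
pose c i : lform := Var i ∧ (two → Bot).
have c_mem y i : prime y -> y (c i) <-> y (Var i) /\
    forall z, prime z -> y `<=` z -> ~ z two.
  move=> py; rewrite prime_and // prime_imp //; split=> -[yi yn]; split=> // z pz yz.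
    by move=> /(yn z pz yz); case: pz.
  by move/(yn z pz yz).
have x_var i : i \in ks -> ~ x (Var i) by move=> ik xi; apply: xF; apply/F_mem => //; exists i.
(* By maximality of [x], a prime theory strictly above it contains [F], hence a variable. *)
have strict y : prime y -> x `<=` y -> ~ y `<=` x -> exists2 j, j \in ks & y (Var j).
  move=> py xy yx; apply/F_mem => //; apply: contrapT => yF; apply: yx.
  by apply: xmax => //; case: py.
(* [x] omits [Var i → F' i], since the premise of the axiom would turn it into [F]; a prime theory
   witnessing this contains [Var i] and no other of the variables. *)
have only i : i \in ks -> exists y, [/\ prime y, x `<=` y, y (Var i) & ~ y two].
  move=> ik; have : ~ x (Var i → F' i).
    by move=> xi; apply: xF; exact: prime_mp px (Ax i ik) xi.
  rewrite prime_imp // => /existsNP[y] /not_implyP[py] /not_implyP[xy] /not_implyP[yi yF'].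
  exists y; split=> // /(two_mem y py)[a [b [ak bk ab ya yb]]]; apply: yF'.
  apply/prime_bigor => //; have [ai|ai] := eqVneq a i.
    exists (Var b); rewrite // map_f // mem_filter bk andbT.
    by rewrite -ai eq_sym.
  by exists (Var a); rewrite // map_f // mem_filter ai.
have uniq_var y i j : prime y -> i \in ks -> j \in ks -> y (Var i) -> y (Var j) ->
    ~ y two -> i = j.
  move=> py ik jk yi yj y2; apply: contrapT => /eqP ij; apply: y2.
  by apply/two_mem => //; exists i, j.
have c_two y i : prime y -> y (c i) -> ~ y two by move=> py /(c_mem y i py)[_]; apply.
pose open i := `[< exists y, [/\ prime y, x `<=` y, y (Var i), ~ y two & ~ y (c i)] >].
have ksP i : i \in ks -> ~ x (c i) by move=> ik /(c_mem x i px)[/(x_var i ik)].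
have x_two : ~ x two by move/(two_mem x px) => [i [j [ik _ _ /(x_var i ik)]]].
have closed_c i y : i \in ks -> ~~ open i -> prime y -> x `<=` y -> y (Var i) -> ~ y two ->
    y (c i).
  move=> ik /asboolPn ni py xy yi y2; apply: contrapT => yc; apply: ni.
  by exists y.
(* Of the [2 * M + 1] indices, at least [M] are open or at least [M] are not. *)
have szs : M <= size [seq i <- ks | open i] \/ M <= size [seq i <- ks | ~~ open i].
  have := count_predC open ks; rewrite !size_filter size_iota /k mul2n -addnn.
  rewrite -[count (predC open) ks]/(count (fun i => ~~ open i) ks) => e.
  case: (leqP M (count open ks)) => [|lt]; [by left|right].
  by rewrite -(leq_add2l M); apply: ltnW; rewrite -e leq_add2r ltnW.
have mem_fil P i : i \in [seq i <- ks | P i] -> i \in ks by rewrite mem_filter => /andP[].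
have [sz|sz] := szs.
  (* [T] holds at overlaps and at points with a variable that never reach one. So a point containing
     some [Var i] always sees [T]: it sees an overlap or lies in [c i] itself. *)
  exists true; pose T := two ∨ bigor [seq c i | i <- ks].
  have T_mem y : prime y -> y T <-> y two \/ exists2 i, i \in ks & y (c i).
    move=> py; rewrite prime_or // prime_bigor //; split=> -[]; try by left.
      by move=> [f /mapP[i ik ->] yc]; right; exists i.
    by move=> [i ik yc]; right; exists (c i); rewrite // map_f.
  apply: (@sound_on_regions true M x [seq i <- ks | open i] Var T) => //.
  - by rewrite filter_uniq // iota_uniq.
  - move=> y py xy yx; have [j jk yj] := strict y py xy yx.
    have [yT|nyT] := pselect (y T); [by left|right]; exists j => //.
    rewrite mem_filter jk andbT; apply/asboolP; exists y; split=> // h; apply: nyT;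
    by apply/T_mem => //; first [by left|by right; exists j].
  - move=> y i j py xy /mem_fil ik /mem_fil jk yi yj.
    have [y2|y2] := pselect (y two); first by left; apply/T_mem => //; left.
    by right; exact: uniq_var y2.
  - move=> i; rewrite mem_filter => /andP[/asboolP[y [py xy yi y2 yc]] ik].
    exists y; split=> // /(T_mem y py)[//|[j jk ycj]]; apply: yc.
    by rewrite (uniq_var y i j) //; case/(c_mem y j py): ycj.
  - split=> [/(T_mem x px)[//|[i /ksP]//]|i /mem_fil]; exact: x_var.
  - move=> _ y i py xy iL yi; have ik := mem_fil _ _ iL.
    have [y2|y2] := pselect (exists z, [/\ prime z, y `<=` z & z two]).
      by case: y2 => z [pz yz z2]; exists z; split=> //; apply/T_mem => //; left.
    exists y; split=> //; apply/T_mem => //; right; exists i => //; apply/c_mem => //.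
    by split=> // z pz yz z2; apply: y2; exists z.
exists false; pose B := [seq i <- ks | ~~ open i].
have [->|Bn0] := posnP M.
  by move=> f _ I ds rt e /andP[I0]; rewrite leqNgt I0.
have {Bn0} a0B : nth 0 B 0 \in B by apply: mem_nth; exact: leq_trans sz.
set a0 := nth 0 B 0 in a0B; have a0k := mem_fil _ _ a0B.
(* A fork has no top point, so its regions must be disjoint. Whatever lies outside [c i] for the
   other indices of [B], overlaps and open indices included, is merged with the region of the one
   index [a0]. *)
pose Q := bigor (two :: c a0 :: [seq Var j | j <- ks & open j]).
have Q_mem y : prime y -> y Q <->
    [\/ y two, y (c a0) | exists j, [/\ j \in ks, open j & y (Var j)]].
  move=> py; rewrite prime_bigor //; split=> [[f]|].
    rewrite !inE => /or3P[/eqP -> y2|/eqP -> yc|/mapP[j + ->] yj].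
    - by apply: Or31.
    - by apply: Or32.
    - by rewrite mem_filter => /andP[oj jk]; apply: Or33; exists j.
  case=> [y2|yc|[j [jk oj yj]]].
  - by exists two; rewrite // mem_head.
  - by exists (c a0); rewrite // !inE eqxx orbT.
  - by exists (Var j); rewrite // !inE map_f ?orbT // mem_filter oj.
pose R i := if i == a0 then Q else c i.
have BP i : i \in B -> i \in ks /\ ~~ open i by rewrite mem_filter => /andP[].
have cQ y i : prime y -> i \in B -> i != a0 -> y (c i) -> ~ y Q.
  move=> py /BP[ik ni] ia0 yc; have yi := ((c_mem y i py).1 yc).1; have y2 := c_two y i py yc.
  move/(Q_mem y py) => [//|yc0|[j [jk oj yj]]].
    by move/eqP: ia0; apply; apply: (uniq_var y) => //; case/(c_mem y a0 py): yc0.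
  by move: ni; rewrite (uniq_var y i j) // oj.
apply: (@sound_on_regions false M x B R Bot) => //.
- by rewrite filter_uniq // iota_uniq.
- move=> y py xy yx; right; have [j jk yj] := strict y py xy yx.
  have inQ : y Q -> exists2 a, a \in B & y (R a) by exists a0; rewrite // /R eqxx.
  have [y2|y2] := pselect (y two); first by apply: inQ; apply/Q_mem => //; apply: Or31.
  have [oj|nj] := boolP (open j); first by apply: inQ; apply/Q_mem => //; apply: Or33; exists j.
  have yc := closed_c j y jk nj py xy yj y2.
  have [ja0|ja0] := eqVneq j a0.
    by apply: inQ; apply/Q_mem => //; apply: Or32; rewrite -ja0.
  by exists j; rewrite ?mem_filter ?nj // /R (negPf ja0).
- move=> y i j py xy iB jB; rewrite /R.
  case: (eqVneq i a0) => [->|ia0]; case: (eqVneq j a0) => [->|ja0] //; try by right.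
  + by move=> yQ /(cQ y j py jB ja0).
  + by move=> /(cQ y i py iB ia0).
  + move=> yi yj; right; have [[ik _] [jk _]] := (BP i iB, BP j jB).
    apply: (uniq_var y) => //; last exact: c_two yi.
    * by case/(c_mem y i py): yi.
    * by case/(c_mem y j py): yj.
- move=> i iB; have [ik ni] := BP i iB; have [y [py xy yi y2]] := only i ik.
  have yc := closed_c i y ik ni py xy yi y2.
  exists y; split=> //; last by case: py.
  by rewrite /R; case: eqP => // ia0; apply/Q_mem => //; apply: Or32; rewrite -ia0.
- split=> [|i /BP[ik _]]; first by case: px.
  rewrite /R; case: eqP => _; last exact: ksP.
  by move/(Q_mem x px) => [//|/ksP|[j [/x_var]]] //; exact.
- by move=> _ y [].
Qed.

End PrimeTheories.

(** * Interpolation for extended Frege proofs *)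

Section Subformulas.
Local Open Scope form_L_scope.
Implicit Types (f g h u : lform) (s ds : seq lform) (tau : nat -> lform).

Fixpoint subformulas f : seq lform :=
  f :: match f with Bin _ g h => subformulas g ++ subformulas h | _ => [::] end.

Lemma subformulas_refl f : f \in subformulas f.
Proof. by case: f => *; rewrite mem_head. Qed.

Lemma subformulas_trans f g h :
  f \in subformulas g -> g \in subformulas h -> f \in subformulas h.
Proof.
move=> fg; elim: h => [x|c|b h1 IH1 h2 IH2]; first by rewrite inE => /eqP <-.
  by rewrite inE => /eqP <-.
rewrite inE => /predU1P[<- //|]; rewrite mem_cat => /orP[/IH1|/IH2] fh;
by rewrite /= inE mem_cat fh ?orbT.
Qed.

Lemma subformulas_bin b g h f : f \in [:: g; h] -> f \in subformulas (Bin b g h).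
Proof.
by rewrite /= !inE mem_cat => /orP[] /eqP ->; rewrite subformulas_refl ?orbT.
Qed.

Lemma subformulas_occurs x f g : f \in subformulas g -> occurs x f -> occurs x g.
Proof.
elim: g => [y|c|b g1 IH1 g2 IH2] /=; rewrite ?inE; try by move/eqP->.
case/predU1P=> [->//|]; rewrite mem_cat => /orP[/IH1|/IH2] + xf;
by move=> ->; rewrite ?orbT.
Qed.

Lemma occurs_subformulas x f : occurs x f = (Var x \in subformulas f).
Proof.
elim: f => [y|c|b g IHg h IHh] /=; rewrite inE.
- by apply/eqP/eqP => [->|[]].
- by case: eqP.
- by rewrite mem_cat IHg IHh; case: eqP.
Qed.

Lemma size_subformulas f : size (subformulas f) <= size (enc f).
Proof.
elim: f => [x|c|b g IHg h IHh] //=; first by rewrite size_rcons.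
by rewrite !size_cat /= size_rcons; lia.
Qed.

Lemma mem_subformulas_subst tau f g :
  f \in subformulas g -> subst tau f \in subformulas (subst tau g).
Proof.
elim: g => [x|c|b g1 IH1 g2 IH2].
- by rewrite inE => /eqP ->; exact: subformulas_refl.
- by rewrite inE => /eqP ->; exact: subformulas_refl.
rewrite inE => /predU1P[->|]; first exact: subformulas_refl.
by rewrite /= inE !mem_cat => /orP[/IH1|/IH2] ->; rewrite ?orbT.
Qed.

Lemma subformulas_subst tau f h : h \in subformulas (subst tau f) ->
  (exists2 g, g \in subformulas f & h = subst tau g) \/
  exists2 x, occurs x f & h \in subformulas (tau x).
Proof.
elim: f => [x|c|b g1 IH1 g2 IH2] /= => [hx||].
- by right; exists x.
- by rewrite inE => /eqP ->; left; exists (Con c); rewrite ?mem_head.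
rewrite inE => /predU1P[->|].
  by left; exists (Bin b g1 g2); rewrite ?mem_head.
rewrite mem_cat => /orP[/IH1|/IH2] [[g gs ->]|[x xg hx]].
- by left; exists g; rewrite // inE mem_cat gs orbT.
- by right; exists x; rewrite ?xg.
- by left; exists g; rewrite // inE mem_cat gs !orbT.
- by right; exists x; rewrite ?xg ?orbT.
Qed.

Lemma eq_subst tau tau' f : (forall x, occurs x f -> tau x = tau' x) ->
  subst tau f = subst tau' f.
Proof.
elim: f => [x|c|b g IHg h IHh] //= e; first by rewrite e.
by rewrite IHg ?IHh // => x xf; apply: e; rewrite xf ?orbT.
Qed.

Lemma subst_id f : subst Var f = f.
Proof. by elim: f => //= b g -> h ->. Qed.

Lemma subst_comp tau tau' f :
  subst tau (subst tau' f) = subst (fun x => subst tau (tau' x)) f.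
Proof. by elim: f => //= b g -> h ->. Qed.

Lemma eval_subst d tau f : eval d (subst tau f) = eval (fun x => eval d (tau x)) f.
Proof. by elim: f => //= -[] g -> h ->. Qed.

Lemma leaf_forces_subst top d tau f : leaf_forces top d (subst tau f) =
  leaf_forces (omap (fun e x => eval e (tau x)) top) (fun x => leaf_forces top d (tau x)) f.
Proof. by case: top => [e|]; elim: f => //= -[] g -> h -> //; rewrite !eval_subst. Qed.

Lemma eq_leaf_forces top d d' f : (forall x, occurs x f -> d x = d' x) ->
  leaf_forces top d f = leaf_forces top d' f.
Proof.
elim: f => [x|c|b g IHg h IHh] //= e; first by rewrite e.
by case: b; rewrite IHg ?IHh // => x xf; apply: e; rewrite xf ?orbT.
Qed.

Lemma leaf_forces_eval e d f : subpred d e -> leaf_forces (Some e) d f -> eval e f.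
Proof.
move=> de; elim: f => [x|[]|[] g IHg h IHh] //=; first exact: de.
- by case/andP=> /IHg -> /IHh.
- by case/orP=> [/IHg|/IHh] ->; rewrite ?orbT.
- by case/andP.
Qed.

End Subformulas.

(** * Removing extension axioms by substitution *)

Section ExtensionElimination.
Local Open Scope form_L_scope.
Implicit Types (f g h u : lform) (s ds : seq lform) (tau : nat -> lform).

Lemma line_by_line_rcons stp ds f :
  line_by_line stp (rcons ds f) <-> line_by_line stp ds /\ stp ds f.
Proof.
rewrite /line_by_line size_rcons; split=> [H|[H Hf] i].
  split=> [i ids|]; last first.
    by have := H (size ds) (leqnn _); rewrite nth_rcons ltnn eqxx -cats1 take_size_cat.
  have := H i (ltnW _); rewrite ltnS => /(_ ids).
  by rewrite nth_rcons ids -cats1 takel_cat // ltnW.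
rewrite ltnS leq_eqVlt => /predU1P[->|ids].
  by rewrite nth_rcons ltnn eqxx -cats1 take_size_cat.
by rewrite nth_rcons ids -cats1 takel_cat ?(ltnW ids) //; exact: H.
Qed.

Definition equivalence_rule : frege_rule :=
  ([::], (Var 0 → Var 0) ∧ (Var 0 → Var 0)).

Definition lines_subformulas ds := flatten [seq subformulas f | f <- ds].

Lemma mem_lines_subformulas ds f :
  reflect (exists2 g, g \in ds & f \in subformulas g) (f \in lines_subformulas ds).
Proof. exact: flatten_mapP. Qed.

(* Substituting the defining formula of each extension variable turns an extension
   axiom into [(f → f) ∧ (f → f)]; the proof gets longer, but no new subformula
   appears up to the substitution. *)
Lemma eliminate_extensions rules goal ds :
    line_by_line (fun prev g => frege_step rules set0 prev g \/
                                extension_step set0 goal prev g) ds ->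
  exists tau, [/\ forall x, occurs x goal -> tau x = Var x,
    line_by_line (frege_step (equivalence_rule :: rules) set0) [seq subst tau f | f <- ds]
    & forall x, tau x = Var x \/ {subset subformulas (tau x) <=
        [seq subst tau f | f <- lines_subformulas ds]}].
Proof.
elim/last_ind: ds => [_|ds d IH].
  by exists Var; split=> // x; left.
rewrite line_by_line_rcons => -[/IH[tau [tau_goal tau_ds tau_sub]] [stp|ext]].
  exists tau; split=> // [|x].
    rewrite map_rcons line_by_line_rcons; split=> //; right.
    case: stp => [[]|[r [s [rr prem ->]]]].
    exists r, (fun x => subst tau (s x)); split.
    - by rewrite inE rr orbT.
    - move=> _ /mapP[g gr ->]; rewrite -subst_comp map_f // prem //.
      exact: map_f.
    - by rewrite subst_comp.
  case: (tau_sub x) => [->|sub]; [by left|right] => h /sub /mapP[g gs ->].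
  by rewrite map_f // /lines_subformulas map_rcons flatten_rcons mem_cat gs.
case: ext => x [g [dE [xg xds _ xgoal]]].
(* [g] may contain earlier extension variables, which [tau] has already resolved. As [x] is fresh
   for the earlier lines, the goal and [g], [tau'] agrees with [tau] on all of them. *)
pose tau' y := if y == x then subst tau g else tau y.
have tau'E f : ~~ occurs x f -> subst tau' f = subst tau f.
  by move=> xf; apply: eq_subst => y yf; rewrite /tau'; case: eqP xf => // <-; rewrite yf.
have mem_ds f : f \in lines_subformulas (rcons ds d) =
    (f \in lines_subformulas ds) || (f \in subformulas d).
  by rewrite /lines_subformulas map_rcons flatten_rcons mem_cat.
have gd : g \in subformulas d.
  by rewrite dE !inE !mem_cat /= !inE !mem_cat subformulas_refl !orbT.
have sub_ds f : f \in lines_subformulas ds -> ~~ occurs x f.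
  case/mem_lines_subformulas=> f' /xds + ff'; apply: contraNN; exact: subformulas_occurs.
exists tau'; split.
- by move=> y yg; rewrite /tau'; case: eqP xgoal => [<-|_ _]; [rewrite yg|exact: tau_goal].
- rewrite map_rcons (@eq_in_map _ _ _ (subst tau) _).1; last by move=> f /xds /tau'E.
  rewrite line_by_line_rcons; split=> //; right; exists equivalence_rule, (fun=> subst tau g).
  by split; rewrite ?mem_head // dE /= tau'E // /tau' eqxx.
move=> y; rewrite {1 2}/tau'; case: eqP => [->|/eqP yx].
  right=> h /subformulas_subst[[u ug ->]|[z zg hz]].
    rewrite -tau'E; first by rewrite map_f // mem_ds (subformulas_trans ug gd) orbT.
    by apply: contraNN xg; exact: subformulas_occurs.
  case: (tau_sub z) hz => [tz|sub /sub/mapP[u us ->]].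
    rewrite tz inE => /eqP ->; have -> : Var z = subst tau' (Var z).
      by rewrite tau'E /= ?tz //; apply: contraNneq xg => ->.
    rewrite map_f // mem_ds (subformulas_trans _ gd) ?orbT //.
    by rewrite -occurs_subformulas.
  by rewrite -tau'E ?map_f ?mem_ds ?us // sub_ds.
case: (tau_sub y) => [->|sub]; [by left|right] => h /sub/mapP[u us ->].
by rewrite -tau'E ?map_f ?mem_ds ?us // sub_ds.
Qed.

End ExtensionElimination.

(** * Horn clauses attached to a rule instance *)

Section RuleClauses.
Local Open Scope form_L_scope.
Implicit Types (f g h u : lform) (s us U : seq lform) (sg : nat -> lform).
Implicit Types (r : frege_rule) (top : option (pred nat)).

Definition rule_subformulas r := lines_subformulas (r.2 :: r.1).

Definition entails top U u := forall d, (if top is Some e then subpred d e else True) ->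
  all (leaf_forces top d) U -> leaf_forces top d u.

(** The top point as seen by the metavariables of a rule under [sg]. *)
Definition rule_top top sg := omap (fun e x => eval e (sg x)) top.

(** Entailment is tested on the scheme and only then instantiated, so the number of clauses is
    bounded in terms of the rule, however long the formulas [sg x] are. *)
Definition rule_clauses top r sg : seq (seq lform * lform) :=
  let us := rule_subformulas r in
  [seq ([seq subst sg u | u <- v.1], subst sg v.2)
  | v <- [seq v <- [seq (mask m us, u)
                     | m <- [seq tval m | m : (size us).-tuple bool], u <- us]
         | `[< entails (rule_top top sg) v.1 v.2 >]]].

(** The introduction rules that [slash_mem] needs to pass from slashed formulas to members of
    [T]. *)
Definition formula_clauses f : seq (seq lform * lform) :=
  match f with
  | Con CTop => [:: ([::], f)]
  | Bin BAnd g h => [:: ([:: g; h], f)]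
  | Bin BOr g h => [:: ([:: g], f); ([:: h], f)]
  | _ => [::]
  end.

Lemma size_rule_clauses top r sg : let k := size (rule_subformulas r) in
  size (rule_clauses top r sg) <= 2 ^ k * k.
Proof.
rewrite /rule_clauses size_map size_filter; apply: leq_trans (count_size _ _) _.
by rewrite size_allpairs size_map -cardE card_tuple card_bool.
Qed.

Lemma rule_clauses_body top r sg :
  all (fun cl : seq lform * lform => size cl.1 <= size (rule_subformulas r))
      (rule_clauses top r sg).
Proof.
apply/allP => _ /mapP[v + ->]; rewrite mem_filter => /andP[_].
case/allpairsP=> -[m' u] [/mapP[m _ ->] _ ->] /=.
by rewrite size_map size_mask ?size_tuple // -[leqRHS](size_tuple m) count_size.
Qed.

Lemma mem_rule_clauses top r sg (P : pred lform) u : u \in rule_subformulas r ->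
    entails (rule_top top sg) [seq v <- rule_subformulas r | P v] u ->
  ([seq subst sg v | v <- rule_subformulas r & P v], subst sg u) \in rule_clauses top r sg.
Proof.
move=> ur ent; apply/mapP; exists ([seq v <- rule_subformulas r | P v], u) => //.
rewrite mem_filter /=; apply/andP; split; first exact/asboolP.
apply/allpairsP; exists ([seq P v | v <- rule_subformulas r], u).
split=> //=; last by rewrite filter_mask.
by apply/mapP; exists (map_tuple P (in_tuple (rule_subformulas r))); rewrite ?mem_enum.
Qed.

Definition leaf_sound top (cl : seq lform * lform) := forall d,
  (if top is Some e then subpred d e else True) ->
  all (leaf_forces top d) cl.1 -> leaf_forces top d cl.2.

Lemma formula_clauses_sound top f cl : cl \in formula_clauses f -> leaf_sound top cl.
Proof.
case: f => [x|[]|[] g h] //=; rewrite ?inE.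
- by move/eqP -> => d.
- by move/eqP -> => d _ /= /and3P[-> ->].
- by case/orP=> /eqP -> d _ /=; rewrite andbT => ->; rewrite ?orbT.
Qed.

(** A point that evaluates the instance, read through [sg], evaluates the scheme; persistence keeps
    it below [rule_top]. *)
Lemma rule_clauses_sound top r sg cl : cl \in rule_clauses top r sg -> leaf_sound top cl.
Proof.
case/mapP=> v; rewrite mem_filter => /andP[/asboolP ent _] -> d de /=.
rewrite leaf_forces_subst all_map => Ud; apply: ent.
  by case: top de Ud => //= e de _ x; exact: leaf_forces_eval.
by apply: sub_all Ud => u; rewrite /= leaf_forces_subst.
Qed.

Lemma horn_sound top cls (H : pred lform) d f : (forall cl, cl \in cls -> leaf_sound top cl) ->
    (if top is Some e then subpred d e else True) ->
    (forall g, H g -> leaf_forces top d g) ->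
  horn cls H f -> leaf_forces top d f.
Proof.
move=> snd de Hd; elim=> [g /Hd//|cl clin _ IH].
by apply: snd => //; apply/allP => g; exact: IH.
Qed.

End RuleClauses.

(** * The slash and its preservation by rules *)

Section Slash.
Local Open Scope form_L_scope.
Implicit Types (f g h u : lform) (r : frege_rule) (sg : nat -> lform).
Variables (T : pred lform) (F : seq lform).

(* Aczel's variant of the Kleene slash, relative to the set [T]. *)
Fixpoint slash f : bool :=
  match f with
  | Var x => T f
  | Con CTop => true
  | Con CBot => false
  | Bin BAnd g h => slash g && slash h
  | Bin BOr g h => slash g || slash h
  | Bin BImp g h => T f && (slash g ==> slash h)
  end.

Hypothesis F_closed : forall f g, f \in subformulas g -> g \in F -> f \in F.
Hypothesis T_closed : forall f cl, f \in F -> cl \in formula_clauses f -> all T cl.1 -> T cl.2.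

Lemma slash_mem f : f \in F -> slash f -> T f.
Proof.
elim: f => [x|[]|[] g IHg h IHh] //= fF.
- by move=> _; apply: (T_closed fF (mem_head _ _)).
- move=> /andP[sg sh]; apply: (T_closed fF (mem_head _ _)) => /=.
  by rewrite IHg ?IHh //; apply: F_closed fF; apply: subformulas_bin; rewrite !inE eqxx ?orbT.
- case/orP=> [sg|sh].
    apply: (T_closed (cl := ([:: g], g ∨ h)) fF (mem_head _ _)) => /=.
    by rewrite IHg //; apply: F_closed fF; apply: subformulas_bin; rewrite !inE eqxx.
  apply: (T_closed (cl := ([:: h], g ∨ h)) fF) => /=; first by rewrite !inE eqxx orbT.
  by rewrite IHh //; apply: F_closed fF; apply: subformulas_bin; rewrite !inE eqxx orbT.
- by case/andP.
Qed.

Lemma root_forces_curry top (I : finType) (ds : I -> pred nat) rt fs f :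
  root_forces top ds rt (foldr (Bin BImp) f fs) ->
  all (root_forces top ds rt) fs -> root_forces top ds rt f.
Proof.
by elim: fs => //= g fs IH /andP[_ /implyP H] /andP[/H]; exact: IH.
Qed.

Variables (D : set lform -> lform -> Prop) (dia : bool) (e : pred nat) (B : nat).
Hypothesis D_sound : sound_on D dia (2 ^ B).
Let top := if dia then Some e else None.
Hypothesis T_e : forall f, T f -> leaf_forces top e f.

(** The frame is built for the instance: its middle points are all truth assignments to the
    metavariables that satisfy every subformula whose instance is in [T], and its root makes true
    the metavariables with slashed instance. An implication true at all middle points is entailed by
    subformulas with instances in [T], so its own instance is in [T] by [rule_clauses]. Hence
    forcing at the root coincides with the slash, and validity of the curried rule in this frame
    gives the claim. *)
Lemma slash_rule r sg : logic_of D (foldr (Bin BImp) r.2 r.1) ->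
    (forall u x, u \in rule_subformulas r -> occurs x u -> x < B) ->
    (forall u, u \in rule_subformulas r -> subst sg u \in F) ->
    (forall cl, cl \in rule_clauses top r sg -> all T cl.1 -> T cl.2) ->
  all slash [seq subst sg g | g <- r.1] -> slash (subst sg r.2).
Proof.
move=> Dr rB rF Tr; pose us := rule_subformulas r; pose top0 := rule_top top sg.
have usS u v : u \in us -> v \in subformulas u -> v \in us.
  case/mem_lines_subformulas=> w ws uw vu; apply/mem_lines_subformulas; exists w => //.
  exact: subformulas_trans uw.
pose below d := if top0 is Some e0 then subpred d e0 else True.
pose good d := below d /\ forall u, u \in us -> T (subst sg u) -> leaf_forces top0 d u.
(* Valuations are cut down to [B] booleans, which leaves at most [2 ^ B] middle points, the number
   allowed by [D_sound]. *)
pose trunc (d : pred nat) := [tuple d i | i < B].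
pose val_of (t : B.-tuple bool) : pred nat := nth false t.
have trunc_nth d x : x < B -> val_of (trunc d) x = d x.
  by move=> xB; rewrite /val_of -[x]/(val (Ordinal xB)) -tnth_nth tnth_mktuple.
have trunc_leaf d u : u \in us -> leaf_forces top0 (val_of (trunc d)) u = leaf_forces top0 d u.
  by move=> us_u; apply: eq_leaf_forces => x xu; apply: trunc_nth; exact: rB xu.
have trunc_good d : good d -> good (val_of (trunc d)).
  move=> [bd gd]; split=> [|u us_u Tu]; last by rewrite trunc_leaf // gd.
  move: bd; rewrite /below; case: (top0) => // e0 de0 x.
  have [xB|xB] := ltnP x B; first by rewrite trunc_nth //; exact: de0.
  by rewrite /val_of nth_default // size_tuple.
pose P t := `[< good (val_of t) >]; pose I : finType := {t : B.-tuple bool | P t}.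
pose ds (i : I) := val_of (val i).
pose rt : pred nat := fun x => (Var x \in us) && slash (sg x).
(* [T_e] supplies a middle point: the truth values of the formulas [sg x] at the leaf [e]. *)
have I0 : 0 < #|I|.
  pose d0 x := leaf_forces top e (sg x); have gd0 : P (trunc d0).
    apply/asboolP; apply: trunc_good; split=> [|u us_u /T_e]; last by rewrite leaf_forces_subst.
    by rewrite /below /top0 /d0 /top; case: (dia) => //= x; exact: leaf_forces_eval.
  by apply/card_gt0P; exists (exist (fun t => is_true (P t)) _ gd0).
have IB : #|I| <= 2 ^ B.
  by rewrite card_sig; apply: leq_trans (max_card _) _; rewrite card_tuple card_bool.
have dsP i : good (ds i) by exact/asboolP/(valP i).
have rt_ds i : subpred rt (ds i).
  move=> x /andP[xu sx]; have [_ /(_ _ xu)] := dsP i; apply.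
  by apply: slash_mem => //; exact: (rF (Var x)).
have ds_e0 : dia -> forall i, subpred (ds i) (fun x => eval e (sg x)).
  by move=> dd i; have [+ _] := dsP i; rewrite /below /top0 /top dd.
have top0E : top0 = if dia then Some (fun x => eval e (sg x)) else None.
  by rewrite /top0 /top; case: (dia).
have imp_leaf u : u \in us -> [forall i, leaf_forces top0 (ds i) u] = T (subst sg u).
  move=> us_u; apply/forallP/idP => [li|Tu i]; last by have [_] := dsP i; apply.
  pose U := [seq v <- us | T (subst sg v)].
  have : entails top0 U u.
    move=> d bd /allP Ud; have gd : P (trunc d).
      apply/asboolP/trunc_good; split=> // v vu Tv; apply: Ud.
      by rewrite mem_filter Tv.
    by have := li (exist (fun t => is_true (P t)) _ gd); rewrite /ds /= trunc_leaf.
  move/(mem_rule_clauses us_u)/Tr; apply; rewrite all_map.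
  by apply/allP => v; rewrite mem_filter => /andP[].
have main u : u \in us -> root_forces top0 ds rt u = slash (subst sg u).
  elim: u => [x|[]|b g IHg h IHh] // us_u; first by rewrite /= /rt us_u.
  have ug : g \in us by apply: usS us_u _; apply: subformulas_bin; rewrite mem_head.
  have uh : h \in us by apply: usS us_u _; apply: subformulas_bin; rewrite !inE eqxx orbT.
  case: b us_u => us_u /=; rewrite IHg ?IHh //.
  by congr andb; exact: (imp_leaf (g → h)).
have inus f : f \in r.2 :: r.1 -> f \in us.
  by move=> fr; apply/mem_lines_subformulas; exists f; rewrite ?subformulas_refl.
rewrite -main ?inus ?mem_head // all_map => prem.
apply: (@root_forces_curry _ _ _ _ r.1).
  by rewrite top0E; apply: D_sound => //; rewrite I0.
apply/allP => f fr; rewrite main; first exact: (allP prem).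
by apply: inus; rewrite inE fr orbT.
Qed.

End Slash.

(** * Clauses for a whole extended Frege proof *)

Section Interpolation.
Local Open Scope form_L_scope.
Implicit Types (f g h u : lform) (r : frege_rule) (ds : seq lform).
Variables (D : set lform -> lform -> Prop) (rules : seq frege_rule).
Hypotheses (HD : super_intuitionistic D) (Hbranch : infinite_branching (logic_of D))
  (Hfrege : frege_system D rules).

Let rules' := equivalence_rule :: rules.

Lemma deriv_curry X (s : seq lform) f :
  D (X `|` [set` s]) f -> D X (foldr (Bin BImp) f s).
Proof.
elim: s X => [|g s IH] X /= Df.
  by apply: (deriv_mono HD _ Df) => h [].
apply/(deriv_imp HD)/IH; apply: (deriv_mono HD _ Df) => h [Xh|]; first by left; left.
by case/predU1P=> [->|hs]; [left; right|right].
Qed.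

Lemma rule_theorem r : r \in rules' -> logic_of D (foldr (Bin BImp) r.2 r.1).
Proof.
case/predU1P=> [->|rr].
  rewrite /= /logic_of /=; apply/(deriv_and HD); split; apply/(deriv_imp HD);
  by apply: (deriv_refl HD); right.
have [_ _ /(_ r rr) Dr] := Hfrege; apply: deriv_curry.
by apply: (deriv_mono HD _ Dr) => h; right.
Qed.

Lemma occurs_bound (s : seq lform) : exists B, forall u x, u \in s -> occurs x u -> x < B.
Proof.
elim: s => [|f s [B HB]]; first by exists 0.
have [C HC] : exists C, forall x, occurs x f -> x < C.
  elim: f => [y|c|b g [C HC] h [C' HC']].
  - by exists y.+1 => x /= /eqP ->.
  - by exists 0.
  - exists (C + C') => x /= /orP[/HC|/HC'] lt; apply: leq_trans lt _;
    by rewrite ?leq_addr ?leq_addl.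
exists (B + C) => u x /predU1P[->|us] xu.
  by apply: leq_trans (HC _ xu) _; rewrite leq_addl.
by apply: leq_trans (HB _ _ us xu) _; rewrite leq_addr.
Qed.

Lemma size_enc_proof ds :
  size ds + size (lines_subformulas ds) <= size (enc_proof ds).
Proof.
elim: ds => //= f ds IH; rewrite /enc_proof /lines_subformulas /= !size_cat.
rewrite size_rcons size_map -/(enc_proof ds) -/(lines_subformulas ds).
by have := size_subformulas f; lia.
Qed.

(** The order of quantifiers is the point: the clauses come from the proof alone and serve every
    [H]. Both the leaf and the top point used for consistency make all variables true, so any set of
    variables is admissible as [H]. *)
Lemma ef_interpolation : exists (dia : bool) (w K : nat),
  let top := if dia then Some xpredT else None in
  forall ds f, EF_proof rules set0 ds f -> exists cls : seq (seq lform * lform),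
  [/\ size cls <= K * size (enc_proof ds),
      all (fun cl : seq lform * lform => size cl.1 <= w) cls,
      forall cl, cl \in cls -> leaf_sound top cl
    & forall H : pred lform, (forall g, H g -> leaf_forces top xpredT g) ->
      exists T : pred lform, [/\ forall g, T g <-> horn cls H g, slash T f
        & forall g, g \in subformulas f -> slash T g -> T g]].
Proof.
have [B HB] := occurs_bound (flatten [seq rule_subformulas r | r <- rules']).
have {}HB r u x : r \in rules' -> u \in rule_subformulas r -> occurs x u -> x < B.
  by move=> rr ur; apply: HB; apply/flatten_mapP; exists r.
have [dia snd] := fork_or_diamond HD (2 ^ B) Hbranch.
pose c := \max_(r <- rules') size (rule_subformulas r).
have cP r : r \in rules' -> size (rule_subformulas r) <= c by move=> rr; exact: leq_bigmax_seq.
(* Each line gives at most [2 ^ c * c] rule clauses with bodies of size at most [c]; each subformula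
   of a line gives at most two more, with bodies of size at most two. *)
exists dia, (c + 2), (2 ^ c * c + 2) => top ds f [[ds' dsE] /eliminate_extensions].
case=> tau [tau_f tau_ds tau_sub]; set es := [seq subst tau g | g <- ds] in tau_ds.
pose F := [seq subst tau g | g <- lines_subformulas ds].
have F_closed g h : g \in subformulas h -> h \in F -> g \in F.
  move=> gh /mapP[u /mem_lines_subformulas[v vds uv] hE]; move: gh; rewrite hE.
  have sub u' : u' \in subformulas u -> subst tau u' \in F.
    move=> u'u; apply: map_f; apply/mem_lines_subformulas; exists v => //.
    exact: subformulas_trans uv.
  case/subformulas_subst=> [[u' u'u ->]|[x xu]]; first exact: sub.
  case: (tau_sub x) => [tx|sx /sx//]; rewrite tx inE => /eqP ->; rewrite -tx.
  by apply: (sub (Var x)); rewrite -occurs_subformulas.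
have es_F g : g \in es -> g \in F.
  move=> /mapP[h hds ->]; apply: map_f; apply/mem_lines_subformulas.
  by exists h => //; exact: subformulas_refl.
pose instance i (p : frege_rule * (nat -> lform)) := i < size es ->
    [/\ p.1 \in rules', {subset [seq subst p.2 g | g <- p.1.1] <= take i es}
      & nth Bot es i = subst p.2 p.1.2].
have [ins insP] : {ins & forall i, instance i (ins i)}.
  apply: choice => i; rewrite /instance.
  case: (ltnP i (size es)) => [ies|_]; last by exists (equivalence_rule, Var).
  by case: (tau_ds i ies) => [[]|[r [sg rP]]]; exists (r, sg).
pose cls := flatten [seq formula_clauses g | g <- F] ++
  flatten [seq rule_clauses top (ins i).1 (ins i).2 | i <- iota 0 (size es)].
have clsP cl : cl \in cls -> (exists2 g, g \in F & cl \in formula_clauses g) \/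
    exists2 i, i < size es & cl \in rule_clauses top (ins i).1 (ins i).2.
  rewrite mem_cat => /orP[/flatten_mapP[g gF cg]|/flatten_mapP[i]]; first by left; exists g.
  by rewrite mem_iota => /= ies ci; right; exists i.
have cls_sound cl : cl \in cls -> leaf_sound top cl.
  move=> /clsP[[g _]|[i _]]; first exact: formula_clauses_sound.
  exact: rule_clauses_sound.
exists cls; split.
- have size_flatten_le (I : eqType) (G : I -> seq (seq lform * lform)) m (s : seq I) :
      (forall i, i \in s -> size (G i) <= m) -> size (flatten [seq G i | i <- s]) <= m * size s.
    elim: s => [|i s IH] Gm //=; rewrite size_cat mulnS leq_add ?Gm ?mem_head //.
    by apply: IH => j js; apply: Gm; rewrite inE js orbT.
  have le1 : size (flatten [seq formula_clauses g | g <- F]) <= 2 * size F.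
    by apply: size_flatten_le; case=> [x|[]|[] g h].
  have le2 : size (flatten [seq rule_clauses top (ins i).1 (ins i).2
                           | i <- iota 0 (size es)]) <= 2 ^ c * c * size es.
    rewrite -[X in _ * X](size_iota 0); apply: size_flatten_le => i; rewrite mem_iota => /= /insP[rr _ _].
    apply: leq_trans (size_rule_clauses _ _ _) _.
    by rewrite leq_mul ?cP // leq_exp2l ?cP.
  rewrite size_cat; apply: leq_trans (leq_add le1 le2) _; rewrite !size_map.
  apply: leq_trans (_ : (2 ^ c * c + 2) * (size ds + size (lines_subformulas ds)) <= _).
    by rewrite mulnDl addnC leq_add // leq_mul2l ?leq_addr ?leq_addl ?orbT.
  by rewrite leq_mul2l size_enc_proof orbT.
- apply/allP => cl /clsP[[g _]|[i ies cli]].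
    case: g => [x|[]|[] g h] //=; rewrite !inE; do ?[case/orP]; move/eqP -> => //=;
    by rewrite addnC.
  have [rr _ _] := insP i ies; have := allP (rule_clauses_body _ _ _) cl cli => /= le1.
  by apply: leq_trans le1 _; apply: leq_trans (cP _ rr) _; rewrite leq_addr.
- exact: cls_sound.
move=> H He; pose T : pred lform := fun g => `[< horn cls H g >].
have TP g : T g <-> horn cls H g by split=> /asboolP.
have T_fire cl : cl \in cls -> all T cl.1 -> T cl.2.
  by move=> clin /allP Tb; apply/TP; apply: HornClause => // g /Tb/TP.
have T_closed g cl : g \in F -> cl \in formula_clauses g -> all T cl.1 -> T cl.2.
  move=> gF cg; apply: T_fire; rewrite mem_cat; apply/orP; left.
  by apply/flatten_mapP; exists g.
have T_e g : T g -> leaf_forces top xpredT g.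
  by move/TP; apply: (horn_sound cls_sound) => //; rewrite /top; case: (dia).
have lines i : i < size es -> slash T (nth Bot es i).
  have [n] := ubnP i; elim: n i => // n IH i lein ies.
  have [rr prem ->] := insP i ies.
  have premF g : g \in (ins i).1.1 -> subst (ins i).2 g \in F.
    by move=> gr; apply: es_F; apply: mem_take (prem _ _); exact: map_f.
  apply: (slash_rule F_closed T_closed snd T_e) => //.
  - exact: rule_theorem.
  - by move=> u x; exact: HB.
  - move=> u /mem_lines_subformulas[g + ug] => /predU1P[ge|/premF gF].
      apply: (F_closed _ (nth Bot es i)); last by apply: es_F; exact: mem_nth.
      by have [_ _ ->] := insP i ies; rewrite -ge; exact: mem_subformulas_subst.
    by apply: F_closed gF; exact: mem_subformulas_subst.
  - move=> cl cli; apply: T_fire; rewrite mem_cat; apply/orP; right.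
    by apply/flatten_mapP; exists i; rewrite // mem_iota.
  - apply/allP => g /prem gt; have [j jt <-] := nthP Bot gt.
    move: jt; rewrite size_take ies => ji; rewrite nth_take //.
    by apply: IH; [exact: leq_trans ji _|exact: ltn_trans ies].
have fE : subst tau f = f by rewrite -[RHS]subst_id; apply: eq_subst.
have esE : es = rcons [seq subst tau g | g <- ds'] f by rewrite /es dsE map_rcons fE.
exists T; split=> //.
  have := lines (size ds'); rewrite esE size_rcons nth_rcons size_map ltnn eqxx; exact.
move=> g gf; apply: (slash_mem F_closed T_closed); apply: F_closed gf _; apply: es_F.
by rewrite esE mem_rcons mem_head.
Qed.

End Interpolation.

(** * The formulas [Theta n] *)

Section ThetaSemantics.
Variables (top : option (pred nat)) (d : pred nat).
Implicit Types (s : seq sform).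

Lemma leaf_bigfus s : leaf_forces top d (transl (bigfus s)) =
  all (fun f => leaf_forces top d (transl f)) s.
Proof.
elim: s => [|f [|g s] IH] //=; first by rewrite andbT.
by congr andb.
Qed.

Lemma leaf_bigmeet s : leaf_forces top d (transl (bigmeet s)) =
  all (fun f => leaf_forces top d (transl f)) s.
Proof.
elim: s => [|f [|g s] IH] //=; first by rewrite andbT.
by congr andb.
Qed.

Lemma leaf_bigjoin s : leaf_forces top d (transl (bigjoin s)) =
  has (fun f => leaf_forces top d (transl f)) s.
Proof.
elim: s => [|f [|g s] IH] //=; first by rewrite orbF.
by congr orb.
Qed.

Lemma leaf_alpha k n : reflect
  ((exists2 i, i < n & forall l, l < k -> d (dvar 3 i l)) \/
   exists i j l, [/\ i < n, j < n, l < k &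
                     [&& d (dvar 2 i l), d (dvar 2 j l) & d (dvar 0 i j)]])
  (leaf_forces top d (transl (alpha k n))).
Proof.
rewrite /= !leaf_bigjoin has_map; apply: (iffP orP).
  case=> [/hasP[i]|/hasP[_ /allpairsP[[i j] [/= + + ->]]]]; rewrite !mem_iota /=.
    move=> iN; rewrite leaf_bigmeet all_map => /allP al; left; exists i => // l lk.
    by apply: al; rewrite mem_iota.
  move=> iN jN; rewrite leaf_bigjoin has_map => /hasP[l]; rewrite mem_iota /= => lk.
  by move=> dl; right; exists i, j, l; split=> //; rewrite andbA.
case=> [[i iN al]|[i [j [l [iN jN lk dl]]]]].
  left; apply/hasP; exists i; rewrite ?mem_iota //= leaf_bigmeet all_map.
  by apply/allP => l; rewrite mem_iota => /al.
right; apply/hasP; eexists.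
  by apply/allpairsP; exists (i, j); rewrite !mem_iota; split.
rewrite /= leaf_bigjoin has_map; apply/hasP; exists l; rewrite ?mem_iota //=.
by rewrite -andbA.
Qed.

Lemma leaf_beta m n : reflect
  ((exists2 l, l < m & forall i, i < n -> d (dvar 5 i l)) \/
   exists i j l l', [/\ i < n, j < n, l < l' < m &
                        [&& d (dvar 4 i l), d (dvar 4 j l') & d (dvar 1 i j)]])
  (leaf_forces top d (transl (beta m n))).
Proof.
rewrite /= !leaf_bigjoin has_map; apply: (iffP orP).
  case=> [/hasP[l]|/hasP[_ /allpairsP[[i j] [/= + + ->]]]]; rewrite !mem_iota /=.
    move=> lm; rewrite leaf_bigmeet all_map => /allP al; left; exists l => // i iN.
    by apply: al; rewrite mem_iota.
  move=> iN jN; rewrite leaf_bigjoin has_map => /hasP[[l l']]; rewrite mem_filter /=.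
  case/andP=> ll' /allpairsP[[a b] [/=]]; rewrite !mem_iota /= => _ bm [_ el'] dl.
  right; exists i, j, l, l'; split=> //; last by rewrite andbA.
  by rewrite ll' el'.
case=> [[l lm al]|[i [j [l [l' [iN jN /andP[ll' lm] dl]]]]]].
  left; apply/hasP; exists l; rewrite ?mem_iota //= leaf_bigmeet all_map.
  by apply/allP => i; rewrite mem_iota => /al.
right; apply/hasP; eexists.
  by apply/allpairsP; exists (i, j); rewrite !mem_iota; split.
rewrite /= leaf_bigjoin has_map; apply/hasP; exists (l, l'); rewrite /= -?andbA //.
rewrite mem_filter /= ll'; apply/allpairsP; exists (l, l').
by rewrite !mem_iota /= lm (ltn_trans ll').
Qed.

End ThetaSemantics.

Lemma slash_bigfus (T : pred lform) s :
  all (fun f => slash T (transl f)) s -> slash T (transl (bigfus s)).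
Proof. by elim: s => [|f [|g s] IH] //= /andP[-> //]. Qed.

Lemma slash_imp_or (T : pred lform) f g h :
  slash T (f → (g ∨ h))%L -> slash T f -> slash T g \/ slash T h.
Proof. by move=> /andP[_ /implyP H] /H /orP. Qed.

Section Valuation.
Variable F : nat -> nat -> nat -> bool.

Definition valuation : pred nat :=
  fun x => `[< exists tag i j, [/\ tag < 6, x = dvar tag i j & F tag i j] >].

Lemma valuationE tag i j : tag < 6 -> valuation (dvar tag i j) = F tag i j.
Proof.
move=> tag6; apply/asboolP/idP => [[a [k [l [a6 /dvar_inj]]]]|Ft]; last by exists tag, i, j.
by case=> // -> -> ->.
Qed.

End Valuation.

(** Strings that are not proofs are mapped to [Top], hence the exclusion of this formula. *)
Lemma EF_inv rules q f : f <> Top -> EF rules q = f ->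
  exists2 ds, q = enc_proof ds & EF_proof rules set0 ds f.
Proof.
rewrite /EF; case: pselect => [w|_ nTop /esym//]; case: cid => g /= [ds [-> pf]] _ <-.
by exists ds.
Qed.

(** * Refuting the disjuncts by colourings and cliques *)

Section ThetaBound.
Local Open Scope form_L_scope.
Variables n k : nat.
Implicit Types (G : rel 'I_n) (top : option (pred nat)) (F : nat -> nat -> nat -> bool).

Let pq := [seq ((p_ i j ∧ One) ∨ (q_ i j ∧ One))%S | i <- iota 0 n, j <- iota 0 n].
Let ss := [seq ((s_ i l ∧ One) ∨ (s'_ i l ∧ One))%S | i <- iota 0 n, l <- iota 0 k].
Let rr := [seq ((r_ i l ∧ One) ∨ (r'_ i l ∧ One))%S | i <- iota 0 n, l <- iota 0 k.+1].

Definition theta_left : lform := transl (bigfus ss) → transl (alpha k n).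
Definition theta_right : lform := transl (bigfus rr) → transl (beta k.+1 n).

Lemma transl_Theta_nk :
  transl (Theta_nk n k) = (transl (bigfus pq) → (theta_left ∨ theta_right)).
Proof. by []. Qed.

Lemma theta_sides f : f \in [:: theta_left; theta_right] ->
  f \in subformulas (transl (Theta_nk n k)).
Proof.
move=> fs; apply: (@subformulas_trans _ (theta_left ∨ theta_right)).
  exact: subformulas_bin.
by rewrite transl_Theta_nk; apply: subformulas_bin; rewrite !inE eqxx orbT.
Qed.

Definition edge_hyps (G G' : rel 'I_n) : pred lform := fun f =>
  [exists i : 'I_n, exists j : 'I_n, (f == Var (dvar 0 i j)) && G i j] ||
  [exists i : 'I_n, exists j : 'I_n, (f == Var (dvar 1 i j)) && G' i j].

Lemma edge_hypsP G G' f : reflect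
  (exists i j : 'I_n, (f = Var (dvar 0 i j) /\ G i j) \/ (f = Var (dvar 1 i j) /\ G' i j))
  (edge_hyps G G' f).
Proof.
apply: (iffP orP).
  case=> /existsP[i /existsP[j /andP[/eqP -> Gij]]]; exists i, j; first by left.
  by right.
case=> i [j [[-> Gij]|[-> Gij]]]; [left|right];
by apply/existsP; exists i; apply/existsP; exists j; rewrite eqxx.
Qed.

Lemma edge_hyps_input f : [\/ forall G, edge_hyps G (fun=> xpredT) f = false,
  forall G, edge_hyps G (fun=> xpredT) f = true
  | exists i j, forall G, edge_hyps G (fun=> xpredT) f = G i j].
Proof.
have [[i [j ->]]|nq] := pselect (exists i j : 'I_n, f = Var (dvar 1 i j)).
  by apply: Or32 => G; apply/edge_hypsP; exists i, j; right.
have [[i [j ->]]|np] := pselect (exists i j : 'I_n, f = Var (dvar 0 i j)); last first.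
  apply: Or31 => G; apply/negP => /edge_hypsP[i [j [[fE _]|[fE _]]]].
    by apply: np; exists i, j.
  by apply: nq; exists i, j.
apply: Or33; exists i, j => G; apply/edge_hypsP/idP => [[i' [j' [[]|[]]]]|Gij].
- by case=> /dvar_inj[] // _ /val_inj -> /val_inj ->.
- by case=> /dvar_inj[].
- by exists i, j; left.
Qed.

Lemma edge_hyps_mono G G' f : edge_hyps G G' f -> edge_hyps G (fun=> xpredT) f.
Proof.
move/edge_hypsP=> [i [j H]]; apply/edge_hypsP; exists i, j.
by case: H => [|[fE _]]; [left|right].
Qed.

Lemma edge_hyps_leaf top F G G' f : (forall i j : 'I_n, G i j -> F 0 i j) ->
    (forall i j : 'I_n, G' i j -> F 1 i j) ->
  edge_hyps G G' f -> leaf_forces top (valuation F) f.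
Proof.
move=> GF G'F /edge_hypsP[i [j [[-> /GF]|[-> /G'F]]]] /=; by rewrite valuationE.
Qed.

(** With [s] recording the colours and [s'] its negation all switches hold, whereas [alpha] asks for
    an uncoloured vertex or a monochromatic edge. *)
Lemma theta_left_coloring top G (c : 'I_n -> 'I_k) F :
    (forall i j, G i j -> c i != c j) ->
    (forall i j : 'I_n, F 0 i j = G i j) ->
    (forall (i : 'I_n) l, F 2 i l = (c i == l :> nat)) ->
    (forall (i : 'I_n) l, F 3 i l = (c i != l :> nat)) ->
  ~ leaf_forces top (valuation F) theta_left.
Proof.
move=> cG F0 F2 F3 /andP[_ /implyP]; rewrite -/leaf_forces leaf_bigfus => H.
have /leaf_alpha[[i iN al]|[i [j [l [iN jN lk]]]]] :
    leaf_forces top (valuation F) (transl (alpha k n)).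
  apply: H; apply/allP => _ /allpairsP[[i l] [/= + + ->]]; rewrite !mem_iota /= => iN lk.
  rewrite !andbT !valuationE // -[i]/(val (Ordinal iN)) F2 F3 orbN //.
  have := al _ (ltn_ord (c (Ordinal iN))).
  by rewrite valuationE // -[i]/(val (Ordinal iN)) F3 eqxx.
rewrite !valuationE // -[i]/(val (Ordinal iN)) -[j]/(val (Ordinal jN)) !F2 F0.
by case/and3P=> /eqP ci /eqP cj /cG; rewrite -val_eqE /= ci cj eqxx.
Qed.

(** With [r] recording the enumeration [v] of the clique all switches hold. As [q] marks non-edges,
    [beta] asks for an index without a vertex or a non-edge inside the clique. *)
Lemma theta_right_clique top G (v : 'I_k.+1 -> 'I_n) F : injective v ->
    (forall l m, l != m -> G (v l) (v m)) ->
    (forall i j : 'I_n, F 1 i j = ~~ G i j) ->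
    (forall i (l : 'I_k.+1), F 4 i l = (v l == i :> nat)) ->
    (forall i (l : 'I_k.+1), F 5 i l = (v l != i :> nat)) ->
  ~ leaf_forces top (valuation F) theta_right.
Proof.
move=> v_inj vG F1 F4 F5 /andP[_ /implyP]; rewrite -/leaf_forces leaf_bigfus => H.
have /leaf_beta[[l lk al]|[i [j [l [m [iN jN /andP[lm mk]]]]]]] :
    leaf_forces top (valuation F) (transl (beta k.+1 n)).
  apply: H; apply/allP => _ /allpairsP[[i l] [+ + ->]]; rewrite !mem_iota /= => iN lk.
  by rewrite !andbT !valuationE // -[l]/(val (Ordinal (lk : l < k.+1))) F4 F5 orbN.
  have := al _ (ltn_ord (v (Ordinal lk))).
  by rewrite valuationE // -[X in F 5 _ X]/(val (Ordinal lk)) F5 eqxx.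
have lk := ltn_trans lm mk; rewrite !valuationE //.
rewrite -[X in F 4 i X]/(val (Ordinal lk)) -[X in F 4 j X]/(val (Ordinal mk)) !F4.
rewrite -[i]/(val (Ordinal iN)) -[j]/(val (Ordinal jN)) F1 => /and3P[/eqP vi /eqP vj].
have -> : Ordinal iN = v (Ordinal lk) by apply: val_inj.
have -> : Ordinal jN = v (Ordinal mk) by apply: val_inj.
by rewrite vG // -val_eqE /= neq_ltn lm.
Qed.

End ThetaBound.

Theorem theta_ef_bound D rules : super_intuitionistic D ->
    infinite_branching (logic_of D) -> frege_system D rules ->
  exists C, forall n t q, 1 < t -> t ^ 16 <= n ->
    EF rules q = transl (Theta n) -> 2 ^ t <= C * (size q).+1 ^ 2.
Proof.
move=> HD Hb Hf; have [dia [w [K HK]]] := ef_interpolation HD Hb Hf.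
set top := if dia then Some xpredT else None in HK.
exists (K.+1 ^ 2 * w.+1) => n t q t1 tn /EF_inv[//|ds qE pf].
have [cls [cls_size cls_w cls_sound cls_slash]] := HK ds _ pf.
have [kn1 kn2] := PeanoNat.Nat.sqrt_spec n (PeanoNat.Nat.le_0_l n).
set k := Nat.sqrt n in kn1 kn2.
have {kn1} kn : k ^ 2 <= n by rewrite -mulnn; apply/leP.
have tk : t ^ 8 <= k.
  rewrite leqNgt; apply/negP => kt; have : k.+1 ^ 2 <= n.
    by apply: leq_trans tn; rewrite -[16]/(8 * 2) expnM leq_exp2r.
  by rewrite -mulnn leqNgt => /negP[]; exact/ltP.
have bound : 2 ^ t <= (size cls).+1 * (size cls * w.+1).
  apply: (@clique_colouring_bound _ n k t w cls (fun G => edge_hyps G (fun=> xpredT))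
            (theta_left n k)) => // [|G v v_inj vG|G c cG].
  - exact: edge_hyps_input.
  (* For the clique, [q] first encodes exactly the complement of [G]: every edge switch is then
     decided, the slash selects a disjunct, and the clique rules out the right one. Passing to all
     [q] afterwards only enlarges the closure. *)
  - pose G' : rel 'I_n := fun i j => ~~ G i j.
    have [g /edge_hypsP[i [j [[-> _]|[-> _]]]]|T [TH sT T_sub]] := cls_slash (edge_hyps G G').
    + by [].
    + by [].
    have T_edge g : edge_hyps G G' g -> T g by move=> eg; apply/TH; exact: HornHyp.
    have slash_pq : slash T (transl (bigfus
        [seq ((p_ i j ∧ One) ∨ (q_ i j ∧ One))%S | i <- iota 0 n, j <- iota 0 n])).
      apply/slash_bigfus/allP => _ /allpairsP[[i j] [+ + ->]].
      rewrite !mem_iota => iN jN; rewrite /= !andbT; apply/orP.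
      have [Gij|Gij] := boolP (G (Ordinal (iN : i < n)) (Ordinal (jN : j < n))).
        by left; apply/T_edge/edge_hypsP; exists (Ordinal iN), (Ordinal jN); left.
      by right; apply/T_edge/edge_hypsP; exists (Ordinal iN), (Ordinal jN); right.
    have [sl|sr] := slash_imp_or sT slash_pq.
      apply: (horn_mono (H := edge_hyps G G')); first exact: edge_hyps_mono.
      by apply/TH; apply: T_sub sl; apply: theta_sides; rewrite mem_head.
    have /TH hr : T (theta_right n k).
      by apply: T_sub sr; apply: theta_sides; rewrite !inE eqxx orbT.
    pose F (tag x y : nat) : bool := match tag with
      | 0 => true
      | 1 => [exists i : 'I_n, exists j : 'I_n, [&& i == x :> nat, j == y :> nat & G' i j]]
      | 4 => [exists l : 'I_k.+1, (v l == x :> nat) && (l == y :> nat)]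
      | 5 => ~~ [exists l : 'I_k.+1, (v l == x :> nat) && (l == y :> nat)]
      | _ => false end.
    have F1 (i j : 'I_n) : F 1 i j = G' i j.
      apply/existsP/idP => [[i' /existsP[j' /and3P[/eqP/val_inj <- /eqP/val_inj <-]]] //|Gij].
      by exists i; apply/existsP; exists j; rewrite !eqxx.
    have F4 x (l : 'I_k.+1) : F 4 x l = (v l == x :> nat).
      apply/existsP/idP => [[l' /andP[vl /eqP/val_inj <-]] //|vl].
      by exists l; rewrite vl eqxx.
    have F5 x (l : 'I_k.+1) : F 5 x l = (v l != x :> nat).
      by rewrite -F4.
    have [] := @theta_right_clique n k top G v F v_inj vG F1 F4 F5.
    apply: (horn_sound cls_sound) hr; first by rewrite /top; case: (dia).
    by move=> g; apply: edge_hyps_leaf => // i j; rewrite F1.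
  (* For a coloured graph, the middle point given by the colouring satisfies all hypotheses but not
     the left disjunct, which therefore stays outside the closure. *)
  - pose F (tag x y : nat) : bool := match tag with
      | 0 => [exists i : 'I_n, exists j : 'I_n, [&& i == x :> nat, j == y :> nat & G i j]]
      | 1 => true
      | 2 => [exists i : 'I_n, (i == x :> nat) && (c i == y :> nat)]
      | 3 => [exists i : 'I_n, (i == x :> nat) && (c i != y :> nat)]
      | _ => false end.
    have F0 (i j : 'I_n) : F 0 i j = G i j.
      apply/existsP/idP => [[i' /existsP[j' /and3P[/eqP/val_inj <- /eqP/val_inj <-]]] //|Gij].
      by exists i; apply/existsP; exists j; rewrite !eqxx.
    have F2 (i : 'I_n) l : F 2 i l = (c i == l :> nat).
      apply/existsP/idP => [[i' /andP[/eqP/val_inj <- ->]] //|ci].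
      by exists i; rewrite eqxx.
    have F3 (i : 'I_n) l : F 3 i l = (c i != l :> nat).
      apply/existsP/idP => [[i' /andP[/eqP/val_inj <- ->]] //|ci].
      by exists i; rewrite eqxx.
    move=> hl; have [] := @theta_left_coloring n k top G c F cG F0 F2 F3.
    apply: (horn_sound cls_sound) hl; first by rewrite /top; case: (dia).
    by move=> g; apply: edge_hyps_leaf => // i j; rewrite F0.
apply: leq_trans bound _; rewrite qE; set N := size (enc_proof ds) in cls_size *.
apply: leq_trans (_ : (K.+1 * N.+1) * (K.+1 * N.+1 * w.+1) <= _).
  have le : (size cls).+1 <= K.+1 * N.+1.
    by apply: leq_ltn_trans cls_size _; rewrite mulSn mulnS; lia.
  by rewrite leq_mul // leq_mul // ltnW.
by rewrite -!mulnn; lia.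
Qed.

(** * Derivations in FL and BPC *)

(** If both fail, [d1] yields a colouring [c] and [d2] a map [v] from [k.+1] indices to vertices.
    Two images of the same colour would give a [p] that satisfies [alpha] or a [q] that satisfies
    [beta], so [c \o v] would inject [k.+1] indices into [k] colours. *)
Lemma theta_pigeonhole n k (d1 d2 : pred nat) :
    (forall i j, i < n -> j < n -> d1 (dvar 0 i j) || d2 (dvar 1 i j)) ->
    (forall i l, i < n -> l < k -> d1 (dvar 2 i l) || d1 (dvar 3 i l)) ->
    (forall i l, i < n -> l < k.+1 -> d2 (dvar 4 i l) || d2 (dvar 5 i l)) ->
  leaf_forces None d1 (transl (alpha k n)) \/ leaf_forces None d2 (transl (beta k.+1 n)).
Proof.
move=> pq ss rr; case: leaf_alpha => na; first by left.
case: leaf_beta => nb; [by right|exfalso].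
have [c cP] : {c : 'I_n -> 'I_k & forall i : 'I_n, d1 (dvar 2 i (c i))}.
  apply: (@choice _ _ (fun (i : 'I_n) (l : 'I_k) => d1 (dvar 2 i l))) => i.
  apply: contrapT => nl; apply: na; left; exists i => // l lk.
  have := ss i l (ltn_ord i) lk; case: (boolP (d1 (dvar 3 i l))) => //.
  by rewrite orbF => _ dl; case: nl; exists (Ordinal lk).
have [v vP] : {v : 'I_k.+1 -> 'I_n & forall l : 'I_k.+1, d2 (dvar 4 (v l) l)}.
  apply: (@choice _ _ (fun (l : 'I_k.+1) (i : 'I_n) => d2 (dvar 4 i l))) => l.
  apply: contrapT => ni; apply: nb; left; exists l => // i iN.
  have := rr i l iN (ltn_ord l); case: (boolP (d2 (dvar 5 i l))) => //.
  by rewrite orbF => _ dl; case: ni; exists (Ordinal iN).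
have key (l m : 'I_k.+1) : l < m -> c (v l) <> c (v m).
  move=> lm cc; have := pq (v l) (v m) (ltn_ord _) (ltn_ord _); case/orP=> d.
    by apply: na; right; exists (v l), (v m), (c (v l)); split; rewrite // cP d cc cP.
  apply: nb; right; exists (v l), (v m), l, m; split; rewrite ?vP ?d //.
  by rewrite lm ltn_ord.
have /leq_card : injective (c \o v).
  move=> l m /= cc; apply: val_inj; case: (ltngtP l m) => // lt; first by case: (key l m).
  by case: (key m l).
by rewrite !card_ord ltnn.
Qed.

Fixpoint positive (f : sform) : bool :=
  match f with
  | Var _ | Con _ => true
  | Bin BMeet g h | Bin BJoin g h => positive g && positive h
  | _ => false
  end.

Lemma positive_bigmeet s : all positive s -> positive (bigmeet s).
Proof. by elim: s => [|f [|g s] IH] //= /andP[-> //]. Qed.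

Lemma positive_bigjoin s : all positive s -> positive (bigjoin s).
Proof. by elim: s => [|f [|g s] IH] //= /andP[-> //]. Qed.

Lemma positive_alpha k n : positive (alpha k n).
Proof.
apply/andP; split; apply/positive_bigjoin/allP.
  by move=> _ /mapP[i _ ->]; apply/positive_bigmeet/allP => _ /mapP[l _ ->].
by move=> _ /allpairsP[[i j] [_ _ ->]]; apply/positive_bigjoin/allP => _ /mapP[l _ ->].
Qed.

Lemma positive_beta m n : positive (beta m n).
Proof.
apply/andP; split; apply/positive_bigjoin/allP.
  by move=> _ /mapP[i _ ->]; apply/positive_bigmeet/allP => _ /mapP[l _ ->].
by move=> _ /allpairsP[[i j] [_ _ ->]]; apply/positive_bigjoin/allP => _ /mapP[l _ ->].
Qed.

Definition selection (cs : seq sform) (ps : seq (sform * sform)) :=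
  all2 (fun c p => (c == p.1) || (c == p.2)) cs ps.

Lemma selection_mem cs ps p : selection cs ps -> p \in ps -> (p.1 \in cs) || (p.2 \in cs).
Proof.
elim: ps cs => // q ps IH [|c cs] //= /andP[cq sel]; rewrite inE => /predU1P[->|/(IH _ sel)].
  by case/orP: cq => /eqP ->; rewrite !inE eqxx ?orbT.
by rewrite !inE => /orP[] ->; rewrite !orbT.
Qed.

Definition switch (p : sform * sform) : sform := ((p.1 ∧ One) ∨ (p.2 ∧ One))%S.

Section Selections.
Variables n k : nat.

Definition edge_pairs := [seq (p_ i j, q_ i j) | i <- iota 0 n, j <- iota 0 n].
Definition colour_pairs := [seq (s_ i l, s'_ i l) | i <- iota 0 n, l <- iota 0 k].
Definition clique_pairs := [seq (r_ i l, r'_ i l) | i <- iota 0 n, l <- iota 0 k.+1].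

Lemma Theta_switch : Theta_nk n k =
  (bigfus [seq switch p | p <- edge_pairs] ⑊
    ((bigfus [seq switch p | p <- colour_pairs] ⑊ alpha k n) ∨
     (bigfus [seq switch p | p <- clique_pairs] ⑊ beta k.+1 n)))%S.
Proof. by rewrite /edge_pairs /colour_pairs /clique_pairs !map_allpairs. Qed.

(* The alternative does not depend on the choices made for the [s] and [r]
   variables, so it can be made before these variables are introduced. *)
Lemma selection_alternative (m : seq sform -> pred nat) cs :
    (forall cs' x, Var x \in cs' ++ cs -> m cs' x) -> selection cs edge_pairs ->
  (forall cs', selection cs' colour_pairs -> leaf_forces None (m cs') (transl (alpha k n))) \/
  (forall cs', selection cs' clique_pairs -> leaf_forces None (m cs') (transl (beta k.+1 n))).
Proof.
move=> mP sel; apply: contrapT => /not_orP[/existsNP[c1 /not_implyP[s1 n1]]].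
move=> /existsNP[c2 /not_implyP[s2 n2]].
have inm c f g x y : (f, g) = (Var x, Var y) -> (f \in c ++ cs) || (g \in c ++ cs) ->
    m c x || m c y.
  by case=> -> -> /orP[] /mP ->; rewrite ?orbT.
have [i j iN jN|i l iN lk|i l iN lk||] := @theta_pigeonhole n k (m c1) (m c2) _ _ _ => //.
- have := selection_mem (p := (p_ i j, q_ i j)) sel.
  rewrite allpairs_f ?mem_iota // => /(_ isT) /orP[] h; apply/orP; [left|right];
  by apply: mP; rewrite mem_cat h orbT.
- have := selection_mem (p := (s_ i l, s'_ i l)) s1.
  rewrite allpairs_f ?mem_iota // => /(_ isT) h; apply: inm erefl _.
  by rewrite !mem_cat; case/orP: h => ->; rewrite ?orbT.
- have := selection_mem (p := (r_ i l, r'_ i l)) s2.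
  rewrite allpairs_f ?mem_iota // => /(_ isT) h; apply: inm erefl _.
  by rewrite !mem_cat; case/orP: h => ->; rewrite ?orbT.
Qed.

End Selections.

Section FLDerivation.
Local Open Scope form_S_scope.
Implicit Types (G S P cs : seq sform) (D : option sform) (f g : sform).

Local Notation fl := (derivable FL_rule).

Lemma fl1 (q c : fl_sequent) : FL_rule [:: q] c -> fl q -> fl c.
Proof. by move=> r qd; apply: Derive r _ => s; rewrite inE => /eqP ->. Qed.

Lemma fl2 (q q' c : fl_sequent) : FL_rule [:: q; q'] c -> fl q -> fl q' -> fl c.
Proof. by move=> r qd qd'; apply: Derive r _ => s; rewrite !inE => /orP[] /eqP ->. Qed.

Lemma fl0 (c : fl_sequent) : FL_rule [::] c -> fl c.
Proof. by move=> r; apply: Derive r _. Qed.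

Definition fl_context cs := [seq f ∧ One | f <- cs].

(** Here the units in the switches act: [FL_1w] inserts [One] anywhere, and [FL_Lmeet2] turns it
    into [f ∧ One]. *)
Lemma fl_weaken G S cs D : fl (G ++ S, D) -> fl (G ++ fl_context cs ++ S, D).
Proof.
move=> d; elim: cs => //= f cs IH.
exact: fl1 (FL_Lmeet2 _ _ _ _ _) (fl1 (FL_1w _ _ _) IH).
Qed.

Lemma fl_context_mem cs f : f \in cs -> fl (fl_context cs, Some f).
Proof.
case/splitPr=> cs1 cs2; rewrite /fl_context map_cat /=.
apply: fl1 (FL_Lmeet1 _ _ _ _ _) _.
apply: (@fl_weaken [::]); rewrite -cat1s -[map _ cs2]cats0 /=.
apply: (@fl_weaken [:: f]); exact: fl0 (FL_id f).
Qed.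

(** Contraction is avoided because [FL_Rmeet] shares its context between the premises; each variable
    at a leaf then discards the rest of the context by [fl_weaken]. *)
Lemma fl_positive cs f : positive f ->
  leaf_forces None (fun x => (Var x : sform) \in cs) (transl f) ->
  fl (fl_context cs, Some f).
Proof.
elim: f => [x|[]|[] g IHg h IHh] //=.
- by move=> _; exact: fl_context_mem.
- move=> _ _; have := @fl_weaken [::] [::] cs (Some One) (fl0 FL_one).
  by rewrite cats0.
- move=> /andP[pg ph] /andP[dg dh].
  exact: fl2 (FL_Rmeet _ _ _) (IHg pg dg) (IHh ph dh).
- move=> /andP[pg ph] /orP[dg|dh].
    exact: fl1 (FL_Rjoin1 _ _ _) (IHg pg dg).
  exact: fl1 (FL_Rjoin2 _ _ _) (IHh ph dh).
Qed.

Lemma fl_bigfus G P D s : fl (G ++ s ++ P, D) -> fl (G ++ bigfus s :: P, D).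
Proof.
elim: s G => [|f [|g s] IH] G //= d; first exact: fl1 (FL_1w _ _ _) d.
apply: fl1 (FL_Lfus _ _ _ _ _) _.
by have := IH (rcons G f); rewrite !cat_rcons; apply.
Qed.

Lemma fl_switches G P D ps :
  (forall cs, selection cs ps -> fl (G ++ fl_context cs ++ P, D)) ->
  fl (G ++ [seq switch p | p <- ps] ++ P, D).
Proof.
elim: ps G => [|p ps IH] G H; first exact: (H [::]).
have step c : (c == p.1) || (c == p.2) ->
    fl (G ++ (c ∧ One) :: [seq switch p | p <- ps] ++ P, D).
  move=> cp; have := IH (rcons G (c ∧ One)); rewrite !cat_rcons; apply=> cs sel.
  by rewrite cat_rcons; apply: (H (c :: cs)); rewrite /= cp.
by apply: fl2 (FL_Ljoin _ _ _ _ _) _ _; apply: step; rewrite eqxx ?orbT.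
Qed.

Lemma fl_residual ps G f :
  (forall cs, selection cs ps -> fl (fl_context cs ++ G, Some f)) ->
  fl (G, Some (bigfus [seq switch p | p <- ps] ⑊ f)).
Proof.
move=> H; apply: fl1 (FL_Runder _ _ _) _.
by apply: (@fl_bigfus [::]); apply: (@fl_switches [::]).
Qed.

Lemma fl_Theta n k : fl ([::], Some (Theta_nk n k)).
Proof.
rewrite Theta_switch; apply: fl_residual => cs sel; rewrite cats0.
have [//|alt|alt] := @selection_alternative n k (fun cs' x => Var x \in cs' ++ cs) cs _ sel.
  apply: fl1 (FL_Rjoin1 _ _ _) _; apply: fl_residual => cs' sel'.
  by rewrite -map_cat; apply: fl_positive (positive_alpha _ _) (alt _ sel').
apply: fl1 (FL_Rjoin2 _ _ _) _; apply: fl_residual => cs' sel'.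
by rewrite -map_cat; apply: fl_positive (positive_beta _ _) (alt _ sel').
Qed.

End FLDerivation.

Section BPCDerivation.
Local Open Scope form_L_scope.
Implicit Types (U X : seq lform) (cs : seq sform) (f g : lform).

Local Notation bpc := (derivable BPC_rule).

Lemma bpc0 (c : bpc_sequent) : BPC_rule [::] c -> bpc c.
Proof. by move=> r; apply: Derive r _. Qed.

Lemma bpc1 (q c : bpc_sequent) : BPC_rule [:: q] c -> bpc q -> bpc c.
Proof. by move=> r qd; apply: Derive r _ => s; rewrite inE => /eqP ->. Qed.

Lemma bpc2 (q q' c : bpc_sequent) : BPC_rule [:: q; q'] c -> bpc q -> bpc q' -> bpc c.
Proof. by move=> r qd qd'; apply: Derive r _ => s; rewrite !inE => /orP[] /eqP ->. Qed.

Lemma bpc_permL U U' X : Permutation U U' -> bpc (U, X) -> bpc (U', X).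
Proof. by move=> p; apply: bpc1 (BPC_exchange p (Permutation_refl X)). Qed.

Lemma bpc_positive U X (f : sform) : positive f ->
  leaf_forces None (fun x => Var x \in U) (transl f) -> bpc (U, transl f :: X).
Proof.
elim: f X => [x|[]|[] g IHg h IHh] X //=.
- move=> _ /splitPr[U1 U2]; apply: bpc_permL (Permutation_middle _ _ _) _.
  exact: bpc0 (BPC_id _ _ _).
- by move=> _ _; exact: bpc0 (BPC_top _ _).
- move=> /andP[pg ph] /andP[dg dh].
  exact: bpc2 (BPC_Rand _ _ _ _) (IHg X pg dg) (IHh X ph dh).
- move=> /andP[pg ph] dgh; apply: bpc1 (BPC_Ror _ _ _ _) _.
  case/orP: dgh => [dg|dh]; first exact: IHg.
  apply: bpc1 (BPC_exchange (Permutation_refl U) (perm_swap _ _ _)) _.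
  exact: IHh.
Qed.

(** On the empty list the translated fusion is [Top], for which the calculus has no left rule. *)
Lemma bpc_bigfus U X (s : seq sform) : s != [::] ->
  bpc (map transl s ++ U, X) -> bpc (transl (bigfus s) :: U, X).
Proof.
elim: s U => // f [|g s] IH U _ // d; apply: bpc1 (BPC_Land _ _ _ _) _.
apply: bpc_permL (perm_swap _ _ _) _; apply: (IH (transl f :: U)) => //.
exact: bpc_permL (@Permutation_middle _ (map transl (g :: s)) U (transl f)) d.
Qed.

(** [BPC_Land] splits each chosen [transl c ∧ Top] in two, and [Top] stays in the context. *)
Definition bpc_context cs : seq lform := flatten [seq [:: transl c; Top] | c <- cs].

Lemma bpc_switches U X ps :
  (forall cs, selection cs ps -> bpc (bpc_context cs ++ U, X)) ->
  bpc ([seq transl (switch p) | p <- ps] ++ U, X).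
Proof.
elim: ps U => [|p ps IH] U H; first exact: (H [::]).
have step c : (c == p.1) || (c == p.2) ->
    bpc ((transl c ∧ Top) :: [seq transl (switch p) | p <- ps] ++ U, X).
  move=> cp; apply: bpc1 (BPC_Land _ _ _ _) _.
  have pm V : Permutation (V ++ [:: transl c; Top] ++ U) ([:: transl c; Top] ++ V ++ U).
    exact: (@Permutation_app_swap_app _ V [:: transl c; Top] U).
  apply: bpc_permL (pm _) _; apply: IH => cs sel.
  apply: bpc_permL (Permutation_sym (pm _)) _.
  by apply: (H (c :: cs)); rewrite /= cp.
by apply: bpc2 (BPC_Lor _ _ _ _) _ _; apply: step; rewrite eqxx ?orbT.
Qed.

Lemma bpc_imp ps U X f : ps != [::] ->
  (forall cs, selection cs ps -> bpc (bpc_context cs ++ U, [:: f])) ->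
  bpc (U, (transl (bigfus [seq switch p | p <- ps]) → f) :: X).
Proof.
move=> ps0 H; apply: bpc1 (BPC_Rimp _ _ _ _) _; apply: bpc_bigfus.
  by case: ps ps0 {H}.
by rewrite -map_comp; apply: bpc_switches.
Qed.

Lemma bpc_Theta n k : 0 < n -> 0 < k -> bpc ([::], [:: transl (Theta_nk n k)]).
Proof.
move=> n0 k0; have pairs_neq0 (h : nat -> nat -> sform * sform) m : 0 < m ->
    [seq h i l | i <- iota 0 n, l <- iota 0 m] != [::].
  by move=> m0; rewrite -size_eq0 size_allpairs !size_iota; lia.
rewrite Theta_switch; apply: bpc_imp => [|cs sel]; first exact: pairs_neq0.
rewrite cats0; apply: bpc1 (BPC_Ror _ _ _ _) _.
have ctxP cs' x : Var x \in cs' -> Var x \in bpc_context cs'.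
  by move=> xc; apply/flatten_mapP; exists (Var x); rewrite // mem_head.
have [cs' x||alt|alt] := @selection_alternative n k
  (fun cs' x => Var x \in bpc_context cs' ++ bpc_context cs) cs => //.
- by rewrite !mem_cat => /orP[] /ctxP ->; rewrite ?orbT.
- apply: bpc_imp => [|cs' sel']; first exact: pairs_neq0.
  exact: bpc_positive (positive_alpha _ _) (alt _ sel').
(* [BPC_Rimp] erases the rest of the succedent, so the right disjunct is first moved to its head. *)
apply: bpc1 (BPC_exchange (Permutation_refl _) (perm_swap _ _ _)) _.
apply: bpc_imp => [|cs' sel']; first exact: pairs_neq0.
exact: bpc_positive (positive_beta _ _) (alt _ sel').
Qed.

End BPCDerivation.

(** * Asymptotics *)

Import Order.TTheory GRing.Theory Num.Theory.

Lemma horner_nat_bound (g : {poly nat}) :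
  exists C D, forall x, g.[x]%R <= C * x.+1 ^ D.
Proof.
rewrite /horner; elim: (polyseq g) => [|a s [C [D H]]] /=; first by exists 0, 0.
exists (C + a), D.+1 => x; have := H x; set y := horner_rec s x => le.
have x1 : 0 < x.+1 ^ D by rewrite expn_gt0.
rewrite -[(_ + _)%R]/(y * x + a) expnS; set z := x.+1 ^ D in le x1 *.
nia.
Qed.

Lemma root16 n : exists t, t ^ 16 <= n < t.+1 ^ 16.
Proof.
have ex : exists t, t ^ 16 <= n by exists 0.
have bd t : t ^ 16 <= n -> t <= n.
  by apply: leq_trans; case: t => // t; rewrite -{1}[t.+1]expn1 leq_pexp2l.
case: (ex_maxnP ex bd) => t tn tmax; exists t; rewrite tn ltnNge; apply/negP.
by move/tmax; rewrite ltnn.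
Qed.

(** The witness is one less than [t %/ E]: smaller than [t] by a factor of about [E], yet its square
    exceeds [t] once [t] is large against [E]. *)
Lemma quotient_bounds E t : 0 < E -> E * (2 * E + 1) < t ->
  exists m, [/\ 2 * E <= m, E * m + E <= t & t < m * m].
Proof.
move=> E0 tE; have tdiv := divn_eq t E; have tmod : t %% E < E by rewrite ltn_mod.
have uE : 2 * E + 1 <= t %/ E by rewrite leq_divRL // mulnC ltnW.
exists (t %/ E).-1; move: tdiv tmod uE; case: (t %/ E) => [|m]; first by rewrite addn1.
by move=> tE' tmod uE; rewrite mulSn in tE'; split=> /=; nia.
Qed.

(** With [E > C] and [E >= D], a size [s < 2 ^ m] would give
    [C * s.+1 ^ D < 2 ^ (E * m + E) <= 2 ^ t]. Since [n < t.+1 ^ 16] and [t < m * m], also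
    [n <= m ^ 32]. *)
Lemma exponential_of_polynomial_bound C D : exists N, forall n s, N <= n ->
    (forall t, 1 < t -> t ^ 16 <= n -> 2 ^ t <= C * s.+1 ^ D) ->
  exists2 m, n <= m ^ 32 & 2 ^ m <= s.
Proof.
have [E [E0 CE DE]] : exists E, [/\ 0 < E, C < E & D <= E].
  by exists (C + D).+1; split; lia.
exists ((E * (2 * E + 1)).+2 ^ 16) => n s nN H.
have [t /andP[tn nt]] := root16 n.
have tE : E * (2 * E + 1) < t.
  have : (E * (2 * E + 1)).+2 ^ 16 < t.+1 ^ 16 by apply: leq_ltn_trans nt.
  by rewrite ltn_exp2r // ltnS; exact: ltnW.
have t1 : 1 < t by apply: leq_ltn_trans tE; rewrite muln_gt0 E0 addn1.
have {t1 tn} H := H t t1 tn.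
have [m [mE mt tm]] := quotient_bounds E0 tE; exists m.
  rewrite -[32]/(2 * 16) expnM; apply: ltnW; apply: leq_trans nt _.
  by rewrite leq_exp2r // -mulnn.
rewrite leqNgt; apply/negP => sm; move: H; apply/negP; rewrite -ltnNge.
apply: (@leq_ltn_trans (2 ^ C * (2 ^ m) ^ D)).
  rewrite leq_mul ?(ltnW (ltn_expl _ _)) //.
  by case: (D) => // D'; rewrite leq_exp2r.
rewrite -expnM -expnD ltn_exp2l //; apply: leq_trans mt.
by rewrite addnC -addnS leq_add // mulnC leq_mul2r DE orbT.
Qed.

Lemma exponential_length_of_bound (R : realType) (A : finType) (X : Type)
    (P : seq A -> X) (f : nat -> X) C D :
  (forall n t p, 1 < t -> t ^ 16 <= n -> P p = f n -> 2 ^ t <= C * (size p).+1 ^ D) ->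
  exponential_length R P f.
Proof.
move=> H; have [N HN] := exponential_of_polynomial_bound C D.
exists (32%:R^-1)%R; first by rewrite invr_gt0 ltr0n.
exists N => n nN p pf; have [t t1 tn|m nm ms] := HN n (size p) nN; first exact: H pf.
have m0 : (0 <= m%:R :> R)%R by exact: ler0n.
have nm' : (n%:R `^ 32%:R^-1 <= m%:R :> R)%R.
  apply: (@le_trans _ _ ((m%:R ^+ 32) `^ 32%:R^-1)%R).
    rewrite ge0_ler_powR // ?nnegrE ?invr_ge0 ?ler0n ?exprn_ge0 //.
    by rewrite -natrX ler_nat.
  by rewrite -powR_mulrn // -powRrM mulfV ?pnatr_eq0 // powRr1.
apply: (@le_trans _ _ (2 `^ m%:R)%R); first by rewrite ler_powR // ler1n.
by rewrite powR_mulrn ?ler0n // -natrX ler_nat.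
Qed.

Lemma simulated_bound (A A' : finType) (X Y : Type) (tr : X -> Y)
    (P : seq A -> X) (Q : seq A' -> Y) (f : nat -> X) (C : nat) :
  simulated tr P Q ->
  (forall n t q, 1 < t -> t ^ 16 <= n -> Q q = tr (f n) -> 2 ^ t <= C * (size q).+1 ^ 2) ->
  exists C' D, forall n t p, 1 < t -> t ^ 16 <= n -> P p = f n ->
    2 ^ t <= C' * (size p).+1 ^ D.
Proof.
move=> [g gP] H; have [Cg [Dg gle]] := horner_nat_bound g.
exists (C * Cg.+1 ^ 2), (Dg * 2) => n t p t1 tn pf.
have [q [trq sq]] := gP p; have := H n t q t1 tn; rewrite -trq pf => /(_ erefl) le.
apply: leq_trans le _; rewrite -mulnA leq_mul2l expnM -expnMn leq_exp2r //.
apply/orP; right; apply: leq_ltn_trans (leq_trans sq (gle _)) _.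
by have : 0 < (size p).+1 ^ Dg by [rewrite expn_gt0]; nia.
Qed.

Theorem theorem5p1 (R : realType) (D : set lform -> lform -> Prop)
    (rules : seq frege_rule)
    (HD : super_intuitionistic D)
    (Hbranch : infinite_branching (logic_of D))
    (Hfrege : frege_system D rules) :
  (forall (A : finType) (LP : set sform) (P : seq A -> sform),
     is_logic LP ->
     proof_system P LP ->
     at_least_as_strong id P FL ->
     simulated transl P (EF rules) ->
     (forall n : nat, (1 <= n)%N -> exists p : seq A, P p = Theta n) /\
     exponential_length R P Theta) /\
  (forall (A : finType) (LP : set lform) (P : seq A -> lform),
     is_logic LP ->
     proof_system P LP ->
     at_least_as_strong id P BPC ->
     simulated id P (EF rules) ->
     (forall n : nat, (1 <= n)%N ->
        exists p : seq A, P p = transl (Theta n)) /\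
     exponential_length R P (fun n : nat => transl (Theta n))).
Proof.
have [C bound] := theta_ef_bound HD Hbranch Hfrege.
split=> A LP P _ _ strong sim; split.
- move=> n _; have [q] := strong (exist _ _ (fl_Theta n (Nat.sqrt n))).
  by exists q.
- have [C' [D' H]] := simulated_bound sim bound.
  exact: exponential_length_of_bound H.
- move=> n n0; have k0 : 0 < Nat.sqrt n.
    have := PeanoNat.Nat.sqrt_le_mono 1 n (elimT ssrnat.leP n0).
    by move/ssrnat.leP.
  have [q] := strong (exist _ _ (bpc_Theta n0 k0)).
  by exists q.
- have [C' [D' H]] := simulated_bound sim bound.
  exact: exponential_length_of_bound H.
Qed.
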